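(* Let $k$ be an algebraically closed field of characteristic $p>0$, let $A=\mathbb{A}_k^2$ with origin $0$, let $E$ be a prime divisor over $A$ with center at $0$, and let $\mathfrak{a},\mathfrak{a}_1,\ldots,\mathfrak{a}_r\subset k[x_1,x_2]$ be non-zero ideals. Then there exists a prime divisor $\widetilde E$ over the affine plane $\widetilde A=\mathbb{A}_{\mathbb{C}}^2$ with center at the origin satisfying the following: (i) $k_E=k_{\widetilde E}$; (ii) there exists a lifting $\widetilde{\mathfrak{a}}\subset \mathbb{C}[x_1,x_2]$ of $\mathfrak{a}$ satisfying $v_E(\mathfrak{a})=v_{\widetilde E}(\widetilde{\mathfrak{a}})$; (iii) there exist liftings $\widetilde{\mathfrak{a}}_i\subset \mathbb{C}[x_1,x_2]$ of $\mathfrak{a}_i$ $(i=1,\ldots,r)$ such that $v_E(\mathfrak{a}_i)=v_{\widetilde E}(\widetilde{\mathfrak{a}}_i)$ for all $i$, and for every multi-ideal $\mathfrak{a}^e:=\mathfrak{a}_1^{e_1}\cdots\mathfrak{a}_r^{e_r}$ $(e_i\in\mathbb{R}_{>0})$ on $A$, the lifting $\widetilde{\mathfrak{a}}^e=\widetilde{\mathfrak{a}}_1^{e_1}\cdots\widetilde{\mathfrak{a}}_r^{e_r}$ of $\mathfrak{a}^e$ on $\widetilde A$ satisfies \[ a(E;A,\mathfrak{a}^e)=a(\widetilde E;\widetilde A,\widetilde{\mathfrak{a}}^e). \]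
   Context: Skeletons. Let $F$ be a field of characteristic $q\ge 0$ and $R$ an integral domain that is a finitely generated $F$-algebra. A subring $S\subset R$ is a skeleton of $R$ if $S$ is a finitely generated $\mathbb{Z}/(q)$-subalgebra of $R$ (so a finitely generated $\mathbb{Z}$-subalgebra if $q=0$) with $F[S]=R$. Let $k$ have characteristic $p>0$, $K$ characteristic $0$, $R$ a finitely generated $k$-algebra, $\widetilde R$ a finitely generated $K$-algebra. Skeletons $S\subset R$, $\widetilde S\subset\widetilde R$ are compatible if $\widetilde S$ is $\mathbb{Z}$-flat at $p$ and $S\simeq\widetilde S\otimes_{\mathbb{Z}}\mathbb{Z}/(p)$; the canonical surjection is $\Phi_p:\widetilde S\to S$. For polynomial rings one uses compatible skeletons $\Sigma\subset k$, $\widetilde\Sigma\subset\mathbb{C}$ and the induced compatible skeletons $\Sigma[x_1,x_2]$, $\widetilde\Sigma[x_1,x_2]$ (with $\Phi_p$ acting on coefficients); skeletons may be enlarged to contain any given finite set of elements. Liftings of ideals. An ideal $\widetilde{\mathfrak{a}}\subset\widetilde R$ is a lifting of an ideal $\mathfrak{a}\subset R$ if $\widetilde{\mathfrak{a}}$ has a system of generators contained in $\widetilde S$ whose image under $\Phi_p$ generates $\mathfrak{a}\subset R$. A common pair of compatible skeletons is used within one discussion. Prime divisors. A prime divisor $E$ over a normal variety $A$ is an irreducible divisor $E$ on a normal variety $A'$ with a proper birational morphism $\varphi:A'\to A$, up to identification of divisors $E_1\subset A_1$, $E_2\subset A_2$ when the induced birational map $A_1\dashrightarrow A_2$ is a local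 isomorphism at their generic points (equivalently, the corresponding divisorial valuation $v_E$). $E$ has center at $P$ if $P$ is the generic point of $\varphi(E)$. $k_E$ is the coefficient of $K_{A'/A}$ at $E$, and $v_E(\mathfrak{a}):=\min\{v_E(f)\mid f\in\mathfrak{a}\}$. Multi-ideals. A multi-ideal $\mathfrak{a}^e=\mathfrak{a}_1^{e_1}\cdots\mathfrak{a}_r^{e_r}$ is a formal product of non-zero ideals with exponents $e=(e_1,\dots,e_r)\in\mathbb{R}_{>0}^r$. The log discrepancy is $a(E;A,\mathfrak{a}^e):=k_E+1-\sum_{i=1}^r e_i v_E(\mathfrak{a}_i)$. *)

(* Defs.v *)
From HB Require Import structures.
From mathcomp Require Import all_boot all_order all_algebra.
From mathcomp Require Import generic_quotient mpoly complex.
From mathcomp Require Import boolp classical_sets reals.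

Set Implicit Arguments.
Unset Strict Implicit.
Unset Printing Implicit Defensive.

Import Order.TTheory GRing.Theory Num.Theory.
Local Open Scope classical_set_scope.
Local Open Scope ring_scope.

Section Rings.
Variable T : comNzRingType.
Implicit Types (B I P : set T).

Definition is_subring B : Prop :=
  [/\ B 1, forall x y, B x -> B y -> B (x - y)
    & forall x y, B x -> B y -> B (x * y)].

Definition ring_generated (G : set T) : set T := smallest is_subring G.

Definition is_ideal B I : Prop :=
  [/\ I `<=` B, I 0 & forall a x y, B a -> I x -> I y -> I (a * x + y)].

Definition ideal_generated B (G : set T) : set T := smallest (is_ideal B) G.

Definition is_nonzero_ideal I : Prop :=
  is_ideal setT I /\ exists2 f, I f & f != 0.

Definition is_prime B P : Prop :=
  [/\ is_ideal B P, ~ P 1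
    & forall a b, B a -> B b -> P (a * b) -> P a \/ P b].

Definition height_one B P : Prop :=
  [/\ is_prime B P, P <> [set 0]
    & forall Q, is_prime B Q -> Q `<=` P -> Q = [set 0] \/ Q = P].

End Rings.

Section Subrings_of_fields.
Variable L : fieldType.
Implicit Types (B V P : set L).

Definition localization B P : set L :=
  [set x | exists a b, [/\ B a, B b, ~ P b & x = a / b]].

Definition integrally_closed B : Prop :=
  forall x (q : {poly L}),
    q \is monic -> (forall i, B q`_i) -> root q x -> B x.

Definition valuation_ring V : Prop :=
  is_subring V /\ forall x, V x \/ V x^-1.

(* The prime of B cut out by the maximal ideal of the valuation ring V. *)
Definition center_on B V : set L :=
  [set b | B b /\ (b = 0 \/ ~ V b^-1)].

(* The value v 0 is irrelevant. *)
Definition normalized_valuation_of (O : set L) (v : L -> int) : Prop :=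
  [/\ forall x y, x != 0 -> y != 0 -> v (x * y) = v x + v y,
      exists2 t, t != 0 & v t = 1
    & forall x, x != 0 -> (O x <-> 0 <= v x)].

End Subrings_of_fields.

Section Plane.
Variable k : fieldType.

Notation kx := {mpoly k[2]}.
Notation kX := {fraction {mpoly k[2]}}.

Definition coord_ring : set kX := range (@tofrac kx).

(* Spec B is a normal affine variety with a birational morphism to the plane:
   B is finitely generated over k[x1,x2] and integrally closed in k(x1,x2). *)
Definition affine_chart (B : set kX) : Prop :=
  (exists s : seq kX, B = ring_generated (coord_ring `|` [set` s]))
  /\ integrally_closed B.

(* A normal variety A' with a proper birational morphism to the plane A, as a
   model in the sense of Zariski: A' is covered by the affine varieties
   Spec (chart i), glued along their common local rings in k(x1,x2). Every
   valuation ring over A has a center on A' (properness), and that center is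
   the same on all the charts that contain it (separatedness). *)
Record normal_model := NormalModel {
  model_size : nat;
  chart : 'I_model_size -> set kX;
  chartP : forall i, affine_chart (chart i);
  model_proper : forall V, valuation_ring V -> coord_ring `<=` V ->
    exists i, chart i `<=` V;
  model_separated : forall V i j, valuation_ring V ->
    chart i `<=` V -> chart j `<=` V ->
    localization (chart i) (center_on (chart i) V) =
    localization (chart j) (center_on (chart j) V)
}.

(* An irreducible divisor E on some such A', given by the height one prime that
   defines it on a chart meeting E, together with the valuation v_E. *)
Record prime_divisor := PrimeDivisor {
  pd_model : normal_model;
  pd_chart : 'I_(model_size pd_model);
  pd_prime : set kX;
  pd_height_one : height_one (chart pd_chart) pd_prime;
  pd_val : kX -> int;
  pd_valP : normalized_valuation_of
    (localization (chart pd_chart) pd_prime) pd_val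
}.

Definition pd_local_ring (E : prime_divisor) : set kX :=
  localization (chart (pd_chart E)) (pd_prime E).

(* The generic point of E maps to the origin: pd_prime E contracts to the
   ideal (x1, x2) of k[x1,x2]. *)
Definition centered_at_origin (E : prime_divisor) : Prop :=
  forall f : kx, pd_prime E (tofrac f) <-> f.@[fun _ => 0] = 0.

(* The extension of the i-th partial derivative to k(x1,x2). *)
Definition fderiv (i : 'I_2) (x : kX) : kX :=
  let f := (frac (repr x)).1 in let g := (frac (repr x)).2 in
  tofrac (f^`M(i) * g - f * g^`M(i)) / tofrac g ^+ 2.

(* da /\ db = jacobian a b * (dx1 /\ dx2) *)
Definition jacobian (a b : kX) : kX :=
  fderiv 0 a * fderiv 1 b - fderiv 1 a * fderiv 0 b.

(* The image of the canonical module /\^2 Omega_{O/k} in the one-dimensional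
   space of rational 2-forms, with h standing for h * (dx1 /\ dx2). *)
Definition canonical_module (O : set kX) : set kX :=
  [set h | exists s : seq (kX * kX * kX),
     (forall t, t \in s -> [/\ O t.1.1, O t.1.2 & O t.2])
     /\ h = \sum_(t <- s) t.1.1 * jacobian t.1.2 t.2].

(* The coefficient of E in the divisor of the pull-back of dx1 /\ dx2: if
   h * (dx1 /\ dx2) generates the canonical module at E, then it is v_E(1/h).
   For k perfect, A' is smooth over k at the generic point of E, so that this
   module is free of rank one and the coefficient is well defined. *)
Definition discrepancy (E : prime_divisor) : int :=
  xget 0 [set n | exists h, [/\ h != 0,
    canonical_module (pd_local_ring E) =
      [set c * h | c in pd_local_ring E]
    & n = pd_val E h^-1]].

(* The minimum of v_E on the nonzero elements of I. *)
Definition val_ideal (E : prime_divisor) (I : set kx) : int :=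
  xget 0 [set n |
    (exists f, [/\ I f, f != 0 & pd_val E (tofrac f) = n])
    /\ forall f, I f -> f != 0 -> n <= pd_val E (tofrac f)].

Definition log_discrepancy (R : realType) (E : prime_divisor) (r : nat)
    (a : 'I_r -> set kx) (e : 'I_r -> R) : R :=
  (discrepancy E)%:~R + 1 - \sum_(i < r) e i * (val_ideal E (a i))%:~R.

End Plane.

(* S is generated by finitely many elements as a ring, equivalently as an
   algebra over the prime ring Z/(q), and F[S] = A. *)
Definition skeleton (F : fieldType) (A : comAlgType F) (S : set A) : Prop :=
  (exists s : seq A, S = ring_generated [set` s])
  /\ ring_generated (range (fun c : F => c%:A) `|` S) = setT.

(* A Z-module is flat at the prime p iff it has no p-torsion. *)
Definition flat_at (p : nat) (A : comNzRingType) (S : set A) : Prop :=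
  forall x, S x -> x *+ p = 0 -> x = 0.

(* Phi is only meaningful on St, where it is the canonical surjection
   St -> St / p St = S; its values outside of St are irrelevant. *)
Definition compatible_skeletons (p : nat) (F Ft : fieldType)
    (A : comAlgType F) (At : comAlgType Ft)
    (S : set A) (St : set At) (Phi : At -> A) : Prop :=
  [/\ skeleton S, skeleton St, flat_at p St,
      [/\ Phi 1 = 1,
          forall x y, St x -> St y -> Phi (x + y) = Phi x + Phi y
        & forall x y, St x -> St y -> Phi (x * y) = Phi x * Phi y]
    & [set Phi x | x in St] = S /\
      forall x, St x -> (Phi x = 0 <-> exists2 y, St y & x = y *+ p)].

Definition is_lifting (A At : comNzRingType) (St : set At) (Phi : At -> A)
    (It : set At) (I : set A) : Prop :=
  exists G : set At, [/\ G `<=` St, It = ideal_generated setT G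
    & I = ideal_generated setT [set Phi g | g in G]].

Definition mpoly_skeleton (n : nat) (A : comNzRingType) (S : set A) :
    set {mpoly A[n]} :=
  [set f | forall m, S f@_m].

Definition mpoly_reduction (n : nat) (A At : comNzRingType) (Phi : At -> A)
    (f : {mpoly At[n]}) : {mpoly A[n]} :=
  \sum_(m <- msupp f) Phi f@_m *: 'X_[m].

(* Main.v *)
(* A prime divisor E over the plane with center at the origin is the exceptional
   curve of the last of finitely many blow ups of points (Zariski). Let s be the
   sequence of their centers. The discrepancy of E depends only on the shape of
   s, that is on which centers lie on the coordinate axes, and so does the
   colength of every valuation ideal V_n = {f | v_E(f) >= n}.
     Choose compatible skeletons containing s and finitely many coefficients, lift
   s without changing its shape, and let Et be the divisor of the lifted
   sequence. Take polynomials e_j that are independent modulo V_n, as many as the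
   colength of V_n. They lift to polynomials independent modulo the ideal Vt_n of
   Et, hence generating the quotient, as the colength is the same. By Cramer's
   rule every f in V_n then has, up to a nonzero constant, a lift det * f - sum
   c_j e_j in Vt_n with all c_j in the kernel of the reduction. For n = v_E(a)
   this lifts generators of a to elements of value at least n, whereas reduction
   can only increase the value. *)
Require Import Defs.
From HB Require Import structures.
From mathcomp Require Import all_boot all_order all_algebra.
From mathcomp Require Import polyXY zify ring lra.
From mathcomp Require Import mpoly complex boolp classical_sets reals.

Set Implicit Arguments.
Unset Strict Implicit.
Unset Printing Implicit Defensive.

Import Order.TTheory GRing.Theory Num.Theory.
Local Open Scope classical_set_scope.
Local Open Scope ring_scope.

(* {poly {poly A}} is the ring A[x1, x2], with 'X for x1 and 'Y for x2. *)
Local Notation "'Y" := ('X%:P) : ring_scope.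

(** * Substitutions in two variables and blow ups *)

(** No colength is ever computed. One induction over the sequence yields a finite set that indexes
    both a family over [k] independent modulo the valuation ideal and a family of linear forms over
    [K] whose common zeros lie in the lifted ideal; the lifting needs just these two inequalities.
    As [k] may contain transcendental elements, the skeleton is built from the integers by adjoining
    lifts of elements of [k] one at a time. The obstacle is to keep the kernel of the reduction
    equal to p times the ring. A transcendental element calls for an element of [C] transcendental
    over the skeleton, found by counting; an algebraic one calls for a monic equation, hence for a
    localization. That blowing up reaches E rests on an element with transcendental residue,
    obtained from a derivation and from p-th roots in [k]; the value of its numerator then drops at
    each blow up. Discrepancies are compared through the local ring of E, which the valuation
    determines: the Jacobian of the last coordinates generates its canonical module. For the lifted
    divisor a model has to be exhibited, with normal charts that are proper and separated over the
    plane. *)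

Definition pp (A : comNzRingType) : comNzRingType := {poly {poly A}}.

Definition CC {A : comNzRingType} (c : A) : {poly {poly A}} := c%:P%:P.

Lemma CC_zmod_morphism A : zmod_morphism (@CC A).
Proof. by move=> c d; rewrite /CC !rmorphB. Qed.

Lemma CC_monoid_morphism A : monoid_morphism (@CC A).
Proof. by split=> [|c d]; rewrite /CC ?rmorph1 ?rmorphM. Qed.

HB.instance Definition _ A :=
  GRing.isZmodMorphism.Build _ _ (@CC A) (@CC_zmod_morphism A).
HB.instance Definition _ A :=
  GRing.isMonoidMorphism.Build _ _ (@CC A) (@CC_monoid_morphism A).

Section Evaluation.
Variables (A B : comNzRingType).

(** The lock keeps simplification and unification from unfolding a substitution into the two
    polynomial maps that compose it. *)
Fact ev2_key : unit. Proof. by []. Qed.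
Definition ev2 (h : {rmorphism A -> B}) (a b : B) : {poly {poly A}} -> B :=
  locked_with ev2_key
    (horner_eval a \o map_poly (horner_eval b \o map_poly h)).

Lemma ev2_zmod_morphism h a b : zmod_morphism (ev2 h a b).
Proof. by move=> f g; rewrite /ev2 unlock rmorphB. Qed.

Lemma ev2_monoid_morphism h a b : monoid_morphism (ev2 h a b).
Proof.
by split=> [|f g]; rewrite /ev2 unlock ?rmorph1 ?rmorphM.
Qed.

HB.instance Definition _ h a b :=
  GRing.isZmodMorphism.Build _ _ (ev2 h a b) (ev2_zmod_morphism h a b).
HB.instance Definition _ h a b :=
  GRing.isMonoidMorphism.Build _ _ (ev2 h a b) (ev2_monoid_morphism h a b).

Lemma ev2X h a b : ev2 h a b 'X = a.
Proof. by rewrite /ev2 unlock /= map_polyX /horner_eval hornerX. Qed.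

Lemma ev2C h a b (g : {poly A}) : ev2 h a b g%:P = (map_poly h g).[b].
Proof. by rewrite /ev2 unlock /= map_polyC /horner_eval /= hornerC. Qed.

Lemma ev2Y h a b : ev2 h a b 'Y = b.
Proof. by rewrite ev2C map_polyX hornerX. Qed.

Lemma ev2CC h a b c : ev2 h a b (CC c) = h c.
Proof. by rewrite ev2C map_polyC hornerC. Qed.

(** The universal property of A[x1, x2]: identities between substitutions below are checked on
    constants and on the two variables. *)
Lemma ev2_unique (h : {rmorphism A -> B}) a b
    (psi : {rmorphism {poly {poly A}} -> B}) :
  (forall c, psi (CC c) = h c) -> psi 'X = a -> psi 'Y = b ->
  psi =1 ev2 h a b.
Proof.
move=> hC hX hY.
have hg g : psi g%:P = ev2 h a b g%:P.
  elim/poly_ind: g => [|g c IH]; first by rewrite !rmorph0.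
  by rewrite !(rmorphD, rmorphM) /= IH hC hY ev2Y ev2CC.
elim/poly_ind => [|f g IH]; first by rewrite !rmorph0.
by rewrite !(rmorphD, rmorphM) /= IH hX hg ev2X.
Qed.

End Evaluation.

Lemma CCN (A : comNzRingType) (c : A) : CC (- c) = - CC c.
Proof. by rewrite /CC !polyCN. Qed.

Definition map2 {A B : comNzRingType} (h : {rmorphism A -> B}) :
    {poly {poly A}} -> {poly {poly B}} := map_poly (map_poly h).
HB.instance Definition _ (A B : comNzRingType) (h : {rmorphism A -> B}) :=
  GRing.RMorphism.on (map2 h).

Section Map2.
Variables (A B : comNzRingType) (h : {rmorphism A -> B}).

Lemma coef_map2 f i j : (map2 h f)`_i`_j = h f`_i`_j.
Proof. by rewrite /map2 !coef_map. Qed.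

Lemma map2X : map2 h 'X = 'X.
Proof. by rewrite /map2 map_polyX. Qed.

Lemma map2C g : map2 h g%:P = (map_poly h g)%:P.
Proof. by rewrite /map2 map_polyC. Qed.

End Map2.

Section Substitution.
Variable A : comNzRingType.
Local Notation PP := {poly {poly A}}.

Definition sub2 (p q : PP) : PP -> PP := @ev2 A (pp A) CC p q.
HB.instance Definition _ p q := GRing.RMorphism.on (sub2 p q).

Lemma sub2X p q : sub2 p q 'X = p. Proof. exact: ev2X. Qed.
Lemma sub2Y p q : sub2 p q 'Y = q. Proof. exact: ev2Y. Qed.
Lemma sub2CC p q c : sub2 p q (CC c) = CC c. Proof. exact: ev2CC. Qed.

Lemma sub2_unique p q (psi : {rmorphism PP -> PP}) :
  (forall c, psi (CC c) = CC c) -> psi 'X = p -> psi 'Y = q ->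
  psi =1 sub2 p q.
Proof. exact: (@ev2_unique A (pp A) CC). Qed.

Lemma ev2_sub2 (B : comNzRingType) (h : {rmorphism A -> B}) a b p q f :
  ev2 h a b (sub2 p q f) = ev2 h (ev2 h a b p) (ev2 h a b q) f.
Proof.
apply: (@ev2_unique A B h _ _ (ev2 h a b \o sub2 p q)) => [c||] /=.
- by rewrite sub2CC ev2CC.
- by rewrite sub2X.
- by rewrite sub2Y.
Qed.

Lemma sub2_sub2 p q p' q' f :
  sub2 p' q' (sub2 p q f) = sub2 (sub2 p' q' p) (sub2 p' q' q) f.
Proof. exact: (@ev2_sub2 (pp A)). Qed.

Lemma sub2_id f : sub2 'X 'Y f = f.
Proof. by rewrite -(@sub2_unique 'X 'Y idfun). Qed.

Lemma swapXY_sub2 f : swapXY f = sub2 'Y 'X f.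
Proof.
rewrite -(@sub2_unique 'Y 'X swapXY) // => [c||].
- exact: (etrans (swapXY_polyC _) (map_polyC _ _)).
- exact: swapXY_X.
- exact: swapXY_Y.
Qed.

(* Blow up of the origin, in the chart with coordinates x = x1 and y = x2/x1 - c
   centered at the next center; s.1 tells whether x1 and x2 are exchanged first,
   and s.2 is c. *)
Definition step (s : bool * A) : PP -> PP :=
  let t := 'X * ('Y + CC s.2) in
  sub2 (if s.1 then t else 'X) (if s.1 then 'X else t).
HB.instance Definition _ s := GRing.RMorphism.on (step s).

Definition blow : PP -> PP := sub2 'X ('X * 'Y).
HB.instance Definition _ := GRing.RMorphism.on blow.

Definition trans (c : A) : PP -> PP := map_poly (comp_poly ('X + c%:P)).
HB.instance Definition _ c := GRing.RMorphism.on (trans c).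

Lemma trans_sub2 c f : trans c f = sub2 'X ('Y + CC c) f.
Proof.
rewrite -(@sub2_unique 'X ('Y + CC c) (trans c)) // => [d||].
- exact: (etrans (map_polyC _ _) (congr1 _ (comp_polyC _ _))).
- exact: map_polyX.
- apply: (etrans (map_polyC _ _)).
  by rewrite /= comp_polyX polyCD.
Qed.

(** In this form only [blow] changes multiplicities into powers of x1; [trans] acts on each
    coefficient in x1 separately. *)
Lemma stepE s f :
  step s f = trans s.2 (blow (if s.1 then swapXY f else f)).
Proof.
have E g : trans s.2 (blow g) = sub2 'X ('X * ('Y + CC s.2)) g.
  rewrite trans_sub2 /blow sub2_sub2 sub2X; congr (sub2 _ _ g).
  by rewrite rmorphM /= sub2X sub2Y.
case: s E => [[] c] /= E; rewrite E /step //=.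
by rewrite swapXY_sub2 sub2_sub2 sub2X sub2Y.
Qed.

Lemma coef_trans c f i : (trans c f)`_i = f`_i \Po ('X + c%:P).
Proof. by rewrite /trans coef_map. Qed.

Lemma transK c : cancel (trans c) (trans (- c)).
Proof.
move=> f; apply/polyP => i; rewrite !coef_trans -comp_polyA.
by rewrite comp_polyD comp_polyX comp_polyC polyCN subrK comp_polyXr.
Qed.

Lemma coef_CCM (a : A) f i j : (CC a * f)`_i`_j = a * f`_i`_j.
Proof. by rewrite /CC !coefCM. Qed.

(** The monomial x1^i x2^j becomes x1^(i + j) x2^j, so [blow] merely moves coefficients. *)
Lemma coef_blow f n j :
  (blow f)`_n`_j = if (j <= n)%N then f`_(n - j)`_j else 0.
Proof.
have hc (g : {poly A}) m i : (blow g%:P)`_m`_i = if i == m then g`_i else 0.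
  elim/poly_ind: g m i => [|g c IH] m i; first by rewrite rmorph0 !coef0 if_same.
  have -> : blow (g * 'X + c%:P)%:P = (blow g%:P * 'Y) * 'X + CC c.
    by rewrite !(rmorphD, rmorphM) /= /blow sub2Y sub2CC ['X * 'Y]mulrC mulrA.
  rewrite coefD coefMX coefC; case: m => [|m] /=.
    by rewrite add0r coefC coefD coefMX coefC; case: i => [|i] //=; rewrite add0r.
  rewrite addr0 coefMC coefMX coefD coefMX coefC; case: i => [|i] //=.
  by rewrite IH eqSS addr0.
elim/poly_ind: f n j => [|f g IH] n j; first by rewrite rmorph0 !coef0 if_same.
have -> : blow (f * 'X + g%:P) = blow f * 'X + blow g%:P.
  by rewrite rmorphD rmorphM /= /blow sub2X.
rewrite coefD coefMX coefD hc coefD coefMX coefC subn_eq0.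
case: n => [|n] /=.
  by rewrite coef0 add0r; case: j => [|j] //=; rewrite coefD coef0 add0r.
rewrite IH; case: (ltngtP j n.+1) => [jn|jn|->].
- by rewrite -ltnS jn coefD coef0 !addr0 subSn.
- by rewrite leqNgt (ltnW jn) /= addr0.
- by rewrite ltnn coefD coef0.
Qed.

(* Pull-back to a chart that meets the last exceptional curve, in the locus
   x1 = 0; [sigma [::]] is the blow up of the origin alone. *)
Fixpoint sigma (s : seq (bool * A)) : PP -> PP :=
  if s is a :: s' then sigma s' \o step a else blow.

Lemma sigma_cons a s f : sigma (a :: s) f = sigma s (step a f).
Proof. by []. Qed.

Lemma sigma_zmod_morphism s : zmod_morphism (sigma s).
Proof.
elim: s => [|a s IH] f g; first exact: rmorphB.
by rewrite /= rmorphB IH.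
Qed.

Lemma sigma_monoid_morphism s : monoid_morphism (sigma s).
Proof.
elim: s => [|a s [IH1 IHM]].
  by split=> [|f g]; [exact: rmorph1 | exact: rmorphM].
split=> [|f g]; first by rewrite /= rmorph1 IH1.
by rewrite /= rmorphM IHM.
Qed.

HB.instance Definition _ s :=
  GRing.isZmodMorphism.Build _ _ (sigma s) (sigma_zmod_morphism s).
HB.instance Definition _ s :=
  GRing.isMonoidMorphism.Build _ _ (sigma s) (sigma_monoid_morphism s).

Lemma sigmaC s c : sigma s (CC c) = CC c.
Proof.
elim: s => [|a s IH]; first exact: sub2CC.
by rewrite sigma_cons /step sub2CC.
Qed.

End Substitution.

Section Naturality.
Variables (A B : comNzRingType) (h : {rmorphism A -> B}).

Lemma map2_sub2 p q f :
  map2 h (sub2 p q f) = sub2 (map2 h p) (map2 h q) (map2 h f).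
Proof.
pose hC : {rmorphism A -> pp B} := @CC B \o h.
have E g : map2 h g = @ev2 A (pp B) hC 'X 'Y g.
  apply: (@ev2_unique A (pp B) hC 'X 'Y (map2 h)) => [c||].
  - exact: (etrans (map2C _ _) (congr1 _ (map_polyC _ _))).
  - exact: map2X.
  - exact: (etrans (map2C _ _) (congr1 _ (map_polyX _))).
rewrite !E {1}/sub2 (@ev2_sub2 A (pp B)); symmetry.
apply: (@ev2_unique A (pp B) hC _ _ (sub2 _ _ \o @ev2 A (pp B) hC 'X 'Y)) => [c||] /=.
- by rewrite ev2CC sub2CC.
- by rewrite ev2X sub2X.
- by rewrite ev2Y sub2Y.
Qed.

(** This lets one computation over the skeleton be read both over [k] and over the complex
    numbers. *)
Lemma map2_sigma s f :
  map2 h (sigma s f) = sigma [seq (a.1, h a.2) | a <- s] (map2 h f).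
Proof.
elim: s f => [|a s IH] f.
  by rewrite /= /blow map2_sub2 rmorphM /= map2X map2C map_polyX.
rewrite map_cons !sigma_cons IH; congr (sigma _ _).
by rewrite /step; case: a => [[] c] /=;
  rewrite map2_sub2 rmorphM rmorphD /= map2X !map2C map_polyX map_polyC.
Qed.

End Naturality.

(** * Orders along the exceptional curve and colengths of valuation ideals *)

Section OrderX.
Variable D : idomainType.
Implicit Types f g h : {poly D}.

Definition dvX (n : nat) f := forall i, (i < n)%N -> f`_i = 0.

Lemma dvXP n f : dvX n f <-> exists g, f = 'X^n * g.
Proof.
split=> [fn|[g ->] i lin]; last by rewrite coefXnM lin.
exists (drop_poly n f); rewrite -{1}(poly_take_drop n f) commr_polyXn.
suff -> : take_poly n f = 0 by rewrite add0r.
by apply/polyP => i; rewrite coef_take_poly coef0; case: ifP => // /fn.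
Qed.

Lemma dvXD n f g : dvX n f -> dvX n g -> dvX n (f + g).
Proof. by move=> fn gn i lin; rewrite coefD fn ?gn ?addr0. Qed.

Lemma dvXMl n f g : dvX n g -> dvX n (f * g).
Proof. by move=> /dvXP[h ->]; apply/dvXP; exists (f * h); rewrite mulrCA. Qed.

(** As D is a domain, x1 is prime in D[x1], and a factor that does not vanish on x1 = 0 can be
    cancelled. *)
Lemma dvXM_unit n g h : g`_0 != 0 -> dvX n (g * h) -> dvX n h.
Proof.
move=> g0; elim: n h => [|n IH] h gh //.
have hn : dvX n h by apply: IH => i lin; apply: gh; lia.
move=> i; rewrite ltnS leq_eqVlt => /predU1P[->|]; last exact: hn.
have /dvXP[h1 hE] := hn; have := gh n (ltnSn n).
have -> : g * h = 'X^n * (g * h1) by rewrite hE mulrCA.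
rewrite hE !coefXnM ltnn subnn coef0M => /eqP.
by rewrite mulf_eq0 (negPf g0) => /eqP.
Qed.

Lemma dvXXM m n f : dvX n ('X^m * f) <-> dvX (n - m) f.
Proof.
split=> [fn i lin|fn i lin]; last first.
  rewrite coefXnM; case: ltnP => // lmi; apply: fn; lia.
have /fn : (i + m < n)%N by lia.
by rewrite coefXnM ltnNge leq_addl /= addnK.
Qed.

(** The order of the zero polynomial comes out as 0 instead of infinity, whence the hypotheses
    [f != 0] below. *)
Definition ordX f : nat := find (fun c => c != 0) f.

Lemma ordX_coef f : f != 0 -> f`_(ordX f) != 0.
Proof.
move=> f0; have hf : has (fun c => c != 0) f; last exact: (nth_find 0 hf).
apply/(has_nthP 0).
by exists (size f).-1; [rewrite prednK // size_poly_gt0 | rewrite -lead_coefE lead_coef_eq0].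
Qed.

Lemma ordX_dvX f : dvX (ordX f) f.
Proof. by move=> i /(before_find 0)/negbFE/eqP. Qed.

Lemma dvX_ordX n f : f != 0 -> dvX n f <-> (n <= ordX f)%N.
Proof.
move=> f0; split=> [fn|le i lin].
  by rewrite leqNgt; apply/negP => /fn/eqP; apply/negP/ordX_coef.
exact/ordX_dvX/(leq_trans lin).
Qed.

Lemma ordX_fact f : f != 0 -> exists2 g, f = 'X^(ordX f) * g & g`_0 != 0.
Proof.
move=> f0; have /dvXP[g fE] := @ordX_dvX f; exists g => //.
by have := ordX_coef f0; rewrite {1}fE coefXnM ltnn subnn.
Qed.

Lemma ordX_eq n g : g`_0 != 0 -> ordX ('X^n * g) = n.
Proof.
move=> g0; have ng0 : 'X^n * g != 0.
  by rewrite mulf_neq0 ?expf_neq0 ?polyX_eq0 //; apply: contraNneq g0 => ->; rewrite coef0.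
apply/eqP; rewrite eqn_leq; apply/andP; split; last first.
  by rewrite -dvX_ordX //; apply/dvXP; exists g.
rewrite leqNgt; apply/negP => /(@ordX_dvX ('X^n * g) n)/eqP.
by rewrite coefXnM ltnn subnn; apply/negP.
Qed.

Lemma ordXM f g : f != 0 -> g != 0 -> ordX (f * g) = (ordX f + ordX g)%N.
Proof.
move=> /ordX_fact[f1 {1}-> f10] /ordX_fact[g1 {1}-> g10].
by rewrite mulrACA -exprD ordX_eq // coef0M mulf_neq0.
Qed.

End OrderX.

Section Shapes.

(* In a shape, the second component tells whether the center c is 0. The pair
   [eXY sh] is (v(x1), v(x2)) for the valuation v of the last exceptional curve. *)
Fixpoint eXY (sh : seq (bool * bool)) : nat * nat :=
  if sh is a :: sh' then
    let e := eXY sh' in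
    let t := (e.1 + if a.2 then e.2 else 0)%N in
    if a.1 then (t, e.1) else (e.1, t)
  else (1, 1)%N.

(** Up to sign, each blow up divides the Jacobian of the coordinates by the new x1, so it
    contributes the value of that coordinate; the last blow up contributes 1. *)
Fixpoint disc (sh : seq (bool * bool)) : nat :=
  if sh is _ :: sh' then ((eXY sh').1 + disc sh')%N else 1%N.

Lemma eXY_gt0 sh : (0 < (eXY sh).1)%N /\ (0 < (eXY sh).2)%N.
Proof. by elim: sh => [|[[] []] sh [h1 h2]] //=; split=> //; lia. Qed.

End Shapes.

Definition shape (F : fieldType) (s : seq (bool * F)) :=
  [seq (a.1, a.2 == 0) | a <- s].

Section Orders.
Variable F : fieldType.
Local Notation PP := {poly {poly F}}.
Implicit Types (f g h : PP) (s : seq (bool * F)).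

Lemma blow_inj : injective (@blow F).
Proof.
move=> f g /(congr1 (fun p : PP => p)) E; apply/polyP => i; apply/polyP => j.
have := congr1 (fun p : PP => p`_(i + j)`_j) E.
by rewrite /= !coef_blow leq_addl addnK.
Qed.

Lemma step_inj a : injective (@step F a).
Proof.
move=> f g; rewrite !stepE => /(can_inj (transK _))/blow_inj.
by case: a.1 => // /(can_inj (@swapXYK _)).
Qed.

Lemma sigma_inj s : injective (@sigma F s).
Proof.
elim: s => [|a s IH]; first exact: blow_inj.
by move=> f g; rewrite !sigma_cons => /IH/step_inj.
Qed.

Lemma sigma_eq0 s f : (sigma s f == 0) = (f == 0).
Proof.
by apply/eqP/eqP => [|->]; [rewrite -[RHS](rmorph0 (sigma s)) => /sigma_inj | exact: rmorph0].
Qed.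

Lemma eXYP s :
  (exists2 g, sigma s 'X = 'X^((eXY (shape s)).1) * g & g`_0 != 0) /\
  (exists2 g, sigma s 'Y = 'X^((eXY (shape s)).2) * g & g`_0 != 0).
Proof.
elim: s => [|[b c] s [[g gE g0] [h hE h0]]].
  rewrite /= expr1; split.
    by exists 1; rewrite ?coef1 ?oner_eq0 // mulr1 /blow sub2X.
  by exists 'Y; rewrite ?coefC ?polyX_eq0 // /blow sub2Y.
have [e1 e2] := eXY_gt0 (shape s).
have [t tE t0] : exists2 t : PP, sigma s ('X * ('Y + CC c)) =
    'X^((eXY (shape s)).1 + (if (c == 0)%R then (eXY (shape s)).2 else 0)%N) * t & t`_0 != 0.
  rewrite rmorphM rmorphD /= gE hE sigmaC; case: eqP => [->|/eqP c0].
    exists (g * h); first by rewrite /CC !polyC0 addr0 mulrACA exprD.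
    by rewrite coef0M mulf_neq0.
  (* The pull-back of x2 has positive order, so x2 + c keeps the nonzero constant c on x1 = 0. *)
  exists (g * ('X^((eXY (shape s)).2) * h + CC c)).
    by rewrite addn0 mulrA.
  rewrite coef0M mulf_neq0 // coefD coefXnM e2 add0r /CC coefC /=.
  by rewrite polyC_eq0.
rewrite !sigma_cons /step sub2X sub2Y /=.
by case: b => /=; split; [exists t|exists g|exists g|exists t].
Qed.

(** Membership in the m-th power of the maximal ideal of the origin. *)
Definition mult (m : nat) f := forall i j, (i + j < m)%N -> f`_i`_j = 0.

Lemma mult_blow m f : mult m f <-> dvX m (blow f).
Proof.
split=> [fm i im|fm i j ij].
  apply/polyP => j; rewrite coef_blow coef0; case: leqP => // ji.
  by apply: fm; lia.
have := congr1 (fun p : {poly F} => p`_j) (fm _ ij).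
by rewrite /= coef_blow leq_addl addnK coef0.
Qed.

Lemma multD m f g : mult m f -> mult m g -> mult m (f + g).
Proof. by move=> fm gm i j ij; rewrite !coefD fm ?gm ?addr0. Qed.

Lemma dvX_trans m (c : F) f : dvX m f -> dvX m (trans c f).
Proof. by move=> fm i im; rewrite coef_trans fm ?comp_poly0. Qed.

Lemma mult_step a m f : mult m f <-> dvX m (step a f).
Proof.
have E : mult m f <-> mult m (if a.1 then swapXY f else f).
  case: a.1 => //; split=> fm i j ij; first by rewrite coef_swapXY fm // addnC.
  by rewrite -coef_swapXY fm // addnC.
rewrite E mult_blow stepE; split; first exact: dvX_trans.
by move/(@dvX_trans _ (- a.2)); rewrite transK.
Qed.

(** The image of [blow] is spanned by the x1^n x2^j with j <= n, and a translation of x2 does not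
    raise the degree in x2. *)
Lemma step_push a m h : (forall i, (size (h`_i)%R <= i + m.+1)%N) ->
  exists H, step a H = 'X^m * h.
Proof.
move=> hs; pose h' := trans (- a.2) h.
have hs' i : (size (h'`_i)%R <= i + m.+1)%N.
  rewrite coef_trans size_comp_poly2 //.
  by rewrite -[_%:P]opprK -polyCN size_XsubC.
(* A bound on both exponents occurring in H: once one of them reaches N, the index i + j - m lies
   beyond the length of h'. *)
pose N := (size h' + m)%N.
pose H := \poly_(i < N) \poly_(j < N)
  (if (i + j < m)%N then 0 else h'`_(i + j - m)`_j).
have HE : blow H = 'X^m * h'.
  apply/polyP => n; apply/polyP => j; rewrite coef_blow coefXnM.
  have big i : (N <= i)%N -> forall l, h'`_(i + l - m) = 0.
    by move=> Ni l; rewrite nth_default //; move: Ni; rewrite /N; move: (size h') => z; lia.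
  case: ltnP => [nm|mn]; case: (leqP j n) => jn; rewrite ?coef0 //.
  - rewrite coef_poly; case: ifP => _; last by rewrite coef0.
    by rewrite coef_poly subnK // nm if_same.
  - rewrite coef_poly; case: ltnP => [_|Nnj]; last first.
      by rewrite coef0 -(subnK jn) big ?coef0.
    rewrite coef_poly subnK // [(n < m)%N]ltnNge mn /=; case: ltnP => // Nj.
    by rewrite -(subnKC jn) big ?coef0.
  - by rewrite nth_default // (leq_trans (hs' _)) //; lia.
exists (if a.1 then swapXY H else H).
have -> : step a (if a.1 then swapXY H else H) = trans a.2 (blow H).
  by rewrite stepE; case: a.1; rewrite // swapXYK.
have h'K : trans a.2 h' = h by have := transK (- a.2) h; rewrite opprK.
by rewrite HE rmorphM /= h'K rmorphXn /= /trans map_polyX.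
Qed.

(* The valuation ideal of the elements of value at least n. *)
Definition V s n f := dvX n (sigma s f).

(** After the first blow up x1 has value [(eXY (shape s)).1], so x1^m accounts for m times this
    amount. If that already exceeds n, the truncated difference is 0 and no condition on f1 is
    left. *)
Lemma V_step a s n m f f1 : step a f = 'X^m * f1 ->
  V (a :: s) n f <-> V s (n - m * (eXY (shape s)).1) f1.
Proof.
move=> E; rewrite /V sigma_cons E rmorphM rmorphXn /=.
have [[g -> g0] _] := eXYP s.
rewrite exprMn -exprM mulnC -mulrA dvXXM; split; last exact: dvXMl.
by apply: dvXM_unit; rewrite -!horner_coef0 horner_exp expf_neq0 // horner_coef0.
Qed.

Lemma VX s n m f : (n <= m)%N -> V s n ('X^m * f).
Proof.
move=> nm; rewrite /V rmorphM rmorphXn /=; have [[g -> g0] _] := eXYP s.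
have [e1 _] := eXY_gt0 (shape s).
rewrite exprMn -exprM -mulrA; apply/dvXXM => i; rewrite ltn_subRL => h.
suff : (m <= (eXY (shape s)).1 * m)%N by lia.
by rewrite leq_pmull.
Qed.

End Orders.

Section Colength.

(** This and [codim_le] bound the dimension of the quotient by P from below and from above by the
    size of I, without forming the quotient. *)
Definition indep_mod (F : fieldType) (I : finType) (P : {poly {poly F}} -> Prop) :=
  exists e : I -> {poly {poly F}}, forall u : I -> F,
    P (\sum_i CC (u i) * e i) -> forall i, u i = 0.

Definition codim_le (F : fieldType) (I : finType) (P : {poly {poly F}} -> Prop) :=
  exists l : I -> {poly {poly F}} -> F,
    (forall i a f g, l i (CC a * f + g) = a * l i f + l i g) /\
    forall f, (forall i, l i f = 0) -> P f.

(** Exponents of the monomials of degree less than m, a basis modulo the m-th power of the maximal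
    ideal. The bounds on each exponent make the type finite. *)
Record simplex (m : nat) := Simplex {
  simplex_val : 'I_m * 'I_m; _ : (simplex_val.1 + simplex_val.2 < m)%N }.
HB.instance Definition _ m := [isSub for @simplex_val m].
HB.instance Definition _ m := [Finite of simplex m by <:].

Variables (k K : fieldType).

Lemma coef_monomial (F : comNzRingType) i j i' j' :
  (('X^i * ('X^j)%:P : {poly {poly F}}))`_i'`_j' =
  ((i == i') && (j == j'))%:R.
Proof.
rewrite coefXnM coefC; case: ltnP => h.
  by rewrite coef0 [i == i']eqn_leq leqNgt h.
rewrite subn_eq0; rewrite [i == i']eqn_leq h /=.
case: leqP => _ /=; last by rewrite coef0.
by rewrite coefXn eq_sym.
Qed.

Lemma coef_simplex_sum (F : fieldType) m (u : simplex m -> F) (p : simplex m) :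
  (\sum_q CC (u q) * ('X^((val q).1) * ('X^((val q).2))%:P))`_((val p).1)`_((val p).2) = u p.
Proof.
rewrite coef_sum coef_sum (bigD1 p) //= big1 ?addr0 => [|q qp].
  by rewrite coef_CCM coef_monomial !eqxx mulr1.
rewrite coef_CCM coef_monomial; case: andP => [[/eqP h1 /eqP h2]|]; last by rewrite mulr0.
case/negP: qp; apply/eqP/val_inj.
rewrite [val q]surjective_pairing [val p]surjective_pairing.
by congr (_, _); apply: val_inj.
Qed.

(* Let mu be the smallest multiplicity in V (a :: s) n. Dividing by x1^mu after
   the first blow up turns this ideal into V s (n - mu v(x1)), the difference of
   the colengths being mu (mu + 1) / 2. *)
Lemma indep_colength (s : seq (bool * k)) (s' : seq (bool * K)) n :
  shape s = shape s' ->
  exists I : finType, indep_mod I (V s n) /\ codim_le I (V s' n).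
Proof.
elim: s s' n => [|a s IH] [|a' s'] n //.
  move=> _; exists (simplex n); split.
    exists (fun p : simplex n => 'X^((val p).1) * ('X^((val p).2))%:P) => u.
    rewrite /V /= -mult_blow => h p; have := h _ _ (valP p).
    by rewrite coef_simplex_sum.
  exists (fun (p : simplex n) (f : {poly {poly K}}) => f`_((val p).1)`_((val p).2)); split=> [p b f g|f h].
    by rewrite !coefD coef_CCM.
  rewrite /V /= -mult_blow => i j ij.
  have [hi hj] : (i < n)%N /\ (j < n)%N by lia.
  exact: (h (@Simplex n (Ordinal hi, Ordinal hj) ij)).
rewrite /shape /= => -[_ _ hs]; rewrite -!/(shape _) in hs.
have [mu [muP muM]] : exists mu, (forall f, V (a :: s) n f -> mult mu f) /\
    ~ (forall f, V (a :: s) n f -> mult mu.+1 f).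
  pose P m := `[< forall f, V (a :: s) n f -> mult m f >].
  have P0 : exists m, P m by exists 0%N; apply/asboolP.
  (* The ideal contains x1^n, of multiplicity n. *)
  have Pb m : P m -> (m <= n)%N.
    move=> /asboolP hm; rewrite leqNgt; apply/negP => nm.
    have h0 : V (a :: s) n ('X^n * 1) by exact: VX.
    have := hm _ h0 n 0%N; rewrite addn0 => /(_ nm)/eqP.
    by rewrite mulr1 coefXn eqxx coef1 oner_eq0.
  case: (ex_maxnP P0 Pb) => m /asboolP hm hmax; exists m; split=> // hm1.
  by have /hmax := introT (asboolP _) hm1; rewrite ltnn.
have [I [[e eP] [l [lL lP]]]] := IH s' (n - mu * (eXY (shape s)).1)%N hs.
set n' := (n - _)%N in eP lP.
have stepX f : mult mu f -> exists f1, step a f = 'X^mu * f1.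
  by move/(mult_step a)/dvXP.
(* The elements x1^mu t that are pull-backs; [surj] shows that such t represent all classes modulo
   [V s n']. *)
pose T t := exists H, step a H = 'X^mu * t.
have TD t1 t2 : T t1 -> T t2 -> T (t1 + t2).
  by move=> [H1 E1] [H2 E2]; exists (H1 + H2); rewrite rmorphD /= E1 E2 mulrDr.
(* An element of multiplicity exactly mu. Its f1 restricts to x1 = 0 as a nonzero polynomial in x2
   of degree at most mu, which serves as the divisor in [surj]. *)
have [f [fV fM]] : exists f, V (a :: s) n f /\ ~ mult mu.+1 f.
  apply: contrapT => h; apply: muM => f fV; apply: contrapT => fM.
  by apply: h; exists f.
have [f1 f1E] := stepX _ (muP _ fV).
have f1V : V s n' f1 by apply/(V_step _ _ f1E).
have f10 : f1`_0 != 0.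
  apply/eqP => f10; apply: fM; apply/(mult_step a); rewrite f1E.
  by apply/dvXXM; rewrite subSnn => i; rewrite ltnS leqn0 => /eqP ->.
have f1s : (size (f1`_0)%R <= mu.+1)%N.
  have -> : f1`_0 = (step a f)`_mu by rewrite f1E coefXnM ltnn subnn.
  rewrite stepE coef_trans size_comp_poly2; last first.
    by rewrite -[_%:P]opprK -polyCN size_XsubC.
  by apply/leq_sizeP => j hj; rewrite coef_blow leqNgt hj.
(* Descending induction on the power of x1, trivial from x1^n' on. The coefficient on x1 = 0 is
   divided by that of f1: the remainder has small enough degree for [step_push], the quotient gives
   a multiple of f1, which lies in [V s n'], and the rest has one more factor x1. *)
have surj j h : exists2 t, T t & V s n' ('X^(n' - j) * h - t).
  elim: j h => [|j IHj] h.
    exists 0; first by exists 0; rewrite rmorph0 mulr0.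
    by rewrite subr0; apply: VX; rewrite subn0.
  have [hj|hj] := leqP n' j.
    have -> : (n' - j.+1 = n' - j)%N by lia.
    exact: IHj.
  pose q := h`_0 %/ f1`_0; pose r := h`_0 %% f1`_0.
  have spl (g : {poly {poly k}}) : exists g', g = (g`_0)%:P + 'X * g'.
    exists (drop_poly 1 g); rewrite -{1}(poly_take_drop 1 g) commr_polyXn expr1.
    congr (_ + _); apply/polyP => i; rewrite coef_take_poly coefC.
    by case: i.
  have [h' hE] := spl h; have [f1' f1E'] := spl f1.
  have [t tT tV] := IHj (h' - q%:P * f1').
  exists (t + 'X^(n' - j.+1) * r%:P).
    apply: TD => //; apply: step_push => i; rewrite coefXnM.
    case: ltnP => _; first by rewrite size_poly0.
    rewrite coefC; case: eqP => _; last by rewrite size_poly0.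
    apply: leq_trans (leq_addl _ _); apply: leqW.
    by rewrite -ltnS; apply: leq_trans f1s; rewrite ltn_modp.
  have -> : 'X^(n' - j.+1) * h - (t + 'X^(n' - j.+1) * r%:P) =
      ('X^(n' - j) * (h' - q%:P * f1') - t) + 'X^(n' - j.+1) * q%:P * f1.
    have -> : (n' - j = (n' - j.+1).+1)%N by lia.
    have aux (R : comNzRingType) (x y q0 r0 b h2 f2 t0 : R) :
        x * ((q0 * b + r0) + y * h2) - (t0 + x * r0) =
        (x * y * (h2 - q0 * f2) - t0) + x * q0 * (b + y * f2) by ring.
    rewrite [in LHS]hE [in RHS]f1E' [in LHS](divp_eq h`_0 f1`_0) -/q -/r polyCD polyCM exprSr.
    exact: (aux (pp k)).
  rewrite /V rmorphD; apply: dvXD; first exact: tV.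
  by rewrite rmorphM; apply: dvXMl.
(* The left summand counts the quotient by the elements of multiplicity mu, the right one the
   quotient of these by V. *)
exists (simplex mu + I)%type; split.
  have [H HP] : {H : I -> {poly {poly k}} & forall i, exists2 t,
      step a (H i) = 'X^mu * t & V s n' (e i - t)}.
    apply: (@choice _ _ (fun i H => exists2 t,
      step a H = 'X^mu * t & V s n' (e i - t))) => i.
    have [t [H HE] tV] := surj n' (e i).
    by exists H, t => //; move: tV; rewrite subnn mul1r.
  have [t tP] : {t : I -> {poly {poly k}} & forall i,
      step a (H i) = 'X^mu * t i /\ V s n' (e i - t i)}.
    by apply: (@choice _ _ (fun i t => step a (H i) = 'X^mu * t /\ V s n' (e i - t))) => i; have [t] := HP i; exists t.
  have Hm i : mult mu (H i).
    by apply/(mult_step a)/dvXP; exists (t i); have [] := tP i.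
  exists (fun x : simplex mu + I => match x return {poly {poly k}} with
    | inl p => 'X^((val p).1) * ('X^((val p).2))%:P | inr i => H i end) => u.
  rewrite big_sumType /= => uV.
  have sumM : mult mu (\sum_i CC (u (inr i)) * H i).
    elim/big_ind: _ => [i j _|f2 g2|i _]; [by rewrite !coef0|exact: multD|].
    by move=> x y xy; rewrite coef_CCM Hm ?mulr0.
  (* Neither the elements of V nor the H i have terms of degree below mu, so such terms come from
     the monomials alone. *)
  have u1 p : u (inl p) = 0.
    have := muP _ uV _ _ (valP p); rewrite !coefD (sumM _ _ (valP p)) addr0.
    by rewrite (@coef_simplex_sum _ _ (u \o inl)).
  have u2 : V s n' (\sum_i CC (u (inr i)) * e i).
    rewrite big1 ?add0r in uV; last by move=> p _; rewrite u1 /CC !polyC0 mul0r.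
    have E : step a (\sum_i CC (u (inr i)) * H i) =
        'X^mu * \sum_i CC (u (inr i)) * t i.
      rewrite rmorph_sum big_distrr; apply: eq_bigr => i _.
      by rewrite rmorphM /= (proj1 (tP i)) {1}/step sub2CC mulrCA.
    have -> : \sum_i CC (u (inr i)) * e i =
      (\sum_i CC (u (inr i)) * t i) + \sum_i CC (u (inr i)) * (e i - t i).
      by rewrite -big_split; apply: eq_bigr => i _; rewrite /= -mulrDr addrC subrK.
    rewrite /V rmorphD; apply: dvXD; first by apply/(V_step _ _ E).
    rewrite rmorph_sum; elim/big_ind: _ => [j _|f2 g2|i _].
    - by rewrite coef0.
    - exact: dvXD.
    - by rewrite rmorphM; apply: dvXMl; have [] := tP i.
  by case=> [p|i]; [exact: u1 | exact: (eP (u \o inr))].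
(* Dropping the terms below x1^mu is linear, and it is division by x1^mu on the pull-backs of
   elements of multiplicity mu. Although mu was chosen over [k], it works here, as over [K] only an
   upper bound is claimed. *)
exists (fun (x : simplex mu + I) (f : {poly {poly K}}) => match x return K with
  | inl p => f`_((val p).1)`_((val p).2)
  | inr i => l i (drop_poly mu (step a' f)) end); split.
  move=> [p|i] b f2 g2; first by rewrite !coefD coef_CCM.
  rewrite -lL; congr (l i _).
  rewrite rmorphD rmorphM /= raddfD /=; congr (_ + _).
  by apply/polyP => j; rewrite /step sub2CC /CC coef_drop_poly !coefCM coef_drop_poly.
move=> f2 f20.
have f2M : mult mu f2.
  move=> i j ij; have [hi hj] : (i < mu)%N /\ (j < mu)%N by lia.
  exact: (f20 (inl (@Simplex mu (Ordinal hi, Ordinal hj) ij))).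
have /dvXP[g2 g2E] := (mult_step a' _ _).1 f2M.
apply/(V_step _ _ g2E); rewrite -hs; apply: lP => i.
have := f20 (inr i); rewrite g2E; congr (l i _ = 0).
by apply/polyP => j; rewrite coef_drop_poly coefXnM ltnNge leq_addl addnK.
Qed.

End Colength.

(** * Lifting elements of valuation ideals *)

Section Reindex.
Variable F : fieldType.

Lemma indep_mod_ord (I : finType) (P : {poly {poly F}} -> Prop) :
  indep_mod I P -> indep_mod 'I_#|I| P.
Proof.
move=> [e eP]; exists (fun i => e (enum_val i)) => u uP i.
have := eP (fun x => u (enum_rank x)); rewrite (reindex (fun j : 'I_#|I| => enum_val j)) /=; last first.
  exact/onW_bij/enum_val_bij.
under eq_bigr do rewrite enum_valK.
by move=> /(_ uP (enum_val i)); rewrite enum_valK.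
Qed.

Lemma codim_le_ord (I : finType) (P : {poly {poly F}} -> Prop) :
  codim_le I P -> codim_le 'I_#|I| P.
Proof.
move=> [l [lL lP]]; exists (fun i => l (enum_val i)); split=> [i|f fP]; first exact: lL.
by apply: lP => i; have := fP (enum_rank i); rewrite enum_rankK.
Qed.

End Reindex.

Section Lifting.
Variables (A : comNzRingType) (k K : fieldType).
Variables (phi : {rmorphism A -> k}) (iota : {rmorphism A -> K}).
Hypothesis iota_inj : injective iota.
Variable s : seq (bool * A).
Let sk := [seq (a.1, phi a.2) | a <- s].
Let sK := [seq (a.1, iota a.2) | a <- s].

(** Coefficients vanishing over [K] vanish in [A] because [iota] is injective, hence also over
    [k]. *)
Lemma V_reduce n g : V sK n (map2 iota g) -> V sk n (map2 phi g).
Proof.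
rewrite /V -!map2_sigma => h i /h E; apply/polyP => j.
have := congr1 (fun p : {poly K} => p`_j) E.
rewrite /= coef_map2 !coef0 coef_map2 -[RHS](rmorph0 iota) => /iota_inj ->.
exact: rmorph0.
Qed.

(* The coefficients of sigma s (e i) of degree below n in x1 have an invertible
   r x r minor; solving for the coefficients of sigma s f by Cramer's rule
   corrects f by a combination of the e i that vanishes under phi. *)
Lemma lift_in_V r n (e : 'I_r -> {poly {poly A}}) f :
  (forall u : 'I_r -> k, V sk n (\sum_i CC (u i) * map2 phi (e i)) ->
     forall i, u i = 0) ->
  codim_le 'I_r (V sK n) ->
  V sk n (map2 phi f) ->
  exists g m, [/\ V sK n (map2 iota g), phi m != 0
    & map2 phi g = CC (phi m) * map2 phi f].
Proof.
move=> eP [l [lL lP]] fV.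
(* A bound on the degrees in x2, so that a finite matrix holds all the coefficients that decide
   membership in [V sk n]. *)
pose N := \max_i \max_(j < n) size ((sigma s (e i))`_j)%R.
pose co (B : comNzRingType) (h : {poly {poly B}}) (t : 'I_n * 'I_N) := h`_t.1`_t.2.
pose M := \matrix_(i < r, t < #|{: 'I_n * 'I_N}|)
  phi (co _ (sigma s (e i)) (enum_val t)).
have Mfree : row_free M.
  apply: inj_row_free => v vM; apply/rowP => i; rewrite mxE.
  apply: (eP (v 0)) => {i} j jn; rewrite rmorph_sum; apply/polyP => j'.
  rewrite /= coef0 coef_sum coef_sum.
  have [jN|Nj] := ltnP j' N; last first.
    rewrite big1 // => i _; rewrite rmorphM /= sigmaC coef_CCM -map2_sigma coef_map2.
    rewrite (nth_default _ (leq_trans _ Nj)) ?rmorph0 ?mulr0 //.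
    rewrite /N (bigD1 i) //= leq_max; apply/orP; left.
    by rewrite (bigD1 (Ordinal jn)) //= leq_max leqnn.
  have := congr1 (fun w : 'rV_ _ => w 0 (enum_rank (Ordinal jn, Ordinal jN))) vM.
  rewrite !mxE; apply: etrans; apply: eq_bigr => i _.
  by rewrite !mxE enum_rankK rmorphM /= sigmaC coef_CCM -map2_sigma coef_map2.
have Mfull : row_full M^T by rewrite /row_full mxrank_tr.
(* A choice of r coefficients whose minor is invertible over [k]. Its determinant is then nonzero in
   [A], and so the minor is invertible over [K] as well. *)
pose rho := fullrankfun Mfull.
pose B := \matrix_(t < r, i < r) co _ (sigma s (e i)) (enum_val (rho t)).
have dB : phi (\det B) != 0.
  have := fullrowsub_unit Mfull; rewrite -unitfE -det_map_mx unitmxE.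
  by congr (\det _ \is a GRing.unit); apply/matrixP => t i; rewrite !mxE.
have iB : map_mx iota B \in unitmx.
  rewrite unitmxE det_map_mx unitfE; apply: contraNneq dB.
  by rewrite -(rmorph0 iota) => /iota_inj ->; rewrite rmorph0.
pose w := \col_(t < r) co _ (sigma s f) (enum_val (rho t)).
(* The adjugate avoids dividing by the determinant in [A]. As w reduces to 0 because f reduces into
   [V sk n], so does x. *)
pose x := \adj B *m w.
have phiw t : phi (w t 0) = 0.
  rewrite mxE /co -coef_map2 map2_sigma (fV _ (ltn_ord _)) coef0 //.
have phix t : phi (x t 0) = 0.
  rewrite mxE rmorph_sum big1 // => i _.
  by rewrite rmorphM /= phiw mulr0.
pose g := CC (\det B) * f + \sum_i CC (- x i 0) * e i.
exists g, (\det B); split=> //; last first.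
  apply/polyP => i; apply/polyP => j.
  rewrite coef_CCM !coef_map2 /g !coefD !coef_sum coef_CCM rmorphD rmorphM.
  rewrite [X in _ + X](_ : _ = 0) ?addr0 // rmorph_sum big1 // => i' _.
  by rewrite coef_CCM rmorphM rmorphN phix oppr0 mul0r.
have cog t : co _ (sigma s g) (enum_val (rho t)) = 0.
  have -> : sigma s g =
      CC (\det B) * sigma s f + \sum_i CC (- x i 0) * sigma s (e i).
    rewrite /g; move: (\det B) => b; rewrite rmorphD rmorphM rmorph_sum /= sigmaC.
    by congr (_ + _); apply: eq_bigr => i _; rewrite rmorphM /= sigmaC.
  rewrite /co !coefD !coef_sum coef_CCM.
  have E : (B *m x) t 0 = \det B * w t 0.
    by rewrite /x mulmxA mul_mx_adj mul_scalar_mx mxE.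
  apply/eqP; rewrite addr_eq0; apply/eqP; move: E; rewrite !mxE => <-.
  rewrite -sumrN; apply: eq_bigr => i _.
  by rewrite coef_CCM mxE mulNr opprK mulrC.
have coV h t : V sK n h -> co _ (sigma sK h) (enum_val (rho t)) = 0.
  by move=> hV; rewrite /co (hV _ (ltn_ord _)) coef0.
pose E i := map2 iota (e i).
have coE (u : 'cV_r) t : co _ (sigma sK (\sum_i CC (u i 0) * E i)) (enum_val (rho t))
   = (map_mx iota B *m u) t 0.
  rewrite /co rmorph_sum /= coef_sum coef_sum mxE; apply: eq_bigr => i _.
  by rewrite rmorphM /= sigmaC coef_CCM -map2_sigma coef_map2 !mxE mulrC.
have coE0 (u : 'cV_r) : (forall t, co _ (sigma sK (\sum_i CC (u i 0) * E i))
    (enum_val (rho t)) = 0) -> u = 0.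
  move=> h; have : map_mx iota B *m u = 0.
    by apply/colP => t; rewrite -coE h mxE.
  by move/(congr1 (mulmx (invmx (map_mx iota B)))); rewrite mulKmx // mulmx0.
have l0 i : l i 0 = 0.
  have := lL i 1 0 0; rewrite mulr0 addr0 mul1r => /eqP.
  by rewrite -subr_eq subrr eq_sym => /eqP.
have lsum i (u : 'cV_r) : l i (\sum_j CC (u j 0) * E j) = \sum_j u j 0 * l i (E j).
  elim/big_rec2: _ => [|j y1 y2 _ <-]; [exact: l0 | exact: lL].
(* The chosen coefficients vanish on [V sK n] and separate the combinations of the E j. These are
   thus independent modulo [V sK n], and r forms on r such elements give an invertible matrix. *)
pose La := \matrix_(i < r, j < r) l i (E j).
have Lau : La \in unitmx.
  rewrite -unitmx_tr -row_free_unit; apply: inj_row_free => v vL.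
  apply: trmx_inj; rewrite trmx0; apply: coE0 => t; apply: coV; apply: lP => i.
  rewrite lsum; have := congr1 (fun w : 'rV_r => w 0 i) vL.
  by rewrite !mxE; apply: etrans; apply: eq_bigr => j _; rewrite !mxE.
pose G := map2 iota g.
(* The combination of the E j congruent to G modulo [V sK n]. The chosen coefficients vanish on G by
   construction and on [V sK n], hence on this combination, which forces u = 0. *)
pose u := invmx La *m \col_i l i G.
have GV : V sK n (G - \sum_j CC (u j 0) * E j).
  apply: lP => i.
  have -> : G - \sum_j CC (u j 0) * E j = CC (-1) * (\sum_j CC (u j 0) * E j) + G.
    by rewrite CCN /CC !polyC1 mulN1r addrC.
  rewrite lL lsum mulN1r addrC; apply/eqP; rewrite subr_eq0; apply/eqP.
  have := congr1 (fun w : 'cV_r => w i 0) (mulKVmx Lau (\col_i l i G)).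
  by rewrite !mxE => <-; apply: eq_bigr => j _; rewrite mulrC !mxE.
suff u0 : u = 0.
  by move: GV; rewrite u0 big1 ?subr0 // => i _; rewrite mxE /CC !polyC0 mul0r.
apply: coE0 => t; pose S := \sum_j CC (u j 0) * E j.
have -> : \sum_j CC (u j 0) * E j = CC (-1) * (G - S) + G.
  by rewrite CCN /CC !polyC1 mulN1r opprB subrK.
have -> : sigma sK (CC (-1) * (G - S) + G) = CC (-1) * sigma sK (G - S) + sigma sK G.
  by move: (G - S) => D; rewrite rmorphD rmorphM /= sigmaC.
rewrite /co !coefD coef_CCM; have := coV _ t GV; rewrite /co => ->.
rewrite mulr0 add0r -map2_sigma coef_map2; have := cog t; rewrite /co => ->.
exact: rmorph0.
Qed.

End Lifting.

(** * Compatible skeletons *)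

Section SubringType.
Variables (T : comNzRingType) (B : set T) (hB : is_subring B).

Definition subring_pred (_ : is_subring B) : {pred T} := fun x => `[< B x >].

Fact subring_pred_closed : subring_closed (subring_pred hB).
Proof.
have [h1 hb hm] := hB; split; first exact/asboolP.
  by move=> x y /asboolP hx /asboolP hy; apply/asboolP/hb.
by move=> x y /asboolP hx /asboolP hy; apply/asboolP/hm.
Qed.
HB.instance Definition _ := GRing.isSubringClosed.Build T (subring_pred hB)
  subring_pred_closed.

Record subring_type := SubringElt {
  subring_val : T; _ : subring_val \in subring_pred hB }.
HB.instance Definition _ := [isSub for subring_val].
HB.instance Definition _ := [Choice of subring_type by <:].
HB.instance Definition _ := [SubChoice_isSubComNzRing of subring_type by <:].

Lemma subring_typeP x : B x <-> exists a : subring_type, val a = x.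
Proof.
split=> [/asboolP hx|[a <-]]; last exact: (asboolW (valP a)).
by exists (SubringElt hx).
Qed.

End SubringType.

Section GeneratedRings.
Variable T : comNzRingType.
Implicit Types (G H B : set T).

Lemma ring_generated_subring G : is_subring (ring_generated G).
Proof.
split=> [B [[h1 hb hm] _]|x y hx hy B BP|x y hx hy B BP] //.
  by have [_ hb _] := BP.1; apply: hb; [apply: hx|apply: hy].
by have [_ _ hm] := BP.1; apply: hm; [apply: hx|apply: hy].
Qed.

Lemma sub_ring_generated G : G `<=` ring_generated G.
Proof. exact: sub_smallest. Qed.

Lemma ring_generated_sub G B : is_subring B -> G `<=` B -> ring_generated G `<=` B.
Proof. by move=> hB GB x; apply. Qed.

Lemma subring0 B : is_subring B -> B 0.
Proof. by move=> [h1 hb _]; rewrite -(subrr 1); apply: hb. Qed.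

Lemma subring1 B : is_subring B -> B 1.
Proof. by case. Qed.

Lemma subringN B x : is_subring B -> B x -> B (- x).
Proof. by move=> hB hx; rewrite -sub0r; have [_ hb _] := hB; apply: hb => //; apply: subring0. Qed.

Lemma subringD B x y : is_subring B -> B x -> B y -> B (x + y).
Proof.
move=> hB hx hy; rewrite -[y]opprK; have [_ hb _] := hB; apply: hb => //.
exact: subringN.
Qed.

Lemma subringM B x y : is_subring B -> B x -> B y -> B (x * y).
Proof. by move=> [_ _ hm]; apply: hm. Qed.

Lemma subringX B x n : is_subring B -> B x -> B (x ^+ n).
Proof.
move=> hB hx; elim: n => [|n IH]; first by have [] := hB.
by rewrite exprS; apply: subringM.
Qed.

Lemma subring_sum B (I : Type) (r : seq I) (P : pred I) (f : I -> T) :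
  is_subring B -> (forall i, P i -> B (f i)) -> B (\sum_(i <- r | P i) f i).
Proof.
move=> hB hf; elim/big_ind: _ => //; first exact: subring0.
by move=> x y; apply: subringD.
Qed.

End GeneratedRings.

Section Skeletons.
Variables (p : nat) (k : fieldType) (C : closedFieldType).
Hypothesis charC : forall n : int, (n%:~R == 0 :> C) = (n == 0).
Hypothesis hp : p \in [pchar k].
Hypothesis uncountableC : forall g : nat -> C, exists z, forall n, g n <> z.

(* Besides being the canonical surjection onto its image, the skeleton is
   countable, so that some element of C is transcendental over it. *)
Record skel (St : set C) (Phi : C -> k) : Prop := Skel {
  skel_ring : is_subring St;
  skel_fg : exists s : seq C, St = ring_generated [set` s];
  skel1 : Phi 1 = 1;
  skelD : forall x y, St x -> St y -> Phi (x + y) = Phi x + Phi y;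
  skelM : forall x y, St x -> St y -> Phi (x * y) = Phi x * Phi y;
  skel_ker : forall x, St x -> (Phi x = 0 <-> exists2 y, St y & x = y *+ p);
  skel_countable : exists f : nat -> C, forall x, St x -> exists n, f n = x }.

(** Turns a set with a map that is additive and multiplicative only on it into a ring with two
    genuine morphisms. *)
Lemma skel_type St Phi : skel St Phi ->
  exists (A : comNzRingType) (iota : {rmorphism A -> C}) (phi : {rmorphism A -> k}),
  [/\ injective iota, forall x, St x <-> exists a, iota a = x
    & forall a, Phi (iota a) = phi a].
Proof.
move=> [hB _ h1 hD hM _ _]; pose A := subring_type hB : comNzRingType.
have AP (a : A) : St (val a) by apply/subring_typeP; exists a.
pose f (a : A) := Phi (val a).
have fz : zmod_morphism f.
  move=> a b; apply/eqP; rewrite eq_sym subr_eq; apply/eqP.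
  by rewrite /f -hD // -rmorphD /= subrK.
have fm : monoid_morphism f.
  split=> [|a b]; first by rewrite /f rmorph1.
  by rewrite /f -hM // -rmorphM.
pose mz := GRing.isZmodMorphism.Build _ _ f fz.
pose mm := GRing.isMonoidMorphism.Build _ _ f fm.
pose phi : {rmorphism A -> k} := HB.pack f mz mm.
exists A, (val : {rmorphism A -> C}), phi; split=> // [|x]; first exact: val_inj.
exact: subring_typeP.
Qed.

Lemma intr_pchar (n : int) : (n%:~R == 0 :> k) = (p %| n)%Z.
Proof.
rewrite dvdzE absz_nat; case: n => n.
  by rewrite -pmulrn (dvdn_pcharf hp).
by rewrite NegzE rmorphN oppr_eq0 abszN absz_nat /= -pmulrn (dvdn_pcharf hp).
Qed.

Lemma skel_base : exists St Phi, skel St Phi.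
Proof.
pose St : set C := [set x | exists n : int, x = n%:~R].
(* An integer is recovered from its image in [C], where it is unique by [charC]. *)
pose Phi (x : C) : k := (xget 0 [set n : int | x = n%:~R])%:~R.
have PhiE n : Phi n%:~R = n%:~R.
  rewrite /Phi; case: xgetP => [m _ /= /eqP|/(_ n)/=/(_ erefl)//].
  by rewrite -subr_eq0 -rmorphB /= charC subr_eq0 => /eqP ->.
have hB : is_subring St.
  split=> [|x y [a ->] [b ->]|x y [a ->] [b ->]]; first by exists 1.
    by exists (a - b); rewrite rmorphB.
  by exists (a * b); rewrite rmorphM.
exists St, Phi; split=> //.
- exists [::]; apply/seteqP; split=> [x [n ->]|].
    have h := @ring_generated_subring C [set` [::]].
    have hn (m : nat) : ring_generated [set` [::]] (m%:R : C).
      elim: m => [|m IH]; first exact: (subring0 h).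
      by rewrite -natr1; apply: (subringD h IH); apply: (subring1 h).
    case: n => n; first by rewrite -pmulrn.
    by rewrite NegzE rmorphN /= -pmulrn; apply: (subringN h).
  by apply: ring_generated_sub => // x.
- exact: (PhiE 1).
- by move=> x y [a ->] [b ->]; rewrite -rmorphD !PhiE rmorphD.
- by move=> x y [a ->] [b ->]; rewrite -rmorphM !PhiE rmorphM.
- move=> x [a ->]; rewrite PhiE; split=> [/eqP|[y [b ->] /eqP]].
    rewrite intr_pchar => /dvdzP[b ->]; exists b%:~R; first by exists b.
    by rewrite rmorphM /= -mulr_natr -pmulrn.
  have -> : (b%:~R *+ p : C) = (b * p%:Z)%:~R.
    by rewrite rmorphM /= -mulr_natr -pmulrn.
  rewrite -subr_eq0 -rmorphB /= charC subr_eq0 => /eqP ->.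
  by apply/eqP; rewrite intr_pchar dvdz_mull.
- exists (fun n => (odflt 0 (unpickle n : option int))%:~R) => x [a ->].
  by exists (pickle a); rewrite pickleK.
Qed.

Definition skel_rep (St : set C) (Phi : C -> k) (A : comNzRingType)
    (iota : {rmorphism A -> C}) (phi : {rmorphism A -> k}) : Prop :=
  [/\ injective iota, forall x, St x <-> exists a, iota a = x
    & forall a, Phi (iota a) = phi a].

Definition skel_ext (St : set C) (Phi : C -> k) (St' : set C) (Phi' : C -> k) :=
  St `<=` St' /\ forall x, St x -> Phi' x = Phi x.

Lemma skel_rep_ker St Phi A iota phi : skel St Phi ->
  @skel_rep St Phi A iota phi ->
  forall a, phi a = 0 <-> exists b, a = b *+ p.
Proof.
move=> hs [inj hS hP] a; rewrite -hP (skel_ker hs); last by apply/hS; exists a.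
split=> [[y /hS[b <-] /eqP]|[b ->]].
  by rewrite -rmorphMn => /eqP/inj ->; exists b.
by exists (iota b); [apply/hS; exists b | rewrite rmorphMn].
Qed.

(** The first condition makes sending beta to alpha well defined on A[beta]; the second makes the
    kernel of the resulting reduction p A[beta]. *)
Lemma skel_adjoin St Phi A iota phi alpha beta : skel St Phi ->
  @skel_rep St Phi A iota phi ->
  (forall g : {poly A}, (map_poly iota g).[beta] = 0 ->
     (map_poly phi g).[alpha] = 0) ->
  (forall g : {poly A}, (map_poly phi g).[alpha] = 0 ->
     exists h : {poly A}, (map_poly iota g).[beta] = (map_poly iota h).[beta] *+ p) ->
  exists St' Phi', [/\ skel St' Phi', skel_ext St Phi St' Phi',
    St' beta & Phi' beta = alpha].
Proof.
move=> hs [inj hS hP] h1 h2.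
pose ib (g : {poly A}) := (map_poly iota g).[beta].
pose pa (g : {poly A}) := (map_poly phi g).[alpha].
pose St' : set C := [set x | exists g, x = ib g].
pose Phi' x := pa (xget 0 [set g | x = ib g]).
have ibD g h : ib (g + h) = ib g + ib h by rewrite /ib rmorphD hornerD.
have ibN g : ib (- g) = - ib g by rewrite /ib rmorphN hornerN.
have ibM g h : ib (g * h) = ib g * ib h by rewrite /ib rmorphM hornerM.
have paD g h : pa (g + h) = pa g + pa h by rewrite /pa rmorphD hornerD.
have paN g : pa (- g) = - pa g by rewrite /pa rmorphN hornerN.
have paM g h : pa (g * h) = pa g * pa h by rewrite /pa rmorphM hornerM.
have ibC a : ib a%:P = iota a by rewrite /ib map_polyC hornerC.
have paC a : pa a%:P = phi a by rewrite /pa map_polyC hornerC.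
have ibX : ib 'X = beta by rewrite /ib map_polyX hornerX.
have paX : pa 'X = alpha by rewrite /pa map_polyX hornerX.
have PhiE g : Phi' (ib g) = pa g.
  rewrite /Phi'; case: xgetP => [h _ /= E|/(_ g)/=/(_ erefl)//].
  apply/eqP; rewrite -subr_eq0 -paN -paD; apply/eqP/h1.
  by rewrite -/(ib _) ibD ibN E subrr.
have hB : is_subring St'.
  split=> [|x y [a ->] [b ->]|x y [a ->] [b ->]].
  - by exists 1; rewrite /ib rmorph1 hornerC.
  - by exists (a - b); rewrite ibD ibN.
  - by exists (a * b); rewrite ibM.
have SS : St `<=` St' by move=> x /hS[a <-]; exists a%:P; rewrite ibC.
exists St', Phi'; split; last 2 first.
- by exists 'X; rewrite ibX.
- by rewrite -ibX PhiE paX.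
- split=> //.
  + have [s sE] := skel_fg hs; exists (beta :: s).
    have hG := @ring_generated_subring C [set` beta :: s].
    apply/seteqP; split=> [x [g ->]|]; last first.
      apply: ring_generated_sub => // x /=; rewrite inE => /predU1P[->|xs].
        by exists 'X; rewrite ibX.
      by apply: SS; rewrite sE; apply: sub_ring_generated.
    rewrite /ib horner_coef; apply: subring_sum; first exact: hG.
    move=> i _.
    apply: (subringM hG); last first.
      by apply: (subringX _ hG); apply: sub_ring_generated; rewrite /= mem_head.
    have : St (iota g`_i) by apply/hS; exists g`_i.
    rewrite coef_map sE; apply: ring_generated_sub => // y xs.
    by apply: sub_ring_generated; rewrite /= inE xs orbT.
  + have -> : (1 : C) = ib 1%:P by rewrite ibC rmorph1.
    by rewrite PhiE paC rmorph1.
  + by move=> x y [a ->] [b ->]; rewrite -ibD !PhiE.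
  + by move=> x y [a ->] [b ->]; rewrite -ibM !PhiE.
  + move=> x [g ->]; rewrite PhiE; split=> [/h2[h E]|[y [h ->] E]].
      by exists (ib h) => //; exists h.
    have -> : pa g = Phi' (ib g) by rewrite PhiE.
    rewrite E; have -> : ib h *+ p = ib (h *+ p) by rewrite /ib rmorphMn hornerMn.
    by rewrite PhiE /pa rmorphMn hornerMn mulrn_pchar.
  (* An element of A[beta] is coded by the list of indices of the coefficients of a polynomial. *)
  + have [f fP] := skel_countable hs.
    have [idx idxP] : {idx : A -> nat & forall a, f (idx a) = iota a}.
      by apply: (@choice _ _ (fun a n => f n = iota a)) => a; apply/fP/hS; exists a.
    exists (fun n => let l := odflt [::] (unpickle n : option (seq nat)) in
      \sum_(i < size l) f (nth 0%N l i) * beta ^+ i) => x [g ->].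
    exists (pickle [seq idx a | a <- g : seq A]); rewrite pickleK /= size_map.
    rewrite /ib (@horner_coef_wide _ (size g)) ?size_map_poly_leq //; last first.
      exact: size_poly.
    by apply: eq_bigr => i _; rewrite (nth_map 0) // idxP coef_map.
- by split=> // x /hS[a <-]; rewrite -{1}ibC PhiE paC hP.
Qed.

Lemma skel_localize St Phi A iota phi t : skel St Phi ->
  @skel_rep St Phi A iota phi -> phi t != 0 ->
  exists St' Phi', [/\ skel St' Phi', skel_ext St Phi St' Phi',
    St' (iota t)^-1 & Phi' (iota t)^-1 = (phi t)^-1].
Proof.
move=> hs hr t0; have [inj hS hP] := hr.
have it0 : iota t != 0.
  by apply: contraNneq t0; rewrite -(rmorph0 iota) => /inj ->; rewrite rmorph0.
(* The value of g at the inverse of t, multiplied by a power of t so as to lie in [A]. *)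
pose G (g : {poly A}) := \sum_(i < size g) g`_i * t ^+ (size g - i).
have GE (D : fieldType) (h : {rmorphism A -> D}) g : h t != 0 ->
    h (G g) = h t ^+ size g * (map_poly h g).[(h t)^-1].
  move=> ht; rewrite rmorph_sum (@horner_coef_wide _ (size g)) ?size_poly //.
  rewrite big_distrr; apply: eq_bigr => i _.
  rewrite rmorphM rmorphXn coef_map /= mulrCA; congr (_ * _).
  by rewrite exprVn exprB ?unitfE // (ltnW (ltn_ord i)).
apply: (skel_adjoin hs hr) => g gE.
  apply/eqP; rewrite -(mulIr_eq0 _ (mulIf (expf_neq0 (size g) t0))) mulrC -GE //.
  have : iota (G g) = 0 by rewrite GE // gE mulr0.
  by rewrite -(rmorph0 iota) => /inj ->; rewrite rmorph0.
have : phi (G g) = 0 by rewrite GE // gE mulr0.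
move/(skel_rep_ker hs hr) => [b bE]; exists (b *: 'X^(size g)).
apply: (mulfI (expf_neq0 (size g) it0)); rewrite -GE // bE rmorphMn mulrnAr.
congr (_ *+ p); rewrite map_polyZ /= map_polyXn hornerZ hornerXn mulrCA -exprMn.
by rewrite divff // expr1n mulr1.
Qed.

(** With beta transcendental over the countable skeleton, only the zero polynomial vanishes at beta,
    and a polynomial whose reduction vanishes at alpha has all its coefficients in p A. *)
Lemma skel_transcendental St Phi A iota phi alpha : skel St Phi ->
  @skel_rep St Phi A iota phi ->
  (forall g : {poly A}, (map_poly phi g).[alpha] = 0 -> map_poly phi g = 0) ->
  exists St' Phi', [/\ skel St' Phi', skel_ext St Phi St' Phi' &
    exists2 x, St' x & Phi' x = alpha].
Proof.
move=> hs hr ha; have [inj hS hP] := hr.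
have [f fP] := skel_countable hs.
have roots (q : {poly C}) : {rs : seq C | q != 0 -> forall x, root q x -> x \in rs}.
  by have [rs E] := closed_field_poly_normal q; exists rs => q0 x; rewrite E rootZ ?lead_coef_eq0 // root_prod_XsubC.
pose P (l : seq nat) := \poly_(i < size l) f (nth 0%N l i).
(* Pairs of a coded polynomial and a position in its list of roots enumerate all elements algebraic
   over the skeleton. *)
pose g n := let li := odflt ([::], 0%N) (unpickle n : option (seq nat * nat)) in
  nth 0 (sval (roots (P li.1))) li.2.
have [beta hbeta] := uncountableC g.
have btr (h : {poly A}) : (map_poly iota h).[beta] = 0 -> h = 0.
  move=> h0; apply/eqP/negP => /negP hn0.
  have [idx idxP] : {idx : A -> nat & forall a, f (idx a) = iota a}.
    by apply: (@choice _ _ (fun a n => f n = iota a)) => a; apply/fP/hS; exists a.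
  pose l := [seq idx a | a <- h : seq A].
  have PE : P l = map_poly iota h.
    apply/polyP => i; rewrite coef_poly size_map coef_map.
    case: ltnP => hi; first by rewrite (nth_map 0) // idxP.
    have -> : h`_i = 0 by exact: nth_default.
    exact/esym/rmorph0.
  have Pn0 : P l != 0 by rewrite PE map_poly_eq0_id0 // -(rmorph0 iota) (inj_eq inj) lead_coef_eq0.
  have hin : beta \in sval (roots (P l)).
    by apply: (svalP (roots (P l))) => //; rewrite PE; apply/eqP.
  apply: (hbeta (pickle (l, index beta (sval (roots (P l)))))).
  by rewrite /g pickleK /= nth_index.
have [|g0 /ha g00|St' [Phi' [h1 h2 h3 h4]]] := @skel_adjoin _ _ _ _ _ alpha beta hs hr.
- by move=> h /btr ->; rewrite rmorph0 horner0.
- have [h hE] : {h : nat -> A & forall i, g0`_i = h i *+ p}.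
    apply: (@choice _ _ (fun i b => g0`_i = b *+ p)) => i.
    by apply/(skel_rep_ker hs hr); rewrite -coef_map g00 coef0.
  exists (\poly_(i < size g0) h i); rewrite -hornerMn -rmorphMn; congr (_.[_]).
  congr (map_poly _ _); apply/polyP => i; rewrite coefMn coef_poly.
  by case: ltnP => hi; [exact: hE | rewrite nth_default ?mul0rn].
by exists St', Phi'; split=> //; exists beta.
Qed.

Lemma size_map_poly_leq (A B : nzRingType) (h : {rmorphism A -> B}) (g : {poly A}) :
  (size (map_poly h g) <= size g)%N.
Proof.
by apply/leq_sizeP => j hj; rewrite coef_map /= nth_default // rmorph0.
Qed.

Lemma skel_rep_reduce St Phi (A : comNzRingType) iota phi (g : {poly A}) : skel St Phi ->
  @skel_rep St Phi A iota phi -> map_poly phi g = 0 ->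
  exists h : {poly A}, g = h *+ p.
Proof.
move=> hs hr g0.
have [h hE] : {h : nat -> A & forall i, g`_i = h i *+ p}.
  apply: (@choice _ _ (fun i b => g`_i = b *+ p)) => i.
  by apply/(skel_rep_ker hs hr); rewrite -coef_map g0 coef0.
exists (\poly_(i < size g) h i); apply/polyP => i; rewrite coefMn coef_poly.
by case: ltnP => hi; [exact: hE | rewrite nth_default ?mul0rn].
Qed.

Section Algebraic.
Variables (St : set C) (Phi : C -> k) (A : comNzRingType).
Variables (iota : {rmorphism A -> C}) (phi : {rmorphism A -> k}).
Hypotheses (hs : skel St Phi) (hr : skel_rep St Phi iota phi).
Variables (alpha : k) (f : {poly A}).
Hypothesis fm : f \is monic.
Hypothesis fa : (map_poly phi f).[alpha] = 0.
Hypothesis fmin : forall g : {poly A}, (map_poly phi g).[alpha] = 0 ->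
  map_poly phi g != 0 -> (size f <= size (map_poly phi g))%N.

Lemma size_map_monic (B : nzRingType) (h : {rmorphism A -> B}) :
  size (map_poly h f) = size f.
Proof.
apply/eqP; rewrite eqn_leq size_map_poly_leq /=.
rewrite -[size f]prednK ?size_poly_gt0 ?monic_neq0 //.
rewrite ltnNge; apply/negP => /leq_sizeP/(_ _ (leqnn _))/eqP.
by rewrite coef_map /= -lead_coefE (monicP fm) rmorph1 oner_eq0.
Qed.

(* The division takes place in the image of phi, which need not be a field. *)
Lemma skel_bezout (r : {poly A}) :
  map_poly phi r != 0 -> (size (map_poly phi r) < size f)%N ->
  exists u v w t,
    [/\ u * r = t%:P + v * f + w, phi t != 0 & map_poly phi w = 0].
Proof.
have [n] := ubnP (size (map_poly phi r)).
elim: n r => // n IH r rn r0 rf.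
have [/eqP/size_poly1P[c c0 cE]|r1] := eqVneq (size (map_poly phi r)) 1%N.
  exists 1, 0, (r - (r`_0)%:P), r`_0; split.
  - by rewrite mul0r addr0 mul1r addrC subrK.
  - by rewrite -coef_map cE coefC.
  - by rewrite rmorphB /= map_polyC /= -coef_map cE coefC subrr.
(* Cutting r at the degree of its reduction gives a leading coefficient outside the kernel of [phi],
   so pseudo-division by r2 survives reduction. *)
pose r2 := take_poly (size (map_poly phi r)) r.
have r2E : map_poly phi r2 = map_poly phi r.
  apply/polyP => i; rewrite coef_map coef_take_poly /=.
  case: ltnP => hi; first by rewrite coef_map.
  by rewrite rmorph0 [RHS]nth_default.
have r2s : size r2 = size (map_poly phi r).
  by apply/eqP; rewrite eqn_leq size_take_poly /= -r2E size_map_poly_leq.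
have r2l : phi (lead_coef r2) != 0.
  by rewrite lead_coefE r2s -coef_map r2E -lead_coefE lead_coef_eq0.
have r20 : r2 != 0 by apply: contraNneq r2l => ->; rewrite lead_coef0 rmorph0.
have [q [r' [m [E r's]]]] : exists q r' m,
    f * (lead_coef r2 ^+ m)%:P = q * r2 + r' /\ (size r' < size r2)%N.
  exists (Pdiv.Ring.rdivp f r2), (Pdiv.Ring.rmodp f r2), (Pdiv.Ring.rscalp f r2).
  split; last by rewrite Pdiv.Ring.ltn_rmodp.
  by rewrite mulrC mul_polyC Pdiv.ComRing.rdivp_eq.
set c := lead_coef r2 ^+ m in E.
have c0 : phi c != 0 by rewrite rmorphXn expf_neq0.
have sr' := size_map_poly_leq phi r'.
have [r'0|r'0] := eqVneq (map_poly phi r') 0; last first.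
  have lt1 : (size (map_poly phi r') < size (map_poly phi r))%N.
    by apply: leq_ltn_trans sr' _; rewrite -r2s.
  have [u [v [w [t [uE t0 w0]]]]] :=
    IH r' (leq_trans lt1 rn) r'0 (ltn_trans lt1 rf).
  exists (- u * q), (v - u * c%:P), (w - u * q * (r - r2)), t; split=> //.
    have -> : - u * q * r = u * r' - u * c%:P * f - u * q * (r - r2).
      have -> : r' = f * c%:P - q * r2 by rewrite E addrAC subrr add0r.
      by ring.
    by rewrite uE; ring.
  by rewrite rmorphB rmorphM rmorphB /= r2E subrr mulr0 w0 subr0.
(* The remainder reduces to 0, so alpha would be a root of the reduction of q or of r, both too
   short for the minimality of f. *)
have Ephi : map_poly phi f * (phi c)%:P = map_poly phi q * map_poly phi r.
  have := congr1 (map_poly phi) E.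
  by rewrite rmorphM rmorphD rmorphM /= r'0 addr0 r2E map_polyC.
have := congr1 (fun h => h.[alpha]) Ephi; rewrite !hornerM fa mul0r => /esym/eqP.
rewrite mulf_eq0 => /orP[] /eqP h0; last first.
  by have := fmin h0 r0; rewrite leqNgt rf.
have f0 : map_poly phi f != 0.
  by rewrite -size_poly_eq0 size_map_monic size_poly_eq0 monic_neq0.
have qn0 : map_poly phi q != 0.
  apply: contraNneq f0 => q0; move/eqP: Ephi.
  by rewrite q0 mul0r mulf_eq0 polyC_eq0 (negPf c0) orbF.
have := fmin h0 qn0; have := congr1 (fun h : {poly k} => size h) Ephi.
rewrite /= [_ * (phi c)%:P]mulrC size_Cmul // size_map_monic size_mul //.
move=> e1 e2; exfalso; move: r0 qn0 r1 e1 e2; rewrite -!size_poly_gt0.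
by move: (size (map_poly phi r)) (size (map_poly phi q)) (size f) => a b d; lia.
Qed.

(** Any root beta of the monic f will do: division by f leaves the conditions of [skel_adjoin] to be
    checked on remainders. That a remainder vanishing at beta reduces to 0 is the delicate point,
    since f need not be irreducible over [C]. *)
Lemma skel_algebraic : exists St' Phi', [/\ skel St' Phi', skel_ext St Phi St' Phi' &
    exists2 x, St' x & Phi' x = alpha].
Proof.
have [inj hS hP] := hr.
have [beta /eqP fb] : exists beta, root (map_poly iota f) beta.
  apply/closed_rootP; rewrite size_map_monic -(size_map_monic phi).
  apply/negP => /size_poly1P[c c0 cE].
  by move/eqP: c0; apply; rewrite -fa cE hornerC.
have division (g : {poly A}) : exists q r, g = q * f + r /\ (size r < size f)%N.
  exists (Pdiv.Ring.rdivp g f), (Pdiv.Ring.rmodp g f).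
  split; first exact: Pdiv.RingMonic.rdivp_eq.
  by rewrite Pdiv.Ring.ltn_rmodp monic_neq0.
have [|g ga|St' [Phi' [h1 h2 h3 h4]]] := @skel_adjoin _ _ _ _ _ alpha beta hs hr.
- move=> g gb; have [q [r [E rf]]] := division g.
  have rb : (map_poly iota r).[beta] = 0.
    by move: gb; rewrite E rmorphD rmorphM /= hornerD hornerM fb mulr0 add0r.
  rewrite E rmorphD rmorphM /= hornerD hornerM fa mulr0 add0r.
  have [->|r0] := eqVneq (map_poly phi r) 0; first by rewrite horner0.
  have rs := leq_ltn_trans (size_map_poly_leq phi r) rf.
  have [u [v [w [t [uE t0 w0]]]]] := skel_bezout r0 rs.
  have [h hE] := skel_rep_reduce hs hr w0.
  pose y := (map_poly iota h).[beta].
  (* At beta both r and f vanish, and w is divisible by p. *)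
  have ty : iota t = - p%:R * y.
    have := congr1 (fun h => (map_poly iota h).[beta]) uE.
    rewrite /= rmorphM !rmorphD rmorphM /= hornerM rb mulr0 !hornerD hornerM fb.
    rewrite mulr0 addr0 map_polyC hornerC hE rmorphMn hornerMn -/y => /esym/eqP.
    by rewrite addr_eq0 mulNr mulr_natl => /eqP.
  have [m mm /eqP m0] : integralOver iota y.
    apply: integral_horner; last by exists f => //; apply/eqP.
    by apply/integral_poly => i; rewrite coef_map; apply: integral_id.
  pose D := (size m).-1.
  have mD : size m = D.+1 by rewrite prednK // size_poly_gt0 monic_neq0.
  (* An integral equation of y, multiplied by (- p)^D, becomes an equation of t over [A]. Its
     reduction leaves only the power t^D, contradicting [phi t != 0]. *)
  pose M := \sum_(i < D.+1) m`_i * (- p%:R) ^+ (D - i) * t ^+ i.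
  have M0 : M = 0.
    apply: inj; rewrite rmorph0 rmorph_sum /=.
    apply: etrans (etrans (congr1 (fun z => (- p%:R) ^+ D * z) m0) (mulr0 _)).
    rewrite (@horner_coef_wide _ D.+1) -?mD ?size_map_poly_leq // mD big_distrr.
    apply: eq_bigr => i _; rewrite !rmorphM !rmorphXn rmorphN rmorph_nat ty coef_map /=.
    have aux (a1 a2 b z : C) : b * a1 * (a2 * z) = (a1 * a2) * (b * z) by ring.
    by rewrite exprMn aux -exprD subnK // -ltnS.
  exfalso; have := congr1 phi M0; rewrite rmorph0 rmorph_sum big_ord_recr /=.
  rewrite big1 ?add0r => [|i _].
    rewrite subnn expr0 mulr1 -/D -lead_coefE (monicP mm) mul1r rmorphXn => /eqP.
    by rewrite expf_eq0 (negPf t0) andbF.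
  rewrite !rmorphM rmorphXn rmorphN rmorph_nat (pcharf0 hp) oppr0 expr0n.
  by rewrite subn_eq0 leqNgt ltn_ord mulr0 mul0r.
- have [q [r [E rf]]] := division g.
  have r0 : map_poly phi r = 0.
    apply/eqP; apply: contraT => r0.
    have ra : (map_poly phi r).[alpha] = 0.
      by move: ga; rewrite E rmorphD rmorphM /= hornerD hornerM fa mulr0 add0r.
    have := fmin ra r0; rewrite leqNgt.
    by rewrite (leq_ltn_trans (size_map_poly_leq phi r) rf).
  have [h hE] := skel_rep_reduce hs hr r0; exists h.
  by rewrite E rmorphD rmorphM /= hornerD hornerM fb mulr0 add0r hE rmorphMn hornerMn.
by exists St', Phi'; split=> //; exists beta.
Qed.

End Algebraic.

Lemma skel_ext_trans St Phi St1 Phi1 St2 Phi2 :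
  skel_ext St Phi St1 Phi1 -> skel_ext St1 Phi1 St2 Phi2 ->
  skel_ext St Phi St2 Phi2.
Proof.
move=> [h1 h2] [h3 h4]; split=> [x /h1/h3//|x hx].
by rewrite h4 ?h2 //; apply: h1.
Qed.

Lemma skel_extend St Phi alpha : skel St Phi ->
  exists St' Phi', [/\ skel St' Phi', skel_ext St Phi St' Phi' &
    exists2 x, St' x & Phi' x = alpha].
Proof.
move=> hs.
(* The degree of an equation of alpha is minimized over all extensions of the skeleton, so it
   remains minimal after a leading coefficient has been inverted. If no extension has an equation,
   alpha is transcendental over the image of [phi]. *)
pose P n := `[< exists St1 Phi1, [/\ skel St1 Phi1, skel_ext St Phi St1 Phi1 &
  exists (A : comNzRingType) iota phi, @skel_rep St1 Phi1 A iota phi /\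
  exists g : {poly A}, [/\ (map_poly phi g).[alpha] = 0, map_poly phi g != 0 &
    size (map_poly phi g) = n]] >].
have [exP|hP] := pselect (exists n, P n); last first.
  have [A [iota [phi hr]]] := skel_type hs.
  apply: (skel_transcendental hs hr) => g ga; apply/eqP; apply: contraT => g0.
  case: hP; exists (size (map_poly phi g)); apply/asboolP.
  exists St, Phi; split=> //; first by split.
  exists A, iota, phi; split=> //.
  by exists g.
have [n /asboolP[St1 [Phi1 [hs1 he1 [A [iota [phi [hr [g [ga g0 gn]]]]]]]]] nmin] :=
  ex_minnP exP.
pose t := g`_n.-1.
have n0 : (0 < n)%N by rewrite -gn size_poly_gt0.
have t0 : phi t != 0 by rewrite -coef_map -gn -lead_coefE lead_coef_eq0.
have [St2 [Phi2 [hs2 he2 h2t h2Phi]]] := skel_localize hs1 hr t0.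
have [A2 [iota2 [phi2 hr2]]] := skel_type hs2.
have [inj hS hP] := hr; have [inj2 hS2 hP2] := hr2.
have [c cE] : {c : nat -> A2 & forall i, iota2 (c i) = iota g`_i * (iota t)^-1}.
  apply: (@choice _ _ (fun i b => iota2 b = iota g`_i * (iota t)^-1)) => i.
  apply/hS2; apply: (subringM (skel_ring hs2)) => //; apply: he2.1.
  by apply/hS; exists g`_i.
have it0 : iota t != 0.
  by apply: contraNneq t0; rewrite -(rmorph0 iota) => /inj ->; rewrite rmorph0.
(* The coefficients of g from n on reduce to 0 and are cut off, which makes f monic. *)
pose f := \poly_(i < n) c i.
have cn : c n.-1 = 1 by apply: inj2; rewrite cE rmorph1 divff.
have fs : size f = n by rewrite size_poly_eq // cn oner_eq0.
have fm : f \is monic.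
  by rewrite monicE lead_coefE fs coef_poly prednK ?leqnn // cn.
have fE : map_poly phi2 f = (phi t)^-1 *: map_poly phi g.
  apply/polyP => i; rewrite coefZ coef_map coef_poly /=; case: ltnP => hi.
    rewrite coef_map -hP2 cE (skelM hs2) ?h2Phi // ?he2.2 //; last first.
    - by apply: he2.1; apply/hS; exists g`_i.
    - by apply/hS; exists g`_i.
    by rewrite hP mulrC.
  by rewrite rmorph0 [X in _ * X]nth_default ?mulr0 ?gn.
have [||St3 [Phi3 [hs3 he3 hx]]] := @skel_algebraic _ _ _ _ _ hs2 hr2 alpha f fm.
- by rewrite fE hornerZ ga mulr0.
- move=> h ha h0; rewrite fs; apply: nmin; apply/asboolP.
  exists St2, Phi2; split=> //; first exact: skel_ext_trans he2.
  by exists A2, iota2, phi2; split=> //; exists h.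
exists St3, Phi3; split=> //; apply: skel_ext_trans he3.
exact: skel_ext_trans he2.
Qed.

Lemma skel_exists (xs : seq k) : exists St Phi, skel St Phi /\
  forall x, x \in xs -> exists2 y, St y & Phi y = x.
Proof.
elim: xs => [|x xs [St [Phi [hs hx]]]].
  by have [St [Phi hs]] := skel_base; exists St, Phi.
have [St' [Phi' [hs' [h1 h2] [y hy yx]]]] := skel_extend x hs.
exists St', Phi'; split=> // z; rewrite inE => /predU1P[->|/hx[w hw <-]].
  by exists y.
by exists w; [exact: h1 | exact: h2].
Qed.

End Skeletons.

(** * Uncountability of the complex numbers *)

Lemma real_uncountable (R : realType) (g : nat -> R) : exists x, forall n, g n != x.
Proof.
(* Nested intervals: of the two outer thirds, the one on the other side of the midpoint avoids
   [g n]. The supremum of the left ends lies in all the intervals. *)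
pose nxt n (ab : R * R) : R * R := let: (a, b) := ab in
  if g n < (a + b) / 2 then ((a + 2 * b) / 3, b) else (a, (2 * a + b) / 3).
pose ab := fix ab n := if n is n'.+1 then nxt n' (ab n') else (0 : R, 1 : R).
have lt n : (ab n).1 < (ab n).2.
  elim: n => [|n] /=; first exact: ltr01.
  by case: (ab n) => a b /= h; case: ifP => _ /=; lra.
have mono n : (ab n).1 <= (ab n.+1).1 /\ (ab n.+1).2 <= (ab n).2.
  have := lt n; rewrite /=; case: (ab n) => a b /= h; case: ifP => _ /=; lra.
have avoid n : g n < (ab n.+1).1 \/ (ab n.+1).2 < g n.
  have := lt n; rewrite /=; case: (ab n) => a b /= h.
  case: (ltP (g n) ((a + b) / 2)) => hg /=; [left|right]; lra.
have mono1 m n : (m <= n)%N -> (ab m).1 <= (ab n).1.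
  move=> /subnK <-; elim: (n - m)%N => // d; move/le_trans; apply.
  by have [] := mono (d + m)%N.
have mono2 m n : (m <= n)%N -> (ab n).2 <= (ab m).2.
  move=> /subnK <-; elim: (n - m)%N => // d; apply: le_trans.
  by have [] := mono (d + m)%N.
pose E : set R := [set (ab n).1 | n in setT].
have Eb m : ubound E (ab m).2.
  move=> _ [n _ <-]; have [h|h] := leqP n m.
    exact: le_trans (mono1 _ _ h) (ltW (lt m)).
  exact: le_trans (ltW (lt n)) (mono2 _ _ (ltnW h)).
exists (sup E) => n; apply/eqP => gn.
have h1 : (ab n.+1).1 <= sup E.
  by apply: ub_le_sup; [exists (ab 0%N).2 | exists n.+1].
have h2 : sup E <= (ab n.+1).2 by apply: ge_sup => //; exists (ab 0%N).1, 0%N.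
by case: (avoid n); rewrite gn ltNge ?h1 ?h2.
Qed.

Lemma complex_uncountable (R : realType) (g : nat -> R[i]) :
  exists z, forall n, g n <> z.
Proof.
have [x hx] := real_uncountable (fun n => complex.Re (g n)).
by exists (x%:C)%C => n E; have := hx n; rewrite E eqxx.
Qed.

(** * Evaluation, derivations and coordinates in the function field *)

Section BivariatePolynomials.
Variable A : comNzRingType.

Definition mono2 (i j : nat) : 'X_{1..2} :=
  [multinom (if (l == 0 :> 'I_2)%R then i else j) | l < 2].

Lemma mono2_eta (m : 'X_{1..2}) : mono2 (m 0) (m 1) = m.
Proof.
apply/mnmP => -[[|[|//]] hl]; rewrite mnmE /=; congr (m _); exact: val_inj.
Qed.

(** Blow ups and divisions take place in iterated polynomials, whereas ideals and fractions live
    over [{mpoly A[2]}]. *)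
Definition toPP : {mpoly A[2]} -> {poly {poly A}} :=
  mmap (@CC A : A -> pp A) (fun l : 'I_2 => if l == 0 then 'X else 'Y).

Definition ofPP : {poly {poly A}} -> {mpoly A[2]} :=
  ev2 (@mpolyC 2 A) 'X_0 'X_1.
HB.instance Definition _ := GRing.RMorphism.on ofPP.

Lemma toPPE f : toPP f =
  \sum_(m <- msupp f) CC f@_m * ('X^(m 0) * ('X^(m 1))%:P).
Proof.
apply: eq_bigr => m _; congr (_ * _).
rewrite /mmap1 !big_ord_recl big_ord0 mulr1 /= polyC_exp.
by congr (_ ^+ m _ * _ ^+ m _); apply: val_inj.
Qed.

Lemma coef_toPP f i j : (toPP f)`_i`_j = f@_(mono2 i j).
Proof.
rewrite toPPE coef_sum coef_sum.
under eq_bigr => m _ do rewrite coef_CCM coef_monomial.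
have [h|h] := boolP (mono2 i j \in msupp f).
  rewrite (bigD1_seq _ h (msupp_uniq f)) /= !mnmE /= !eqxx mulr1 big1 ?addr0 // => m hm.
  case: andP => [[/eqP h0 /eqP h1]|]; last by rewrite mulr0.
  by case/eqP: hm; rewrite -(mono2_eta m) h0 h1.
rewrite memN_msupp_eq0 // big_seq big1 // => m hm.
case: andP => [[/eqP h0 /eqP h1]|]; last by rewrite mulr0.
by case/negP: h; rewrite -h0 -h1 mono2_eta.
Qed.

Lemma coef_ofPP f m : (ofPP f)@_m = f`_(m 0)`_(m 1).
Proof.
rewrite -[m in LHS]mono2_eta -coef_toPP; move: (m 0) (m 1) => i j {m}.
suff -> : toPP (ofPP f) = sub2 'X 'Y f by rewrite sub2_id.
rewrite /sub2.
have hM : monoid_morphism (toPP \o ofPP).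
  split=> [|x y]; first by rewrite /= rmorph1 /toPP rmorph1.
  by rewrite /= rmorphM /toPP rmorphM.
have hZ : zmod_morphism (toPP \o ofPP).
  by move=> x y; rewrite /= rmorphB /toPP rmorphB.
pose mz := GRing.isZmodMorphism.Build _ _ (toPP \o ofPP) hZ.
pose mm := GRing.isMonoidMorphism.Build _ _ (toPP \o ofPP) hM.
pose psi : {rmorphism pp A -> pp A} := HB.pack (toPP \o ofPP) mz mm.
apply: (@ev2_unique A (pp A) CC 'X 'Y psi) => [c||] /=.
- by rewrite /ofPP ev2CC /toPP mmapC.
- by rewrite /ofPP ev2X /toPP mmapX mmap1U.
- by rewrite /ofPP ev2Y /toPP mmapX mmap1U.
Qed.

Lemma toPPK : cancel toPP ofPP.
Proof. by move=> f; apply/mpolyP => m; rewrite coef_ofPP coef_toPP mono2_eta. Qed.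

Lemma ofPPK : cancel ofPP toPP.
Proof.
move=> f; apply/polyP => i; apply/polyP => j.
by rewrite coef_toPP coef_ofPP !mnmE.
Qed.

End BivariatePolynomials.

Section Field.
Variables (F L : fieldType) (cst : {rmorphism F -> L}).
Local Notation PP := {poly {poly F}}.
Implicit Types (x y u v : L) (f g : PP).

Definition evK u v : PP -> L := ev2 cst u v.
HB.instance Definition _ u v := GRing.RMorphism.on (evK u v).

Lemma evKX u v : evK u v 'X = u. Proof. exact: ev2X. Qed.
Lemma evKY u v : evK u v 'Y = v. Proof. exact: ev2Y. Qed.
Lemma evKCC u v c : evK u v (CC c) = cst c. Proof. exact: ev2CC. Qed.

Definition is_der (d : L -> L) := [/\ forall x y, d (x + y) = d x + d y,
  forall x y, d (x * y) = d x * y + x * d y & forall c, d (cst c) = 0].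

Section Derivations.
Variables (d : L -> L) (hd : is_der d).

Lemma derM x y : d (x * y) = d x * y + x * d y.
Proof. by have [_ h _] := hd. Qed.

Lemma derD x y : d (x + y) = d x + d y.
Proof. by have [h _ _] := hd. Qed.

Lemma der_cst c : d (cst c) = 0.
Proof. by have [_ _ h] := hd. Qed.

Lemma der0 : d 0 = 0.
Proof. by rewrite -{1}(rmorph0 cst) der_cst. Qed.

Lemma derN x : d (- x) = - d x.
Proof. by apply/eqP; rewrite -addr_eq0 -derD addNr der0. Qed.

Lemma derB x y : d (x - y) = d x - d y.
Proof. by rewrite derD derN. Qed.

Lemma der_div x y : y != 0 -> d (x / y) = (d x - (x / y) * d y) / y.
Proof.
move=> y0; have := derM (x / y) y; rewrite divfK // => ->.
by rewrite addrK mulfK.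
Qed.

Definition dX (f : PP) : PP := f^`().
Definition dY (f : PP) : PP := map_poly (@deriv F) f.

Lemma der_evK u v f :
  d (evK u v f) = evK u v (dX f) * d u + evK u v (dY f) * d v.
Proof.
have hC (g : {poly F}) : d (evK u v g%:P) = evK u v (g^`())%:P * d v.
  elim/poly_ind: g => [|g c IH].
    by rewrite deriv0 polyC0 rmorph0 der0 mul0r.
  have -> : (g * 'X + c%:P)%:P = g%:P * 'Y + CC c by rewrite polyCD polyCM.
  rewrite rmorphD rmorphM /= derD derM evKY evKCC der_cst addr0 IH.
  rewrite derivD derivM derivX derivC addr0 mulr1 polyCD polyCM rmorphD rmorphM /= evKY.
  by ring.
elim/poly_ind: f => [|f g IH].
  have -> : dX 0 = 0 by exact: deriv0.
  have -> : dY 0 = 0 by exact: raddf0.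
  by rewrite rmorph0 der0 !mul0r addr0.
rewrite rmorphD rmorphM /= evKX derD derM IH hC.
have -> : dX (f * 'X + g%:P) = dX f * 'X + f.
  by rewrite /dX derivD derivM derivX derivC addr0 mulr1.
have -> : dY (f * 'X + g%:P) = dY f * 'X + (g^`())%:P.
  apply/polyP => i; rewrite coef_map /= !coefD !coefMX !coefC derivD coef_map.
  by case: i => [|i] /=; rewrite ?deriv0.
by rewrite !rmorphD !rmorphM /= evKX; ring.
Qed.

End Derivations.

(** The last clause is separate because in characteristic 2 it does not follow from antisymmetry. *)
Definition alternating_der (J : L -> L -> L) := [/\ forall x, is_der (J x),
  forall x y, J x y = - J y x & forall x, J x x = 0].

Definition indep u v := forall f, evK u v f = 0 -> f = 0.

Definition generating u v := forall x, exists f g,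
  evK u v g != 0 /\ x = evK u v f / evK u v g.

Definition next (a : bool * F) (uv : L * L) : L * L :=
  let uv' := if a.1 then (uv.2, uv.1) else uv in
  (uv'.1, uv'.2 / uv'.1 - cst a.2).

(** The appended entry is the last blow up, which creates the divisor; it matches the final [blow]
    in [sigma]. *)
Definition coords (s : seq (bool * F)) (uv : L * L) : L * L :=
  foldl (fun uv a => next a uv) uv (rcons s (false, 0)).

Lemma coords_cons a s uv : coords (a :: s) uv = coords s (next a uv).
Proof. by []. Qed.

Lemma sigma0 f : sigma [::] f = step (false, 0) f.
Proof.
rewrite /= stepE /= -[LHS](transK 0) oppr0; congr (trans _ _).
by apply/polyP => i; rewrite coef_trans addr0 comp_polyXr.
Qed.

Lemma indep_neq0 u v : indep u v -> u != 0 /\ v != 0.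
Proof.
move=> h; split; apply/eqP => E.
  have /h/eqP : evK u v 'X = 0 by rewrite evKX.
  by rewrite polyX_eq0.
have /h/eqP : evK u v 'Y = 0 by rewrite evKY.
by rewrite polyC_eq0 polyX_eq0.
Qed.

Lemma ev_next a u v f : u != 0 -> v != 0 ->
  evK u v f = evK (next a (u, v)).1 (next a (u, v)).2 (step a f).
Proof.
move=> u0 v0; rewrite /step /evK ev2_sub2; case: a => [[] c] /=.
  by rewrite ev2X rmorphM rmorphD /= ev2X ev2Y ev2CC subrK mulrC divfK.
by rewrite ev2X rmorphM rmorphD /= ev2X ev2Y ev2CC subrK mulrC divfK.
Qed.

(** A relation between the new coordinates, multiplied by a high power of x1, is the pull-back of a
    relation between the old ones. *)
Lemma indep_next a u v : indep u v -> indep (next a (u, v)).1 (next a (u, v)).2.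
Proof.
move=> hi h h0; have [u0 v0] := indep_neq0 hi.
pose m := (\max_(i < size h) size (h`_i)%R)%N.
have [|H HE] := @step_push F a m h.
  move=> i; have [hs|hs] := ltnP i (size h); last by rewrite nth_default ?size_poly0.
  rewrite -addSnnS (leq_trans _ (leq_addl _ _)) //.
  exact: (leq_bigmax (Ordinal hs)).
have /hi H0 : evK u v H = 0 by rewrite (ev_next a) // HE rmorphM /= h0 mulr0.
move: HE; rewrite H0 rmorph0 => /esym/eqP; rewrite mulf_eq0 expf_eq0 polyX_eq0 andbF.
by move/eqP.
Qed.

Lemma generating_next a u v : indep u v -> generating u v ->
  generating (next a (u, v)).1 (next a (u, v)).2.
Proof.
move=> /indep_neq0[u0 v0] hg x; have [f [g [g0 ->]]] := hg x.
by exists (step a f), (step a g); rewrite -!ev_next.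
Qed.

Lemma coords_indep s u v : indep u v ->
  indep (coords s (u, v)).1 (coords s (u, v)).2.
Proof.
rewrite /coords; elim: (rcons s _) u v => [|a s' IH] u v //= hi.
have := indep_next (a := a) hi; case: (next a (u, v)) => u' v' /=.
exact: IH.
Qed.

Lemma coords_generating s u v : indep u v -> generating u v ->
  generating (coords s (u, v)).1 (coords s (u, v)).2.
Proof.
rewrite /coords; elim: (rcons s _) u v => [|a s' IH] u v //= hi hg.
have := indep_next (a := a) hi; have := generating_next a hi hg.
by case: (next a (u, v)) => u' v' /= h1 h2; exact: IH.
Qed.

Lemma ev_coords s u v f : indep u v ->
  evK u v f = evK (coords s (u, v)).1 (coords s (u, v)).2 (sigma s f).
Proof.
elim: s u v f => [|a s IH] u v f hi; have [u0 v0] := indep_neq0 hi.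
  by rewrite sigma0 (ev_next (false, 0)).
rewrite (ev_next a) // sigma_cons coords_cons.
have := indep_next (a := a) hi; case: (next a (u, v)) => u' v' hi'.
exact: IH.
Qed.

Section Jacobian.
Variables (J : L -> L -> L) (hJ : alternating_der J).

Lemma jac_next a u v : u != 0 -> v != 0 ->
  J (next a (u, v)).1 (next a (u, v)).2 =
  (if a.1 then -1 else 1) * J u v / (next a (u, v)).1.
Proof.
have [hd hC h0] := hJ.
have aux x y c : x != 0 -> J x (y / x - cst c) = J x y / x.
  by move=> x0; rewrite (derB (hd x)) (der_cst (hd x)) subr0 (der_div (hd x)) // h0 mulr0 subr0.
move=> u0 v0; case: a => [[] c] /=; rewrite aux //.
  by rewrite [J v u]hC mulN1r.
by rewrite mul1r.
Qed.

End Jacobian.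

End Field.

Lemma quotient_derivation (R : comNzRingType) (L : fieldType) (t : {rmorphism R -> L})
    (del : R -> R) (fd : L -> L) :
  (forall f g, del (f + g) = del f + del g) ->
  (forall f g, del (f * g) = del f * g + f * del g) ->
  (forall x, exists f g, t g != 0 /\ x = t f / t g) ->
  (forall f g, t g != 0 -> fd (t f / t g) = t (del f * g - f * del g) / t g ^+ 2) ->
  [/\ forall x y, fd (x + y) = fd x + fd y,
      forall x y, fd (x * y) = fd x * y + x * fd y &
      forall f, fd (t f) = t (del f)].
Proof.
move=> hD hM hx hfd; split=> [x y|x y|f].
- have [f [g [g0 ->]]] := hx x; have [f' [g' [g0' ->]]] := hx y.
  have -> : t f / t g + t f' / t g' = t (f * g' + f' * g) / t (g * g').
    by rewrite addf_div // rmorphD !rmorphM.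
  have gg : t (g * g') != 0 by rewrite rmorphM mulf_neq0.
  rewrite !hfd // hD !hM !(rmorphB, rmorphD, rmorphM) /=.
  by field; rewrite g0 g0'.
- have [f [g [g0 ->]]] := hx x; have [f' [g' [g0' ->]]] := hx y.
  have -> : t f / t g * (t f' / t g') = t (f * f') / t (g * g').
    by rewrite mulf_div !rmorphM.
  have gg : t (g * g') != 0 by rewrite rmorphM mulf_neq0.
  rewrite !hfd // !hM !(rmorphB, rmorphD, rmorphM) /=.
  by field; rewrite g0 g0'.
have t1 : t 1 != 0 by rewrite rmorph1 oner_neq0.
have del1 : del 1 = 0.
  have := hM 1 1; rewrite !mulr1 mul1r => /eqP.
  by rewrite -subr_eq0 opprD addrA subrr sub0r oppr_eq0 => /eqP.
by have := hfd f 1 t1; rewrite rmorph1 divr1 expr1n divr1 del1 mulr1 mulr0 subr0.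
Qed.

(** Needed since [fderiv] applies the quotient rule to a chosen representative of a fraction. *)
Lemma quotient_rule_eq (R : comNzRingType) (L : fieldType) (t : {rmorphism R -> L})
    (del : R -> R) (f g N D : R) : injective t ->
  (forall f g, del (f * g) = del f * g + f * del g) ->
  t g != 0 -> t D != 0 -> t N / t D = t f / t g ->
  t (del N * D - N * del D) / t D ^+ 2 = t (del f * g - f * del g) / t g ^+ 2.
Proof.
move=> inj hM g0 D0 E0.
have E : N * g = f * D.
  apply: inj; rewrite !rmorphM; apply: (mulIf (invr_neq0 D0)).
  by rewrite mulrAC E0 divfK // mulfK.
have E' := congr1 del E; rewrite !hM in E'.
have aux : (del N * D - N * del D) * g ^+ 2 = (del f * g - f * del g) * D ^+ 2.
  apply/eqP; rewrite -subr_eq0; apply/eqP.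
  (* The difference is a combination of N g - f D and its derivative. *)
  transitivity (D * g * ((del N * g + N * del g) - (del f * D + f * del D)) -
    (N * g - f * D) * (del D * g + D * del g)); first by ring.
  by rewrite E E' !subrr mulr0 mul0r subr0.
have := congr1 t aux; rewrite !rmorphM /= => E2.
apply: (mulIf (expf_neq0 2 g0)); apply: (mulIf (expf_neq0 2 D0)).
by rewrite divfK ?expf_neq0 // mulrAC divfK ?expf_neq0 // !expr2 E2.
Qed.

Section FractionRepresentatives.
Variable R : idomainType.
Implicit Types x : {fraction R}.

Definition num x : R := (frac (repr x)).1.
Definition den x : R := (frac (repr x)).2.

Lemma den_neq0 x : den x != 0.
Proof. exact: denom_ratioP. Qed.

Lemma num_den x : x * tofrac (den x) = tofrac (num x).
Proof.
rewrite -{1}[x]reprK /num /den; set r := repr x.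
unlock tofrac; rewrite -[LHS]FracField.pi_mul; apply/eqP.
rewrite FracField.equivf_def /FracField.mulf !numden_Ratio ?oner_neq0 //;
  by rewrite ?mulr1 ?mul1r ?mulf_neq0 ?denom_ratioP ?oner_neq0 // mulrC.
Qed.

Lemma tofrac_den_neq0 x : tofrac (den x) != 0.
Proof. by rewrite tofrac_eq0 den_neq0. Qed.

Lemma fracE x : x = tofrac (num x) / tofrac (den x).
Proof. by rewrite -num_den mulfK // tofrac_den_neq0. Qed.

Lemma tofrac_inj : injective (@tofrac R).
Proof. by move=> f g /eqP; rewrite tofrac_eq => /eqP. Qed.

End FractionRepresentatives.

Section FractionField.
Variable F : fieldType.
Local Notation kx := {mpoly F[2]}.
Local Notation K := {fraction kx}.

Definition cstK : F -> K := @tofrac kx \o @mpolyC 2 F.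
HB.instance Definition _ := GRing.RMorphism.on cstK.

Definition XK : K := tofrac 'X_0.
Definition YK : K := tofrac 'X_1.

Lemma evK_tofrac f : evK cstK XK YK f = tofrac (ofPP f).
Proof.
symmetry; apply: (@ev2_unique F K cstK XK YK (@tofrac kx \o @ofPP F)) => [c||] /=.
- by rewrite /ofPP ev2CC.
- by rewrite /ofPP ev2X.
- by rewrite /ofPP ev2Y.
Qed.

Lemma tofrac_evK (p : kx) : tofrac p = evK cstK XK YK (toPP p).
Proof. by rewrite evK_tofrac toPPK. Qed.

Lemma fderivE i (f g : kx) : tofrac g != 0 -> fderiv i (tofrac f / tofrac g) =
  tofrac (f^`M(i) * g - f * g^`M(i)) / tofrac g ^+ 2.
Proof.
move=> g0; rewrite /fderiv -!/(num _) -!/(den _).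
exact: (quotient_rule_eq (@tofrac_inj _) (@mderivM _ _ i) g0 (tofrac_den_neq0 _) (esym (fracE _))).
Qed.

Lemma fderiv_quotient i :
  [/\ forall x y : K, fderiv i (x + y) = fderiv i x + fderiv i y,
      forall x y : K, fderiv i (x * y) = fderiv i x * y + x * fderiv i y &
      forall f : kx, fderiv i (tofrac f) = tofrac f^`M(i)].
Proof.
apply: (@quotient_derivation kx K (@tofrac kx) (mderiv i)).
- exact: mderivD.
- exact: mderivM.
- by move=> x; exists (num x), (den x); split; [exact: tofrac_den_neq0|exact: fracE].
- exact: fderivE.
Qed.

Lemma fderiv_der i : is_der cstK (fderiv i).
Proof.
have [h1 h2 h3] := fderiv_quotient i; split=> [||c]; [exact: h1|exact: h2|].
by rewrite /cstK /= h3 mderivC rmorph0.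
Qed.

Lemma fderiv_tofrac i (f : kx) : fderiv i (tofrac f) = tofrac f^`M(i).
Proof. by have [_ _ h3] := fderiv_quotient i. Qed.

Lemma alternating_der_of (L : fieldType) (cst : {rmorphism F -> L}) (d e : L -> L) :
  is_der cst d -> is_der cst e ->
  alternating_der cst (fun a b => d a * e b - e a * d b).
Proof.
move=> [h0 m0 c0] [h1 m1 c1]; split=> [x|x y|x]; last 2 first.
- by ring.
- by ring.
split=> [a b|a b|c].
- by rewrite h0 h1; ring.
- by rewrite m0 m1; ring.
- by rewrite c0 c1 !mulr0 subrr.
Qed.

Lemma jacobian_alternating : alternating_der cstK (@jacobian F).
Proof. exact: (alternating_der_of (fderiv_der 0) (fderiv_der 1)). Qed.

Lemma jacobianXY : jacobian XK YK = 1.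
Proof.
rewrite /jacobian !fderiv_tofrac !mderivX !mnmE /= !scale1r !scale0r rmorph0 mul0r subr0.
have e i : (U_(i) - U_(i))%MM = 0%MM :> 'X_{1..2} by apply/mnmP => j; rewrite mnmBE subnn mnmE.
by rewrite !e mpolyX0 rmorph1 mulr1.
Qed.

Lemma indep_XY : indep cstK XK YK.
Proof.
move=> f; rewrite evK_tofrac => /eqP; rewrite tofrac_eq0 => /eqP h.
by rewrite -[f]ofPPK h /toPP mmap0.
Qed.

Lemma generating_XY : generating cstK XK YK.
Proof.
move=> x; exists (toPP (num x)), (toPP (den x)).
by rewrite -!tofrac_evK; split; [exact: tofrac_den_neq0|exact: fracE].
Qed.

End FractionField.

(** * Valuations with transcendental residues *)

Lemma int_pos_mul_eq1 (z : int) (m n : nat) : 0 < z -> z *+ m - z *+ n = 1 -> z = 1.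
Proof.
rewrite -(mulr_natr z m) -(mulr_natr z n) -mulrBr; move: (_ - _) => d z0 zd.
have : (`|z| * `|d|)%N = 1%N by rewrite -abszM zd.
by move/eqP; rewrite muln_eq1 => /andP[/eqP h _]; rewrite -(gtz0_abs z0) h.
Qed.

Lemma ltz_pos_addl (a b : int) (n : nat) : 0 < a -> a + b < n.+1%:Z -> b < n%:Z.
Proof. by move=> a0 h; lia. Qed.

Section Valuations.
Variables (F L : fieldType) (cst : {rmorphism F -> L}) (w : L -> int).
Local Notation PP := {poly {poly F}}.
Local Notation evK := (evK cst).

Definition vge (n : int) (x : L) := x = 0 \/ n <= w x.

Record is_valuation : Prop := IsValuation {
  valuationM : forall x y, x != 0 -> y != 0 -> w (x * y) = w x + w y;
  valuation_geD : forall n x y, vge n x -> vge n y -> vge n (x + y);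
  valuation_cst : forall c, c != 0 -> w (cst c) = 0 }.

Hypothesis hw : is_valuation.

Lemma valM x y : x != 0 -> y != 0 -> w (x * y) = w x + w y.
Proof. exact: valuationM. Qed.

Lemma vgeD n x y : vge n x -> vge n y -> vge n (x + y).
Proof. exact: valuation_geD. Qed.

Lemma val_cst c : c != 0 -> w (cst c) = 0.
Proof. exact: valuation_cst. Qed.

Lemma val1 : w 1 = 0.
Proof. by rewrite -(rmorph1 cst) val_cst // oner_neq0. Qed.

Lemma valV x : x != 0 -> w x^-1 = - w x.
Proof.
move=> x0; apply/eqP; rewrite -addr_eq0 -valM ?invr_eq0 // mulVf //.
by rewrite val1.
Qed.

Lemma val_div x y : x != 0 -> y != 0 -> w (x / y) = w x - w y.
Proof. by move=> x0 y0; rewrite valM ?invr_eq0 // valV. Qed.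

Lemma valX x n : x != 0 -> w (x ^+ n) = w x *+ n.
Proof.
move=> x0; elim: n => [|n IH]; first exact: val1.
by rewrite exprS valM ?expf_neq0 // IH mulrS.
Qed.

Lemma vge_cst c : vge 0 (cst c).
Proof. by have [->|/val_cst h] := eqVneq c 0; [left; exact: rmorph0 | right; rewrite h]. Qed.

Lemma vgeM m n x y : vge m x -> vge n y -> vge (m + n) (x * y).
Proof.
move=> [->|hx]; first by rewrite mul0r; left.
move=> [->|hy]; first by rewrite mulr0; left.
have [->|x0] := eqVneq x 0; first by rewrite mul0r; left.
have [->|y0] := eqVneq y 0; first by rewrite mulr0; left.
by right; rewrite valM // lerD.
Qed.

Lemma vge_le m n x : m <= n -> vge n x -> vge m x.
Proof. by move=> mn [->|h]; [left | right; apply: le_trans h]. Qed.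

Lemma vgeN n x : vge n x -> vge n (- x).
Proof.
by move=> h; rewrite -mulN1r -(add0r n) -(rmorph1 cst) -rmorphN; apply: vgeM (vge_cst _) h.
Qed.

Lemma vgeB n x y : vge n x -> vge n y -> vge n (x - y).
Proof. by move=> h1 h2; apply: vgeD => //; apply: vgeN. Qed.

Lemma vge_val n x : x != 0 -> vge n x <-> n <= w x.
Proof. by move=> x0; split=> [[E|//]|]; [rewrite E eqxx in x0|right]. Qed.

Lemma val_add_unit x y : x != 0 -> w x = 0 -> vge 1 y -> x + y != 0 /\ w (x + y) = 0.
Proof.
move=> x0 wx hy.
have xy : ~ vge 1 (x + y).
  move=> h; have := vgeB h hy; rewrite addrK vge_val // wx.
  by [].
have xy0 : x + y != 0 by apply/eqP => E; apply: xy; left.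
split=> //; apply/eqP; rewrite eq_le; apply/andP; split.
  by rewrite leNgt; apply/negP => h; apply: xy; right.
rewrite -vge_val //; apply: vgeD; first by right; rewrite wx.
exact: vge_le hy.
Qed.

Lemma poly_const_term (R : nzRingType) (f : {poly R}) : exists g, f = (f`_0)%:P + 'X * g.
Proof.
exists (drop_poly 1 f); rewrite -{1}(poly_take_drop 1 f) commr_polyXn expr1.
by congr (_ + _); apply/polyP => i; rewrite coef_take_poly coefC; case: i.
Qed.

Lemma vge_ev0 u v f : vge 0 u -> vge 0 v -> vge 0 (evK u v f).
Proof.
move=> hu hv; have hC (g : {poly F}) : vge 0 (evK u v g%:P).
  elim/poly_ind: g => [|g c IH]; first by rewrite polyC0 rmorph0; left.
  have -> : (g * 'X + c%:P)%:P = g%:P * 'Y + CC c by rewrite polyCD polyCM.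
  rewrite rmorphD rmorphM /= evKY evKCC; apply: vgeD (vge_cst _).
  exact: (vgeM IH hv).
elim/poly_ind: f => [|f g IH]; first by rewrite rmorph0; left.
rewrite rmorphD rmorphM /= evKX; apply: vgeD (hC _).
exact: (vgeM IH hu).
Qed.

Lemma ev_const_term u v f : vge 1 u -> vge 1 v ->
  exists2 r, evK u v f = cst (f`_0`_0) + r & vge 1 r.
Proof.
move=> hu hv; have hu0 := vge_le (ler01 : 0 <= 1 :> int) hu.
have hv0 := vge_le (ler01 : 0 <= 1 :> int) hv.
have [f1 E] := poly_const_term f; have [g E'] := poly_const_term f`_0.
exists (v * evK u v g%:P + u * evK u v f1).
  rewrite {1}E {1}E' polyCD polyCM !(rmorphD, rmorphM) /= evKX evKY.
  by rewrite -/(CC _) evKCC addrA.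
apply: vgeD; first by have := vgeM hv (vge_ev0 g%:P hu0 hv0); rewrite addr0.
by have := vgeM hu (vge_ev0 f1 hu0 hv0); rewrite addr0.
Qed.

Lemma mult1P (f : PP) : mult 1 f <-> f`_0`_0 = 0.
Proof. by split=> [h|h i j]; [exact: h | case: i j => [|i] [|j]]. Qed.

(* As b = f/g has a transcendental residue, f and g both vanish at the center
   (0, 0); dividing their pull-backs by u or v lowers the value of f. *)
Lemma blow_up_terminates b n u v f g :
  (forall c, b - cst c != 0 /\ w (b - cst c) = 0) ->
  indep cst u v -> 0 < w u -> 0 < w v -> evK u v g != 0 ->
  b = evK u v f / evK u v g -> w (evK u v f) < n%:Z ->
  exists s, 0 < w (coords cst s (u, v)).1 /\
    forall c, w ((coords cst s (u, v)).2 - cst c) = 0.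
Proof.
move=> hb; elim: n u v f g => [|n IH] u v f g hi wu wv g0 bE fn.
all: have [u0 v0] := indep_neq0 hi.
all: have hu : vge 1 u by right.
all: have hv : vge 1 v by right.
all: have hf := vge_ev0 f (vge_le ler01 hu) (vge_le ler01 hv).
all: have b0 : b != 0 by have [] := hb 0; rewrite rmorph0 subr0.
all: have f0 : evK u v f != 0 by apply: contraNneq b0 => E; rewrite bE E mul0r.
  by move/(vge_val _ f0): hf => h; lia.
have wb : w b = 0 by have [_] := hb 0; rewrite rmorph0 subr0.
have wfg : w (evK u v f) = w (evK u v g).
  by apply/eqP; rewrite -subr_eq0 -val_div // -bE wb.
have [rf fE hrf] := ev_const_term f hu hv; have [rg gE hrg] := ev_const_term g hu hv.
have unitP h r : evK u v h = cst h`_0`_0 + r -> vge 1 r -> h`_0`_0 != 0 ->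
    w (evK u v h) = 0.
  move=> -> hr c0; have [] // := @val_add_unit (cst h`_0`_0) r.
    by rewrite fmorph_eq0.
  exact: val_cst.
have nunitP h r : evK u v h = cst h`_0`_0 + r -> vge 1 r -> h`_0`_0 = 0 ->
    vge 1 (evK u v h).
  by move=> -> hr ->; rewrite rmorph0 add0r.
have f00 : f`_0`_0 = 0.
  apply/eqP; apply: contraT => c0; exfalso.
  have wf := unitP _ _ fE hrf c0.
  have d0 : g`_0`_0 != 0.
    apply/eqP => /(nunitP _ _ gE hrg)/(vge_val _ g0); rewrite -wfg wf.
    by [].
  (* If f and g were both units, b would differ from the constant f(0, 0) / g(0, 0) by an element of
     positive value. *)
  have [bc0 wbc] := hb (f`_0`_0 / g`_0`_0).
  have E : (b - cst (f`_0`_0 / g`_0`_0)) * (cst g`_0`_0 * evK u v g) =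
      cst g`_0`_0 * rf - cst f`_0`_0 * rg.
    have dd0 : cst g`_0`_0 != 0 by rewrite fmorph_eq0.
    rewrite mulrBl bE fmorph_div mulrCA divfK // mulrA divfK // gE fE.
    by ring.
  have h1 : vge 1 (cst g`_0`_0 * rf - cst f`_0`_0 * rg).
    by apply: vgeB; [have := vgeM (vge_cst g`_0`_0) hrf | have := vgeM (vge_cst f`_0`_0) hrg]; rewrite add0r.
  have g1 : cst g`_0`_0 * evK u v g != 0 by rewrite mulf_neq0 // fmorph_eq0.
  have wg1 : w (cst g`_0`_0 * evK u v g) = 0.
    by rewrite valM ?fmorph_eq0 // val_cst // -wfg wf.
  move: h1; rewrite -E => /(vge_val _ (mulf_neq0 bc0 g1)).
  by rewrite valM // wbc wg1.
have g00 : g`_0`_0 = 0.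
  apply/eqP; apply: contraT => c0; exfalso.
  have := unitP _ _ gE hrg c0; rewrite -wfg.
  by move/(vge_val _ f0): (nunitP _ _ fE hrf f00) => h E; rewrite E in h.
pose sw := w v < w u.
pose u' := if sw then v else u; pose v1 := if sw then u else v.
have nextE c : next cst (sw, c) (u, v) = (u', v1 / u' - cst c).
  by rewrite /u' /v1 /next /=; case: ifP.
have u'0 : u' != 0 by rewrite /u'; case: ifP.
have v10 : v1 != 0 by rewrite /v1; case: ifP.
have wu' : 0 < w u' by rewrite /u'; case: ifP.
have le' : vge 0 (v1 / u').
  right; rewrite val_div // subr_ge0 /u' /v1 /sw.
  by case: ltP => [/ltW|].
(* Either the quotient of the coordinates has a transcendental residue and the last blow up is
   reached, or its residue is a constant c, which gives the next center. *)
have [hc|] := pselect (forall c, w (v1 / u' - cst c) = 0).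
  (* After an exchange the quotient would have positive value, so its residue would be 0. *)
  have swF : sw = false.
    apply/negP => swT; have := hc 0; rewrite rmorph0 subr0 val_div //.
    by rewrite /u' /v1 swT; move: swT; rewrite /sw; lia.
  exists [::]; rewrite /coords /=; split=> // c.
  by have := hc c; rewrite /u' /v1 swF rmorph0 subr0.
move=> /existsNP[c wc]; pose a := (sw, c).
have hi' := indep_next (a := a) hi.
have nn := ev_next cst a _ u0 v0; rewrite nextE /= in hi' nn.
set v' := _ / u' - cst c in wc hi' nn.
have v'0 : v' != 0 by have [] := indep_neq0 hi'.
have wv' : 0 < w v'.
  rewrite lt_neqAle eq_sym; apply/andP; split; first exact/eqP.
  by rewrite -vge_val //; apply: vgeB => //; exact: vge_cst.
have /(mult1P f)/(mult_step a)/dvXP[f1 f1E] := f00.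
have /(mult1P g)/(mult_step a)/dvXP[g1 g1E] := g00.
have fE1 : evK u v f = u' * evK u' v' f1 by rewrite nn f1E expr1 rmorphM /= evKX.
have gE1 : evK u v g = u' * evK u' v' g1 by rewrite nn g1E expr1 rmorphM /= evKX.
have g10 : evK u' v' g1 != 0 by apply: contraNneq g0 => E; rewrite gE1 E mulr0.
have f10 : evK u' v' f1 != 0 by apply: contraNneq f0 => E; rewrite fE1 E mulr0.
have [|| s [s1 s2]] := IH u' v' f1 g1 hi' wu' wv' g10.
- by rewrite bE fE1 gE1 -mulf_div divff // mul1r.
- by move: fn; rewrite fE1 valM //; apply: ltz_pos_addl.
by exists (a :: s); rewrite coords_cons nextE.
Qed.

End Valuations.

Section ClosedField.
Variables (F : closedFieldType) (L : fieldType) (cst : {rmorphism F -> L}) (w : L -> int).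
Hypothesis hw : is_valuation cst w.
Local Notation PP := {poly {poly F}}.
Local Notation evK := (evK cst).

(** Over an algebraically closed field a polynomial in W splits into factors W - z, all of value 0;
    hence only the power of U counts. *)
Lemma val_final U W g : 0 < w U -> U != 0 ->
  (forall c, W - cst c != 0 /\ w (W - cst c) = 0) -> g != 0 ->
  w (evK U W g) = w U *+ ordX g.
Proof.
move=> wU U0 hW /ordX_fact[h {1}-> h0].
have hU : vge w 1 U by right.
have [h1 hE] := poly_const_term h.
have [rs rsE] := closed_field_poly_normal h`_0.
have [c0 wc] : evK U W (h`_0)%:P != 0 /\ w (evK U W (h`_0)%:P) = 0.
  rewrite /evK ev2C rsE map_polyZ hornerZ rmorph_prod horner_prod.
  have lc0 : cst (lead_coef h`_0) != 0 by rewrite fmorph_eq0 lead_coef_eq0.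
  have [p0 wp] : \prod_(z <- rs) (map_poly cst ('X - z%:P)).[W] != 0 /\
      w (\prod_(z <- rs) (map_poly cst ('X - z%:P)).[W]) = 0.
    elim: rs {rsE} => [|z rs [IH1 IH2]]; first by rewrite big_nil oner_neq0 (val1 hw).
    have [z0 wz] := hW z.
    rewrite big_cons rmorphB /= map_polyX map_polyC hornerD hornerN hornerX hornerC.
    by rewrite mulf_neq0 // (valM hw) // wz IH2.
  by rewrite mulf_neq0 // (valM hw) // wp (val_cst hw) // lead_coef_eq0.
have hW0 : vge w 0 W.
  by right; have [_] := hW 0; rewrite rmorph0 subr0 => ->.
have [e0 we] : evK U W h != 0 /\ w (evK U W h) = 0.
  rewrite hE rmorphD rmorphM /= evKX; apply: (val_add_unit hw) => //.
  have := vgeM hw hU (vge_ev0 hw h1 (vge_le ler01 hU) hW0).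
  by rewrite addr0.
by rewrite rmorphM rmorphXn /= evKX (valM hw) ?expf_neq0 // we addr0 (valX hw).
Qed.

Lemma val_is_ordX b u v : (exists2 t, t != 0 & w t = 1) ->
  (forall c, b - cst c != 0 /\ w (b - cst c) = 0) ->
  indep cst u v -> generating cst u v -> 0 < w u -> 0 < w v ->
  exists s, forall f, f != 0 -> w (evK u v f) = (ordX (sigma s f))%:Z.
Proof.
move=> [t t0 wt] hb hi hg wu wv; have [f [g [g0 bE]]] := hg b.
have [] := @blow_up_terminates _ _ cst w hw b (absz (w (evK u v f))).+1 u v f g => //.
  by lia.
move=> s [wU wW]; exists s.
have hi' := coords_indep (s := s) hi.
have E h : h != 0 -> w (evK u v h) = w (coords cst s (u, v)).1 *+ ordX (sigma s h).
  move=> h0; rewrite (ev_coords s) // val_final ?sigma_eq0 //.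
    by have [] := indep_neq0 hi'.
  move=> c; split=> //; apply/eqP => Ec.
  have /hi'/eqP : evK (coords cst s (u, v)).1 (coords cst s (u, v)).2 ('Y - CC c) = 0.
    by rewrite -CCN rmorphD /= evKY evKCC rmorphN.
  by rewrite /CC -polyCB polyC_eq0 polyXsubC_eq0.
(* Every value is a multiple of the value of the last first coordinate, and t has value 1. *)
suff U1 : w (coords cst s (u, v)).1 = 1 by move=> h h0; rewrite E // U1 -mulr_natr mul1r natz.
have [f1 [g1 [g10 tE]]] := hg t.
have f10 : evK u v f1 != 0 by apply: contraNneq t0 => E0; rewrite tE E0 mul0r.
have nz h : evK u v h != 0 -> h != 0 by apply: contraNneq => ->; rewrite rmorph0.
move: wt; rewrite tE (val_div hw) // !E ?nz //.
exact: int_pos_mul_eq1.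
Qed.

End ClosedField.

(** * Prime divisors are obtained by blowing up points *)

Lemma prime_idealM (T : comNzRingType) (B P : set T) a x :
  is_prime B P -> B a -> P x -> P (a * x).
Proof. by move=> [[_ P0 h] _ _] Ba Px; rewrite -[_ * _]addr0; apply: h. Qed.

Section LocalRing.
Variables (F L : fieldType) (cst : {rmorphism F -> L}) (B P : set L) (v : L -> int).
Hypotheses (hB : is_subring B) (hP : is_prime B P).
Hypothesis hcst : forall c, B (cst c).
Local Notation O := (localization B P).

Lemma prime0 : P 0. Proof. by have [[]] := hP. Qed.

Lemma notP_neq0 b : ~ P b -> b != 0.
Proof. by move=> Pb; apply/eqP => E; apply: Pb; rewrite E; exact: prime0. Qed.

Lemma notPM a b : B a -> B b -> ~ P a -> ~ P b -> ~ P (a * b).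
Proof. by have [_ _ h] := hP; move=> Ba Bb Pa Pb /(h _ _ Ba Bb)[]. Qed.

Lemma sub_localization : B `<=` O.
Proof.
move=> x Bx; exists x, 1; rewrite divr1; split=> //; first exact: subring1 hB.
by have [_ h _] := hP.
Qed.

Lemma localization_subring : is_subring O.
Proof.
split; first exact/sub_localization/(subring1 hB).
  move=> x y [a [b [Ba Bb Pb ->]]] [a' [b' [Ba' Bb' Pb' ->]]].
  exists (a * b' - a' * b), (b * b'); split.
  - by have [_ h _] := hB; apply: h; apply: subringM.
  - exact: subringM.
  - exact: notPM.
  - by rewrite -mulNr addf_div ?notP_neq0 // mulNr.
move=> x y [a [b [Ba Bb Pb ->]]] [a' [b' [Ba' Bb' Pb' ->]]].
exists (a * a'), (b * b'); split; [exact: subringM|exact: subringM|exact: notPM|].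
by rewrite mulf_div.
Qed.

Hypothesis hv : normalized_valuation_of O v.

Lemma normalized_is_valuation : is_valuation cst v.
Proof.
have [hM _ hO] := hv; have hS := localization_subring.
have v1 : v 1 = 0.
  have := hM 1 1 (oner_neq0 _) (oner_neq0 _); rewrite mulr1 => /eqP.
  by rewrite -subr_eq subrr eq_sym => /eqP.
have vV x : x != 0 -> v x^-1 = - v x.
  by move=> x0; apply/eqP; rewrite -addr_eq0 -hM ?invr_eq0 // mulVf // v1.
split=> //.
  have wlogD n x y : x != 0 -> y != 0 -> v x <= v y -> n <= v x -> vge v n (x + y).
    move=> x0 y0 xy nx; have [->|s0] := eqVneq (x + y) 0; first by left.
    right; have E : x + y = x * (1 + y / x) by rewrite mulrDr mulr1 mulrC divfK.
    have e0 : 1 + y / x != 0 by apply: contraNneq s0 => e; rewrite E e mulr0.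
    rewrite E hM // -[n]addr0 lerD // -hO //; apply: (subringD hS).
      exact: (subring1 hS).
    by apply/hO; rewrite ?mulf_neq0 ?invr_eq0 // hM ?invr_eq0 // vV // subr_ge0.
  move=> n x y [->|nx]; first by rewrite add0r.
  move=> [->|ny]; first by rewrite addr0; right.
  have [->|x0] := eqVneq x 0; first by rewrite add0r; right.
  have [->|y0] := eqVneq y 0; first by rewrite addr0; right.
  have [xy|yx] := leP (v x) (v y); first exact: wlogD.
  by rewrite addrC; apply: wlogD => //; exact: ltW.
move=> c c0; have cc : cst c != 0 by rewrite fmorph_eq0.
apply/eqP; rewrite eq_le; apply/andP; split.
  rewrite -oppr_ge0 -vV // -fmorphV -hO ?fmorph_eq0 ?invr_eq0 //.
  exact/sub_localization/hcst.
by rewrite -hO //; exact/sub_localization/hcst.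
Qed.

Let hw := normalized_is_valuation.

Lemma val_localization x : O x -> vge v 0 x.
Proof.
have [_ _ hO] := hv; have [->|x0] := eqVneq x 0; first by left.
by move/hO => h; right; apply: h.
Qed.

Lemma val_unit b : B b -> ~ P b -> v b = 0.
Proof.
move=> Bb Pb; have b0 := notP_neq0 Pb; have [hM _ hO] := hv.
apply/eqP; rewrite eq_le; apply/andP; split; last first.
  by rewrite -hO //; exact: sub_localization.
rewrite -oppr_ge0 -(valV hw) // -hO ?invr_eq0 //.
by exists 1, b; split=> //; [exact: subring1 hB | rewrite mul1r].
Qed.

Lemma val_prime b : P b -> vge v 1 b.
Proof.
move=> Pb; have [->|b0] := eqVneq b 0; first by left.
right; have [hM _ hO] := hv; have [[PB _ _] _ _] := hP.
have : 0 <= v b by rewrite -hO //; exact/sub_localization/PB.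
rewrite le_eqVlt => /predU1P[vb|//]; exfalso.
have : O b^-1 by apply/hO; rewrite ?invr_eq0 // (valV hw) // -vb oppr0.
move=> [a [d [Ba Bd Pd E]]]; apply: Pd.
have d0 : d != 0.
  by apply: contraNneq b0 => d0; rewrite -invr_eq0 E d0 invr0 mulr0.
suff -> : d = a * b by exact: prime_idealM hP Ba Pb.
by rewrite -[a](divfK d0) -E mulrAC mulVf // mul1r.
Qed.

(* Otherwise every element of B is a constant modulo P. For a uniformizer t, the
   derivation J t then increases the valuation of all the generators of B, hence
   vanishes, whereas t is not a p-th power. *)
Lemma transcendental_residue (J : L -> L -> L) (x y : L) (s : seq L) :
  alternating_der cst J ->
  B = ring_generated (range (evK cst x y) `|` [set` s]) ->
  (forall t, t != 0 -> J t x = 0 -> J t y = 0 -> v t <> 1) ->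
  exists b, forall c, b - cst c != 0 /\ v (b - cst c) = 0.
Proof.
move=> [hJ _ J0] BE hp; apply: contrapT => hn.
have hres b : B b -> exists c, P (b - cst c).
  move=> Bb; apply: contrapT => /forallNP hb; apply: hn; exists b => c.
  have Bc : B (b - cst c) by have [_ h _] := hB; apply: h.
  by split; [exact: notP_neq0 | apply: val_unit].
have [hM [t t0 vt] hO] := hv.
pose gens := [:: x, y & s].
have gensB g : g \in gens -> B g.
  have rg : [set` s] `<=` B.
    by move=> z zs; rewrite BE; apply: sub_ring_generated; right.
  have re : range (evK cst x y) `<=` B.
    by move=> z zs; rewrite BE; apply: sub_ring_generated; left.
  rewrite !inE => /or3P[/eqP ->|/eqP ->|/rg//]; apply: re.
    by exists 'X; rewrite ?evKX.
  by exists 'Y; rewrite ?evKY.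
have D0 : forall g, g \in gens -> J t g = 0.
  apply: contrapT => /existsNP[g0 /not_implyP[g0s /eqP Dg0]].
  have [g [gs Dg gmin]] : exists g, [/\ g \in gens, J t g != 0 &
      forall h, h \in gens -> vge v (v (J t g)) (J t h)].
    have : exists2 g, g \in gens & J t g != 0 by exists g0.
    clear g0 g0s Dg0; elim: (gens) => [[]//|a l IH] [g gl Dg].
    have [[h hl Dh]|hno] := pselect (exists2 h, h \in l & J t h != 0); last first.
      move: gl; rewrite inE => /predU1P[ga|gl]; last by case: hno; exists g.
      exists a; rewrite mem_head -ga; split=> // h; rewrite inE => /predU1P[->|hl].
        by right.
      by have [->|Dh] := eqVneq (J t h) 0; [left | case: hno; exists h].
    have [g' [g'l Dg' g'min]] := IH (ex_intro2 _ _ h hl Dh).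
    have [a0|a0] := eqVneq (J t a) 0.
      exists g'; rewrite inE g'l orbT; split=> // z; rewrite inE => /predU1P[->|/g'min//].
      by left.
    have [le|lt] := leP (v (J t a)) (v (J t g')).
      exists a; rewrite mem_head; split=> // z; rewrite inE => /predU1P[->|/g'min hz].
        by right.
      exact: vge_le hz.
    exists g'; rewrite inE g'l orbT; split=> // z; rewrite inE => /predU1P[->|/g'min//].
    by right; exact: ltW.
  (* The elements with derivative of value at least mu form a ring containing all generators by
     minimality, hence B; the quotient rule extends the bound to the localization. *)
  pose mu := v (J t g); pose G h := O h /\ vge v mu (J t h).
  have GS : is_subring G.
    split.
    - by split; [exact: (subring1 localization_subring) | rewrite -(rmorph1 cst) (der_cst (hJ t)); left].
    - move=> a b [Oa Da] [Ob Db]; split.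
        by have [_ h _] := localization_subring; apply: h.
      by rewrite (derB (hJ t)); apply: (vgeB hw).
    - move=> a b [Oa Da] [Ob Db]; split; first exact: (subringM localization_subring).
      rewrite (derM (hJ t)); apply: (vgeD hw).
        by have := vgeM hw Da (val_localization Ob); rewrite addr0.
      by have := vgeM hw (val_localization Oa) Db; rewrite add0r.
  have Ggens h : h \in gens -> G h.
    by move=> hg; split; [exact/sub_localization/gensB | exact: gmin].
  have Gev f : G (evK cst x y f).
    have Gx : G x by apply: Ggens; rewrite mem_head.
    have Gy : G y by apply: Ggens; rewrite !inE eqxx orbT.
    have Gc c : G (cst c).
      by split; [exact/sub_localization/hcst | rewrite (der_cst (hJ t)); left].
    have hC (q : {poly F}) : G (evK cst x y q%:P).
      elim/poly_ind: q => [|q c IH]; first by rewrite polyC0 rmorph0; exact: (subring0 GS).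
      have -> : (q * 'X + c%:P)%:P = q%:P * 'Y + CC c by rewrite polyCD polyCM.
      rewrite rmorphD rmorphM /= evKY evKCC; apply: (subringD GS) (Gc _).
      exact: (subringM GS).
    elim/poly_ind: f => [|q r IH]; first by rewrite rmorph0; exact: (subring0 GS).
    rewrite rmorphD rmorphM /= evKX; apply: (subringD GS) (hC _).
    exact: (subringM GS).
  have BG : B `<=` G.
    rewrite BE; apply: (ring_generated_sub GS) => h [[f _ <-]|hs]; first exact: Gev.
    by apply: Ggens; rewrite !inE [h \in s]hs !orbT.
  have OG h : O h -> vge v mu (J t h).
    move=> [a [b [Ba Bb Pb ->]]]; have b0 := notP_neq0 Pb.
    have vb := val_unit Bb Pb.
    have vbV : vge v 0 b^-1 by right; rewrite (valV hw) // vb.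
    rewrite (der_div (hJ t)) //.
    rewrite -[mu]addr0; apply: (vgeM hw) => //; apply: (vgeB hw); first exact: (BG _ Ba).2.
    have va := val_localization (sub_localization Ba).
    have := vgeM hw (vgeM hw va vbV) (BG _ Bb).2.
    by rewrite !add0r.
  have [c Pc] := hres _ (gensB _ gs).
  (* Writing g - c = t q with q in the local ring, J t g = t (J t q) has value at least mu + 1, a
     contradiction. *)
  have hgc : O ((g - cst c) / t).
    have [->|q0] := eqVneq ((g - cst c) / t) 0; first exact: (subring0 localization_subring).
    have gc0 : g - cst c != 0 by apply: contraNneq q0 => ->; rewrite mul0r.
    apply/hO => //; rewrite (val_div hw) // vt subr_ge0.
    exact/(vge_val _ _ gc0)/val_prime.
  have : vge v (1 + mu) (J t g).
    have -> : J t g = t * J t ((g - cst c) / t).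
      have -> : J t g = J t (g - cst c) by rewrite (derB (hJ t)) (der_cst (hJ t)) subr0.
      have := derM (hJ t) ((g - cst c) / t) t.
      by rewrite divfK // J0 mulr0 addr0 mulrC.
    by apply: (vgeM hw); [right; rewrite vt | exact: OG].
  by move/(vge_val _ _ Dg); rewrite -/mu lez1D ltxx.
by apply: (hp t t0) => //; apply: D0; rewrite !inE eqxx ?orbT.
Qed.

End LocalRing.

Lemma eq_exp_div (L : fieldType) (h t d : L) n :
  d != 0 -> h ^+ n = t * d ^+ n -> t = (h / d) ^+ n.
Proof. by move=> d0 E; rewrite expr_div_n E mulfK // expf_neq0. Qed.

(** * Vanishing derivatives and p-th powers *)

Section PthRoots.
Variables (k : closedFieldType) (p : nat).
Hypothesis hp : p \in [pchar k].
Local Notation kx := {mpoly k[2]}.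
Local Notation K := {fraction kx}.

Lemma pth_root (a : k) : exists b, b ^+ p = a.
Proof.
have p0 : (0 < p)%N by exact/prime_gt0/(pcharf_prime hp).
have [b bE] := solve_monicpoly (fun i => if i == 0%N then a else 0) p0.
exists b; rewrite bE -(prednK p0) big_ord_recl /= expr0 mulr1 big1 ?addr0 // => i _.
by rewrite mul0r.
Qed.

(** All exponents of G are divisible by p, its coefficients have p-th roots, and raising to the
    power p is additive. *)
Lemma mpoly_pth_root (G : kx) : (forall i, G^`M(i) = 0) -> exists H, H ^+ p = G.
Proof.
move=> dG; have hpm : p \in [pchar kx].
  by rewrite inE (pcharf_prime hp) -mpolyC_nat (pcharf0 hp) mpolyC0 eqxx.
have pdiv m i : m \in msupp G -> (p %| m i)%N.
  rewrite mcoeff_msupp => Gm; have [->|mi] := eqVneq (m i) 0%N; first exact: dvdn0.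
  have le : (U_(i) <= m)%MM by rewrite lep1mP.
  have := congr1 (mcoeff (m - U_(i))%MM) (dG i).
  rewrite mcoeff_deriv submK // mcoeff0 mnmBE mnm1E eqxx -mulr_natl => /eqP.
  rewrite mulf_eq0 (negPf Gm) orbF (dvdn_pcharf hp) subn1 prednK ?lt0n //.
have [c cE] : {c : 'X_{1..2} -> k & forall m, c m ^+ p = G@_m}.
  by apply: (@choice _ _ (fun m b => b ^+ p = G@_m)) => m; exact: pth_root.
pose h (m : 'X_{1..2}) : 'X_{1..2} := [multinom (m i %/ p)%N | i < 2].
exists (\sum_(m <- msupp G) c m *: 'X_[h m]).
rewrite -[_ ^+ p]/(pFrobenius_aut hpm _) rmorph_sum /= [RHS]mpolyE.
rewrite big_seq [RHS]big_seq; apply: eq_bigr => m mG.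
rewrite /= pFrobenius_autE exprZn cE mpolyXn; congr (_ *: 'X_[_]).
by apply/mnmP => i; rewrite mulmnE mnmE divnK // pdiv.
Qed.

Lemma uniformizer_not_pth_power (v : K -> int) t : is_valuation (@cstK k) v ->
  t != 0 -> jacobian t (XK k) = 0 -> jacobian t (YK k) = 0 -> v t <> 1.
Proof.
move=> hv t0 h1 h2 vt.
have hXY i : fderiv i (XK k) = (i == 0)%:R /\ fderiv i (YK k) = (i == 1)%:R.
  have e j : fderiv i (tofrac ('X_j : kx)) = (i == j)%:R.
    rewrite fderiv_tofrac mderivX mnm1E eq_sym; case: eqP => [->|_].
      have -> : (U_(j) - U_(j))%MM = 0%MM :> 'X_{1..2} by apply/mnmP => l; rewrite mnmBE subnn mnmE.
      by rewrite scale1r mpolyX0 rmorph1.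
    by rewrite scale0r rmorph0.
  by rewrite /XK /YK !e.
have d1 : fderiv 1 t = 0.
  by move/eqP: h1; rewrite /jacobian !(hXY _).1 /= mulr0 mulr1 sub0r oppr_eq0 => /eqP.
have d0 : fderiv 0 t = 0.
  by move/eqP: h2; rewrite /jacobian !(hXY _).2 /= mulr0 mulr1 subr0 => /eqP.
have dt i : fderiv i t = 0.
  by case: i => [[|[|//]] hi]; [rewrite -d0 | rewrite -d1]; congr (fderiv _ t); exact: val_inj.
have p0 : (0 < p)%N by exact/prime_gt0/(pcharf_prime hp).
pose D := tofrac (den t); have D0 : D != 0 := tofrac_den_neq0 t.
have pK : p%:R = 0 :> K by rewrite -(rmorph_nat (@cstK k)) (pcharf0 hp) rmorph0.
(* Multiplying t by the p-th power of its denominator gives a polynomial, still with zero partial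
   derivatives. It is thus a p-th power, and p divides the value of t. *)
have GE : tofrac (num t * den t ^+ p.-1) = t * D ^+ p.
  by rewrite rmorphM rmorphXn /= -num_den -/D -mulrA -exprS prednK.
have dp i : fderiv i (D ^+ p) = 0.
  have hd := fderiv_der k i.
  have dX n : fderiv i (D ^+ n) = n%:R * (D ^+ n.-1 * fderiv i D).
    elim: n => [|n IH]; first by rewrite -(rmorph1 (@cstK k)) (der_cst hd) mul0r.
    rewrite exprS (derM hd) IH /=; case: n {IH} => [|n] /=.
      by rewrite mul0r mulr0 addr0 expr0 mulr1 !mul1r.
    by rewrite exprS -[n.+2]addn1 natrD; ring.
  by rewrite dX pK mul0r.
have [|H HE] := @mpoly_pth_root (num t * den t ^+ p.-1).
  move=> i; apply: tofrac_inj; rewrite -fderiv_tofrac GE (derM (fderiv_der k i)).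
  by rewrite dt dp mul0r mulr0 addr0 rmorph0.
have HK : tofrac H ^+ p = t * D ^+ p by rewrite -GE -HE rmorphXn.
have tE : t = (tofrac H / D) ^+ p.
  exact: eq_exp_div D0 HK.
have q0 : tofrac H / D != 0.
  by apply: contraNneq t0 => q0; rewrite tE q0 expr0n (negPf (lt0n_neq0 p0)).
have := congr1 absz (valX hv p q0); rewrite -tE vt -mulr_natr abszM natz absz_nat.
move/esym/eqP; rewrite muln_eq1 => /andP[_ /eqP p1].
by have := prime_gt1 (pcharf_prime hp); rewrite p1.
Qed.

End PthRoots.

Section PrimeDivisors.
Variable F : fieldType.
Local Notation kx := {mpoly F[2]}.
Local Notation K := {fraction kx}.

Lemma coord_ringE : @coord_ring F = range (evK (@cstK F) (XK F) (YK F)).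
Proof.
apply/seteqP; split=> [_ [f _ <-]|_ [f _ <-]].
  by exists (toPP f) => //; rewrite -tofrac_evK.
by exists (ofPP f) => //; rewrite evK_tofrac.
Qed.

Lemma chart_subring (B : set K) : affine_chart B -> is_subring B.
Proof. by move=> [[s ->] _]; exact: ring_generated_subring. Qed.

Lemma chart_coord (B : set K) : affine_chart B -> @coord_ring F `<=` B.
Proof. by move=> [[s ->] _] x xc; apply: sub_ring_generated; left. Qed.

Lemma chart_cst (B : set K) c : affine_chart B -> B (cstK c).
Proof. by move=> hB; apply: (chart_coord hB); exists c%:MP. Qed.

Lemma pd_is_valuation (E : prime_divisor F) : is_valuation (@cstK F) (pd_val E).
Proof.
have hB := chartP (pd_chart E); have [hP _ _] := pd_height_one E.
exact: (normalized_is_valuation (chart_subring hB) hP (fun c => chart_cst c hB) (pd_valP E)).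
Qed.

End PrimeDivisors.

Theorem divisor_blow_ups (k : closedFieldType) (p : nat) (hp : p \in [pchar k])
    (E : prime_divisor k) : centered_at_origin E ->
  exists s, forall f, f != 0 ->
    pd_val E (evK (@cstK k) (XK k) (YK k) f) = (ordX (sigma s f))%:Z.
Proof.
move=> hE; have hw := pd_is_valuation E.
have hB := chartP (pd_chart E); have [hP _ _] := pd_height_one E.
have hS := chart_subring hB; have hc c := chart_cst c hB.
have [[s sE] _] := hB.
have [b hb] := transcendental_residue hS hP hc (pd_valP E)
  (jacobian_alternating k) (etrans sE (congr1 (fun X => ring_generated (X `|` _)) (@coord_ringE k)))
  (fun t t0 => uniformizer_not_pth_power hp hw t0).
have pos (i : 'I_2) : 0 < pd_val E (tofrac 'X_i).
  have /(val_prime hS hP hc (pd_valP E)) : pd_prime E (tofrac 'X_i).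
    by apply/hE; rewrite mevalXU.
  rewrite vge_val; first by rewrite -gtz0_ge1.
  rewrite tofrac_eq0; apply/eqP => X0; have := mcoeffXU k i i.
  by rewrite X0 mcoeff0 eqxx => /eqP; rewrite eq_sym oner_eq0.
have [_ ht _] := pd_valP E.
exact: (val_is_ordX hw ht hb (@indep_XY k) (@generating_XY k) (pos 0) (pos 1)).
Qed.

(** * Normality of the charts *)

Section Normality.
Variable F : fieldType.
Local Notation PP := {poly {poly F}}.

(** After removing the common factor, every power of what remains of g divides d, so what remains is
    constant. *)
Lemma dvdp_of_powers (Q : fieldType) (f g d : {poly Q}) : g != 0 -> d != 0 ->
  (forall m, g ^+ m %| d * f ^+ m) -> g %| f.
Proof.
move=> g0 d0 h; pose D := gcdp f g.
have D0 : D != 0 by rewrite gcdp_eq0 negb_and g0 orbT.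
have gE : g = g %/ D * D by rewrite divpK // dvdp_gcdr.
have fE : f = f %/ D * D by rewrite divpK // dvdp_gcdl.
have cop : coprimep (f %/ D) (g %/ D) by rewrite coprimep_div_gcd // g0 orbT.
move: (f %/ D) (g %/ D) gE fE cop => f1 g1 gE fE cop.
have g10 : g1 != 0 by apply: contraNneq g0 => E; rewrite gE E mul0r.
have g1d m : g1 ^+ m %| d.
  have := h m; rewrite gE fE !exprMn mulrA dvdp_mul2r ?expf_neq0 //.
  by rewrite Gauss_dvdpl // coprimep_expl // coprimep_expr // coprimep_sym.
have := dvdp_leq d0 (g1d (size d)); have := size_exp g1 (size d).
rewrite -size_poly_gt0 in g10; move: g10; case: (eqVneq (size g1) 1%N) => [g1s _ _ _|].
  by rewrite gE fE dvdp_mul // (dvdp_trans _ (dvd1p _)) // dvdp1 g1s.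
move: d0; rewrite -size_poly_gt0; move: (size (g1 ^+ size d)) => b.
move: (size g1) (size d) => a c c0 a1 a0 bE bc; exfalso.
have : (c <= a.-1 * c)%N by rewrite leq_pmull //; lia.
by lia.
Qed.

Lemma clear_denominators (Q : fieldType) (t : {rmorphism {poly F} -> Q}) (q : {poly Q}) :
  (forall x, exists n d, t d != 0 /\ x = t n / t d) ->
  exists e (q' : PP), t e != 0 /\ t e *: q = map_poly t q'.
Proof.
move=> ht; elim/poly_ind: q => [|q c [e [q' [e0 E]]]].
  by exists 1, 0; rewrite rmorph1 oner_neq0 scaler0 rmorph0.
have [n [d [d0 ->]]] := ht c.
exists (e * d), (d *: q' * 'X + (e * n)%:P); rewrite rmorphM mulf_neq0 //; split=> //.
apply/polyP => i; rewrite coefZ coefD coefMX coefC coef_map coefD coefMX coefC coefZ.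
case: i => [|i] /=.
  by rewrite !add0r [t e * _]mulrC -mulrA mulrC mulrA divfK // rmorphM mulrC.
rewrite !addr0 rmorphM; have := congr1 (fun r : {poly Q} => r`_i) E.
by rewrite /= coefZ coef_map /= => <-; rewrite mulrA [t d * _]mulrC.
Qed.

Lemma dvd_over_fractions (f g d : PP) : g != 0 -> d != 0 ->
  (forall m, exists h, d * f ^+ m = g ^+ m * h) ->
  exists e h, e != 0 /\ e%:P * f = g * h.
Proof.
move=> g0 d0 hm.
pose Q : fieldType := {fraction {poly F}}.
pose t : {rmorphism {poly F} -> Q} := @tofrac {poly F}.
have tinj : injective t by exact: tofrac_inj.
have tP x : exists n d, t d != 0 /\ x = t n / t d.
  by exists (num x), (den x); split; [exact: tofrac_den_neq0 | exact: fracE].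
move: Q t tinj tP => Q t tinj tP.
have minj : injective (map_poly t : PP -> {poly Q}).
  move=> a b /polyP E; apply/polyP => i; have := E i; rewrite !coef_map; exact: tinj.
have mn0 (p : PP) : p != 0 -> map_poly t p != 0.
  by apply: contraNneq => E; apply/eqP/(minj p 0); rewrite E rmorph0.
have /dvdpP[q qE] : map_poly t g %| map_poly t f.
  apply: (dvdp_of_powers (mn0 _ g0) (mn0 _ d0)) => m.
  have [h hE] := hm m; rewrite -!rmorphXn -rmorphM hE rmorphM.
  exact: dvdp_mulIl.
have [e [h [e0 eE]]] := clear_denominators q tP.
exists e, h; split; first by apply: contraNneq e0 => ->; rewrite rmorph0.
apply: minj; rewrite !rmorphM /= map_polyC /= qE -eE mul_polyC.
by rewrite scalerAl mulrC.
Qed.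

(** In place of unique factorization in two variables, divisibility is obtained over F(x2)[x1] and,
    exchanging the variables, over F(x1)[x2]. The two denominators e(x2) and e'(x1) share no factor,
    and division by the monic multiple of e' removes them. *)
Lemma dvd_of_powers (f g d : PP) : g != 0 -> d != 0 ->
  (forall m, exists h, d * f ^+ m = g ^+ m * h) -> exists h, f = g * h.
Proof.
move=> g0 d0 hm.
have [e [h [e0 eE]]] := dvd_over_fractions g0 d0 hm.
have sg0 : swapXY g != 0 by rewrite swapXY_eq0.
have sd0 : swapXY d != 0 by rewrite swapXY_eq0.
have [|e' [h' [e'0 eE']]] := @dvd_over_fractions (swapXY f) _ _ sg0 sd0.
  move=> m; have [h1 h1E] := hm m; exists (swapXY h1).
  by rewrite -!rmorphXn -!rmorphM h1E.
pose e1 := (lead_coef e')^-1 *: e'.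
have e1m : e1^:P \is monic.
  by rewrite map_monic // monicE lead_coefZ mulVf // lead_coef_eq0.
have [h1 E1] : exists h1, e1^:P * f = g * h1.
  exists (((lead_coef e')^-1)%:P%:P * swapXY h').
  have := congr1 swapXY eE'; rewrite !rmorphM /= swapXY_polyC !swapXYK => E2.
  rewrite mulrCA -E2 mulrA; congr (_ * _).
  by rewrite /e1 -mul_polyC rmorphM /= map_polyC.
have E2 : e1^:P * h = e%:P * h1.
  apply: (mulfI g0); rewrite mulrCA -eE mulrCA E1.
  by rewrite mulrCA.
have [q [r [hE rs]]] : exists q r, h1 = q * e1^:P + r /\ (size r < size e1^:P)%N.
  exists (Pdiv.Ring.rdivp h1 e1^:P), (Pdiv.Ring.rmodp h1 e1^:P).
  split; first exact: Pdiv.RingMonic.rdivp_eq.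
  by rewrite Pdiv.Ring.ltn_rmodp monic_neq0.
have E3 : e1^:P * (h - e%:P * q) = e%:P * r.
  have aux (R : comNzRingType) (a b c x y z : R) : a * b = c * x -> x = y * a + z ->
      a * (b - c * y) = c * z by move=> e2 e3; rewrite mulrBr e2 e3; ring.
  exact: (aux (pp F)) E2 hE.
exists q; suff : h - e%:P * q = 0.
  move/eqP; rewrite subr_eq0 => /eqP hq; apply: (mulfI (_ : e%:P != 0)).
    by rewrite polyC_eq0.
  by rewrite eE hq mulrCA.
(* Degrees in x1: e is constant in x1, while r is shorter than the monic [e1^:P]. *)
apply/eqP; apply: contraT => n0.
have := congr1 (fun p : PP => size p) E3; rewrite /= size_monicM // size_Cmul //.
move: rs n0; rewrite -size_poly_gt0.
by move: (size e1^:P) (size r) (size (h - _)) => a b c; lia.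
Qed.

End Normality.

Section ChartRings.
Variables (F L : fieldType) (cst : {rmorphism F -> L}).
Local Notation PP := {poly {poly F}}.
Local Notation evK := (evK cst).

Definition chart_ring (u v : L) : set L := range (evK u v).

Lemma chart_ring_subring u v : is_subring (chart_ring u v).
Proof.
split=> [|_ _ [f _ <-] [g _ <-]|_ _ [f _ <-] [g _ <-]].
- by exists 1; [by [] | exact: rmorph1].
- exists (f + CC (-1) * g); first by [].
  rewrite rmorphD rmorphM /= evKCC.
  have -> : cst (-1) = -1 by rewrite rmorphN rmorph1.
  by rewrite mulN1r.
- by exists (f * g); [by [] | exact: rmorphM].
Qed.

Lemma chart_ring_cst u v c : chart_ring u v (cst c).
Proof. by exists (CC c); [by [] | exact: evKCC]. Qed.

Lemma chart_ring1 u v : chart_ring u v u.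
Proof. by exists 'X; [by [] | exact: evKX]. Qed.

Lemma chart_ring2 u v : chart_ring u v v.
Proof. by exists 'Y; [by [] | exact: evKY]. Qed.

Lemma indep_inj u v : indep cst u v -> injective (evK u v).
Proof.
move=> hi f g E; have /hi : evK u v (f + CC (-1) * g) = 0.
  rewrite rmorphD rmorphM /= evKCC E.
  have -> : cst (-1) = -1 by rewrite rmorphN rmorph1.
  by rewrite mulN1r subrr.
by rewrite CCN /CC !polyC1 mulN1r => /eqP; rewrite subr_eq0 => /eqP.
Qed.

Lemma chart_ring_sub u v (B : set L) : is_subring B -> (forall c, B (cst c)) ->
  B u -> B v -> chart_ring u v `<=` B.
Proof.
move=> hB Bc Bu Bv _ [f _ <-].
have hC (q : {poly F}) : B (evK u v q%:P).
  elim/poly_ind: q => [|q c IH]; first by rewrite polyC0 rmorph0; exact: (subring0 hB).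
  have -> : (q * 'X + c%:P)%:P = q%:P * 'Y + CC c by rewrite polyCD polyCM.
  rewrite rmorphD rmorphM /= evKY evKCC; apply: (subringD hB) (Bc _).
  exact: (subringM hB).
elim/poly_ind: f => [|q r IH]; first by rewrite rmorph0; exact: (subring0 hB).
rewrite rmorphD rmorphM /= evKX; apply: (subringD hB) (hC _).
exact: (subringM hB).
Qed.

(** For x = f / g integral of degree n, the element g^n is a common denominator of all powers of x;
    hence g^m divides g^n f^m for every m, and g divides f. *)
Lemma chart_ring_integrally_closed u v : indep cst u v -> generating cst u v ->
  integrally_closed (chart_ring u v).
Proof.
move=> hi hg x q qm qB /eqP qx.
have hS := chart_ring_subring u v.
have [f [g [g0 xE]]] := hg x.
pose n := (size q).-1.
have qs : size q = n.+1 by rewrite prednK // size_poly_gt0 monic_neq0.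
have xn : x ^+ n = - \sum_(i < n) q`_i * x ^+ i.
  move: qx; rewrite horner_coef qs big_ord_recr /=.
  have -> : q`_n = 1 by rewrite -(monicP qm) lead_coefE.
  by rewrite mul1r addrC => /eqP; rewrite addr_eq0 => /eqP.
have hm m : chart_ring u v (evK u v g ^+ n * x ^+ m).
  have [l] := ubnP m; elim: l m => // l IH m ml.
  have [mn|nm] := leqP m n.
    exists (g ^+ (n - m) * f ^+ m); first by [].
    rewrite rmorphM !rmorphXn /= xE expr_div_n -{2}(subnK mn) exprD -mulrA.
    by congr (_ * _); rewrite mulrC divfK // expf_neq0.
  rewrite -(subnK (ltnW nm)) exprD xn mulrN mulrN mulrA.
  apply: subringN => //; rewrite big_distrr; apply: subring_sum; first exact: hS.
  move=> i _ /=.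
  have -> : evK u v g ^+ n * x ^+ (m - n) * (q`_i * x ^+ i) =
      q`_i * (evK u v g ^+ n * x ^+ (m - n + i)) by rewrite exprD; ring.
  apply: (subringM hS) => //; apply: IH; have := ltn_ord i; lia.
have gn0 : g != 0 by apply: contraNneq g0 => ->; rewrite rmorph0.
have [||h hE] := @dvd_of_powers F f g (g ^+ n) gn0.
- by rewrite expf_neq0.
- move=> m; have [h _ hE] := hm m; exists h; apply: (indep_inj hi).
  rewrite !rmorphM !rmorphXn /= hE xE expr_div_n mulrCA.
  by congr (_ * _); rewrite mulrC divfK // expf_neq0.
exists h; first by [].
by rewrite xE hE rmorphM /= [_ * evK u v h]mulrC mulfK.
Qed.

End ChartRings.

(** * The model obtained by blowing up points *)

Section Centers.
Variables (L : fieldType) (V : set L).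
Hypothesis hV : valuation_ring V.
Implicit Types B : set L.

Let VS : is_subring V. Proof. by have [] := hV. Qed.

Definition nonunit (x : L) := x = 0 \/ ~ V x^-1.

Lemma nonunitP x : ~ nonunit x <-> x != 0 /\ V x^-1.
Proof.
split=> [h|[x0 Vx] [E|//]]; last by rewrite E eqxx in x0.
by split; [apply/eqP => E; apply: h; left | apply: contrapT => E; apply: h; right].
Qed.

Lemma nonunitD x y : V x -> V y -> nonunit x -> nonunit y -> nonunit (x + y).
Proof.
have aux a b : b != 0 -> nonunit b -> V (a / b) -> nonunit (a + b).
  move=> b0 nb Vab; apply: contrapT => /nonunitP[s0 Vs].
  case: nb => [E|nb]; [by rewrite E eqxx in b0|apply: nb].
  have -> : b^-1 = (a / b + 1) * (a + b)^-1.
    by rewrite -[1](divff b0) -mulrDl mulrAC divff // mul1r.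
  by apply: (subringM VS) => //; apply: (subringD VS) => //; exact: subring1 VS.
move=> Vx Vy nx ny; have [->|x0] := eqVneq x 0; first by rewrite add0r.
have [->|y0] := eqVneq y 0; first by rewrite addr0.
have [_ hx] := hV; case: (hx (x / y)) => h; first exact: aux.
by rewrite addrC; apply: aux => //; rewrite -invf_div.
Qed.

Lemma nonunitM a x : V a -> V x -> nonunit x -> nonunit (a * x).
Proof.
move=> Va Vx nx; apply: contrapT => /nonunitP[ax0 Vax]; move: ax0.
rewrite mulf_eq0 negb_or => /andP[a0 x0].
case: nx => [E|nx]; [by rewrite E eqxx in x0|apply: nx].
have -> : x^-1 = a * (a * x)^-1 by rewrite invfM mulrA divff // mul1r.
exact: (subringM VS).
Qed.

Lemma center_prime B : is_subring B -> B `<=` V -> is_prime B (center_on B V).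
Proof.
move=> hB BV; split.
- split=> [x []//||a x y Ba [Bx nx] [By ny]]; first by split; [exact: subring0 | left].
  split; first by apply: (subringD hB) => //; exact: (subringM hB).
  apply: nonunitD; [|exact: BV|apply: nonunitM|] => //; try exact: BV.
  exact/BV/(subringM hB).
- by move=> [_ [/eqP|]]; [rewrite oner_eq0 | apply; rewrite invr1; exact: subring1 VS].
- move=> a b Ba Bb [_ nab]; apply: contrapT => h.
  have /nonunitP[a0 Va] : ~ nonunit a by move=> na; apply: h; left.
  have /nonunitP[b0 Vb] : ~ nonunit b by move=> nb; apply: h; right.
  case: nab => [/eqP|]; first by rewrite mulf_eq0 (negPf a0) (negPf b0).
  by apply; rewrite invfM; exact: (subringM VS).
Qed.

Definition loc_at B := localization B (center_on B V).

Lemma loc_at_subring B : is_subring B -> B `<=` V -> is_subring (loc_at B).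
Proof. by move=> hB BV; apply: localization_subring => //; exact: center_prime. Qed.

Lemma loc_at_sub B : is_subring B -> B `<=` V -> B `<=` loc_at B.
Proof. by move=> hB BV; apply: sub_localization => //; exact: center_prime. Qed.

Lemma loc_at_inv B x : is_subring B -> B x -> x != 0 -> V x^-1 -> loc_at B x^-1.
Proof.
move=> hB Bx x0 Vx; exists 1, x; split=> //; [exact: subring1 | | by rewrite mul1r].
by move=> [_ h]; move: h; apply/nonunitP.
Qed.

(** A denominator b from B1 is a unit of V and a fraction c / d of [loc_at B2]; then c is a unit of
    V too, so b is invertible in [loc_at B2]. *)
Lemma loc_at_le B1 B2 : is_subring B1 -> is_subring B2 -> B1 `<=` V -> B2 `<=` V ->
  B1 `<=` loc_at B2 -> loc_at B1 `<=` loc_at B2.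
Proof.
move=> h1 h2 V1 V2 h12 _ [a [b [Ba Bb nb ->]]].
have [b0 Vb] : b != 0 /\ V b^-1 by apply/nonunitP => h; apply: nb.
apply: (subringM (loc_at_subring h2 V2)); first exact: h12.
have [c [d [Bc Bd nd E]]] := h12 _ Bb.
have [d0 Vd] : d != 0 /\ V d^-1 by apply/nonunitP => h; apply: nd.
have c0 : c != 0 by apply: contraNneq b0 => c0; rewrite E c0 mul0r.
exists d, c; split=> //; last by rewrite E invf_div.
move=> [_]; apply/nonunitP; split=> //.
have -> : c^-1 = b^-1 * d^-1 by rewrite E invf_div mulrC mulKf.
exact: (subringM VS).
Qed.

Lemma loc_at_eq B1 B2 : is_subring B1 -> is_subring B2 -> B1 `<=` V -> B2 `<=` V ->
  B1 `<=` loc_at B2 -> B2 `<=` loc_at B1 -> loc_at B1 = loc_at B2.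
Proof. by move=> *; apply/seteqP; split; exact: loc_at_le. Qed.

End Centers.

Section Charts.
Variables (F L : fieldType) (cst : {rmorphism F -> L}).
Local Notation evK := (evK cst).
Local Notation next := (next cst).
Local Notation coords := (coords cst).
Local Notation R uv := (chart_ring cst uv.1 uv.2).

(* The pair in the coordinates of which the blown up point lies at the origin
   and the direction of the next center is (1 : 0). *)
Definition recenter (a : bool * F) (uv : L * L) : L * L :=
  let uv' := if a.1 then (uv.2, uv.1) else uv in (uv'.1, uv'.2 - cst a.2 * uv'.1).

(* The chart left aside at each blow up adds a single point of the exceptional
   line, which is not the next center. *)
Fixpoint charts (s : seq (bool * F)) (uv : L * L) : seq (L * L) :=
  match s with
  | [::] => [:: next (true, 0) uv; next (false, 0) uv]
  | a :: s' => next (true, 0) (recenter a uv) :: charts s' (next a uv)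
  end.

Lemma coords_in_charts s uv : coords s uv \in charts s uv.
Proof.
elim: s uv => [|a s IH] uv; first by rewrite /= !inE eqxx orbT.
by rewrite inE coords_cons IH orbT.
Qed.

Lemma next_recenter a uv : (recenter a uv).1 != 0 ->
  next a uv = next (false, 0) (recenter a uv).
Proof.
move=> h; rewrite /next /=; congr (_, _).
by rewrite rmorph0 subr0 mulrBl mulfK.
Qed.

Definition good (uv : L * L) := indep cst uv.1 uv.2 /\ generating cst uv.1 uv.2.

Lemma good_next a uv : good uv -> good (next a uv).
Proof.
by case: uv => u v [h1 h2]; split; [exact: indep_next | exact: generating_next].
Qed.

Lemma good_neq0 uv : good uv -> uv.1 != 0 /\ uv.2 != 0.
Proof. by move=> [h _]; exact: indep_neq0 h. Qed.

(** Exchanging the coordinates and shearing are automorphisms of the polynomial ring. *)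
Lemma good_recenter a uv : good uv -> good (recenter a uv).
Proof.
have hsw (u v : L) : good (u, v) -> good (v, u).
  have E u1 v1 f : evK u1 v1 (swapXY f) = evK v1 u1 f.
    by rewrite swapXY_sub2 /evK ev2_sub2 ev2X ev2Y.
  move=> [h1 h2]; split=> [f /= h|x]; rewrite /= in h1 h2 *.
    have := h1 (swapXY f); rewrite E => /(_ h)/eqP; rewrite swapXY_eq0.
    by move/eqP.
  by have [f [g]] := h2 x; rewrite -!(E v u); exists (swapXY f), (swapXY g).
have hsh (u v : L) c : good (u, v) -> good (u, v - cst c * u).
  have E u1 v1 d f : evK u1 v1 (sub2 'X ('Y + CC d * 'X) f) = evK u1 (v1 + cst d * u1) f.
    rewrite /evK ev2_sub2 ev2X; congr (ev2 _ _ _ _).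
    by rewrite rmorphD rmorphM /= ev2Y ev2CC ev2X.
  have K d : cancel (sub2 'X ('Y + CC d * 'X)) (@sub2 F 'X ('Y + CC (- d) * 'X)).
    move=> f; rewrite sub2_sub2 sub2X -[RHS]sub2_id; congr (sub2 _ _ f).
    by rewrite rmorphD rmorphM /= sub2X sub2Y sub2CC CCN mulNr subrK.
  have vE : v - cst c * u = v + cst (- c) * u by rewrite rmorphN mulNr.
  move=> [h1 h2]; split=> [f /= h|x]; rewrite /= in h1 h2 *.
    have := h1 (sub2 'X ('Y + CC (- c) * 'X) f); rewrite E -vE => /(_ h) f0.
    by rewrite -(K (- c) f) f0 rmorph0.
  have [f [g [g0 xE]]] := h2 x.
  exists (sub2 'X ('Y + CC c * 'X) f), (sub2 'X ('Y + CC c * 'X) g).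
  by rewrite !E subrK.
by case: uv => u v h; case: a => [[] c]; rewrite /recenter /=; apply: hsh => //; exact: hsw.
Qed.

Lemma R_subring uv : is_subring (R uv). Proof. exact: chart_ring_subring. Qed.
Lemma R_cst uv c : R uv (cst c). Proof. exact: chart_ring_cst. Qed.
Lemma R_fst uv : R uv uv.1. Proof. exact: chart_ring1. Qed.
Lemma R_snd uv : R uv uv.2. Proof. exact: chart_ring2. Qed.

Lemma R_sub uv (B : set L) : is_subring B -> (forall c, B (cst c)) ->
  B uv.1 -> B uv.2 -> R uv `<=` B.
Proof. exact: chart_ring_sub. Qed.

Lemma R_recenter a uv : R (recenter a uv) = R uv.
Proof.
case: uv a => u v [b c].
have hM x y uv : R uv x -> R uv y -> R uv (x - cst c * y).
  move=> hx hy; have [_ h _] := R_subring uv; apply: h => //.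
  by apply: (subringM (R_subring uv)) => //; exact: R_cst.
have hP x y uv : R uv (x - cst c * y) -> R uv y -> R uv x.
  move=> hx hy; rewrite -(subrK (cst c * y) x); apply: (subringD (R_subring uv)) => //.
  by apply: (subringM (R_subring uv)) => //; exact: R_cst.
apply/seteqP; split; apply: R_sub; try exact: R_subring; try exact: R_cst.
- by case: b; [exact: (R_snd (u, v)) | exact: (R_fst (u, v))].
- by case: b; apply: hM; first [exact: (R_snd (u, v)) | exact: (R_fst (u, v))].
- case: b => /=; last exact: (R_fst (u, v - cst c * u)).
  by apply: (hP u v (v, u - cst c * v)); [exact: (R_snd (v, u - cst c * v)) | exact: (R_fst (v, u - cst c * v))].
- case: b => /=; first exact: (R_fst (v, u - cst c * v)).
  by apply: (hP v u (u, v - cst c * u)); [exact: (R_snd (u, v - cst c * u)) | exact: (R_fst (u, v - cst c * u))].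
Qed.

Section ValuationRing.
Variables (V : set L) (hV : valuation_ring V).
Local Notation loc uv := (loc_at V (R uv)).

Let VS : is_subring V. Proof. by have [] := hV. Qed.

(* The center of V on the chart with coordinates uv is not the origin. *)
Definition off_origin (uv : L * L) := ~ nonunit V uv.1 \/ ~ nonunit V uv.2.

Lemma off_origin_recenter a uv : R uv `<=` V -> off_origin uv ->
  off_origin (recenter a uv).
Proof.
move=> RV h; apply: contrapT => /not_orP[/contrapT n1 /contrapT n2].
have hR : R (recenter a uv) `<=` V by rewrite R_recenter.
have V1 := hR _ (R_fst (recenter a uv)); have V2 := hR _ (R_snd (recenter a uv)).
have n3 : nonunit V ((recenter a uv).2 + cst a.2 * (recenter a uv).1).
  have Vc := hR _ (R_cst (recenter a uv) a.2).
  apply: nonunitD => //; last exact: nonunitM.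
  exact: (subringM VS).
move: n1 n3 h; rewrite /recenter /off_origin /= subrK.
by case: a.1 => /= h1 h2 [].
Qed.

Lemma next_false (p q : L) : next (false, 0) (p, q) = (p, q / p).
Proof. by rewrite /next /= rmorph0 subr0. Qed.

Lemma next_true (p q : L) : next (true, 0) (p, q) = (q, p / q).
Proof. by rewrite /next /= rmorph0 subr0. Qed.

Lemma R_blow p q : p != 0 -> R (p, q) `<=` R (p, q / p).
Proof.
move=> p0; have h := R_subring (p, q / p).
apply: R_sub => //; [exact: R_cst | exact: (R_fst (p, q / p)) |].
suff : R (p, q / p) (q / p * p) by rewrite divfK.
apply: (subringM h).
  exact: (R_snd (p, q / p)).
exact: (R_fst (p, q / p)).
Qed.

Lemma loc_blow p q : p != 0 -> R (p, q / p) `<=` V -> V p^-1 ->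
  loc (p, q / p) = loc (p, q).
Proof.
move=> p0 RV Vp; have R0V : R (p, q) `<=` V by apply: subset_trans RV; exact: R_blow.
have hL := loc_at_subring hV (R_subring (p, q)) R0V.
have sub := loc_at_sub hV (R_subring (p, q)) R0V.
apply: loc_at_eq => //; try exact: R_subring; last first.
  by apply: subset_trans (R_blow p0) _; exact: loc_at_sub (R_subring _) RV.
apply: R_sub => // [c||]; first exact/sub/R_cst.
  exact/sub/(R_fst (p, q)).
apply: (subringM hL); first exact/sub/(R_snd (p, q)).
by apply: loc_at_inv => //; [exact: R_subring | exact: (R_fst (p, q))].
Qed.

Lemma R_swap p q : R (p, q) = R (q, p).
Proof.
apply/seteqP; split; apply: R_sub; try exact: R_subring; try exact: R_cst.
- exact: (R_snd (q, p)).
- exact: (R_fst (q, p)).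
- exact: (R_snd (p, q)).
- exact: (R_fst (p, q)).
Qed.

Lemma loc_blow_both p q : p != 0 -> q != 0 ->
  R (p, q / p) `<=` V -> R (q, p / q) `<=` V -> loc (p, q / p) `<=` loc (q, p / q).
Proof.
move=> p0 q0 V1 V2; apply: loc_at_le => //; try exact: R_subring.
have hL := loc_at_subring hV (R_subring (q, p / q)) V2.
have sub := loc_at_sub hV (R_subring (q, p / q)) V2.
apply: R_sub => // [c||]; first exact/sub/R_cst.
  suff : loc (q, p / q) (p / q * q) by rewrite divfK.
  apply: (subringM hL).
    exact/sub/(R_snd (q, p / q)).
  exact/sub/(R_fst (q, p / q)).
suff : loc (q, p / q) (p / q)^-1 by rewrite invf_div.
apply: loc_at_inv => //.
- exact: R_subring.
- exact: (R_snd (q, p / q)).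
- by rewrite mulf_neq0 // invr_eq0.
- by rewrite invf_div; apply: V1; exact: (R_snd (p, q / p)).
Qed.

Lemma off_origin_blow p q : p != 0 -> R (p, q / p) `<=` V -> off_origin (p, q) -> V p^-1.
Proof.
move=> p0 RV [/nonunitP[]//|/nonunitP[q0 Vq]].
have -> : p^-1 = q / p * q^-1 by rewrite mulrAC divff // mul1r.
by apply: (subringM VS) => //; exact/RV/(R_snd (p, q / p)).
Qed.

(** A valuation ring contains p / q or q / p, so at each blow up it has a center on one of the two
    charts. *)
Lemma charts_proper s uv : good uv -> R uv `<=` V ->
  exists2 ab, ab \in charts s uv & R ab `<=` V.
Proof.
have blow a uv' : good uv' -> R uv' `<=` V ->
    R (next (true, 0) (recenter a uv')) `<=` V \/ R (next a uv') `<=` V.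
  move=> hg; rewrite -(R_recenter a) => RV.
  have hg' := good_recenter a hg; have [p0 q0] := good_neq0 hg'.
  rewrite (next_recenter p0); case: (recenter a uv') p0 q0 RV => p q p0 q0 RV; rewrite [_.1]/= in p0; rewrite [_.2]/= in q0.
  rewrite next_true next_false.
  have Vp := RV _ (R_fst (p, q)); have Vq := RV _ (R_snd (p, q)).
  have Vc c := RV _ (R_cst (p, q) c).
  by have [_ h] := hV; case: (h (p / q)) => hpq; [left|right];
    apply: R_sub => //=; rewrite -invf_div.
elim: s uv => [|a s IH] uv hg RV.
  have := blow (false, 0) uv hg RV.
  have -> : recenter (false, 0) uv = uv by case: uv {hg RV} => u v; rewrite /recenter /= rmorph0 mul0r subr0.
  case=> h; [exists (next (true, 0) uv) | exists (next (false, 0) uv)] => //;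
    by rewrite !inE eqxx ?orbT.
case: (blow a uv hg RV) => h.
  by exists (next (true, 0) (recenter a uv)); rewrite // mem_head.
have [ab h1 h2] := IH _ (good_next a hg) h.
by exists ab => //; rewrite inE h1 orbT.
Qed.

End ValuationRing.

Lemma charts_good s uv : good uv ->
  forall ab, ab \in charts s uv -> good ab /\ R uv `<=` R ab.
Proof.
have blow a uv' : good uv' -> R uv' `<=` R (next (true, 0) (recenter a uv')) /\
    R uv' `<=` R (next a uv').
  move=> hg; rewrite -(R_recenter a).
  have hg' := good_recenter a hg; have [p0 q0] := good_neq0 hg'.
  rewrite (next_recenter p0); case: (recenter a uv') p0 q0 => p q p0 q0; rewrite [_.1]/= in p0; rewrite [_.2]/= in q0.
  rewrite next_true next_false; split; last exact: R_blow.
  by rewrite (R_swap p q); exact: R_blow.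
elim: s uv => [|a s IH] uv hg ab.
  have := blow (false, 0) uv hg.
  have -> : recenter (false, 0) uv = uv by case: uv {hg} => u v; rewrite /recenter /= rmorph0 mul0r subr0.
  move=> [h1 h2]; rewrite !inE => /orP[] /eqP ->; split=> //; exact: good_next.
have [h1 h2] := blow a uv hg.
rewrite inE => /predU1P[->|hab].
  by split=> //; exact/good_next/good_recenter.
have [h3 h4] := IH _ (good_next a hg) ab hab.
by split=> //; exact: subset_trans h2 h4.
Qed.

Section Separated.
Variables (V : set L) (hV : valuation_ring V).
Local Notation loc uv := (loc_at V (R uv)).

(* The blow ups are isomorphisms away from their centers. *)
Lemma charts_off_origin s uv : good uv -> off_origin V uv ->
  forall ab, ab \in charts s uv -> R ab `<=` V -> loc ab = loc uv.
Proof.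
have blow a uv' : good uv' -> off_origin V uv' -> R uv' `<=` V ->
    (R (next (true, 0) (recenter a uv')) `<=` V ->
      loc (next (true, 0) (recenter a uv')) = loc uv') /\
    (R (next a uv') `<=` V -> off_origin V (next a uv') /\ loc (next a uv') = loc uv').
  move=> hg ho RV; have ho' := off_origin_recenter hV a RV ho.
  have hg' := good_recenter a hg; have [p0 q0] := good_neq0 hg'.
  rewrite (next_recenter p0) -(R_recenter a uv').
  case: (recenter a uv') p0 q0 ho' => p q p0 q0 ho'; rewrite [_.1]/= in p0; rewrite [_.2]/= in q0.
  rewrite next_true next_false; split=> h.
    rewrite (R_swap p q); apply: loc_blow => //.
    by apply: (off_origin_blow hV q0 h); case: ho'; [right|left].
  have Vp := off_origin_blow hV p0 h ho'.
  by split; [left; apply/nonunitP | exact: loc_blow].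
have sub a b uv' ab : good uv' -> ab \in charts (a :: b) uv' -> R ab `<=` V -> R uv' `<=` V.
  by move=> hg /(charts_good hg)[_ h]; apply: subset_trans.
elim: s uv => [|a s IH] uv hg ho ab hab RV.
  have RuV : R uv `<=` V by apply: subset_trans RV; have [] := charts_good hg hab.
  have := blow (false, 0) uv hg ho RuV.
  have -> : recenter (false, 0) uv = uv.
    by case: uv {hg ho hab RuV} => u v; rewrite /recenter /= rmorph0 mul0r subr0.
  move=> [h1 h2]; move: hab; rewrite !inE => /orP[] /eqP E; rewrite E in RV *.
    exact: h1 RV.
  by have [_ ->] := h2 RV.
have [h1 h2] := blow a uv hg ho (sub _ _ _ _ hg hab RV).
move: hab; rewrite inE => /predU1P[E|hab]; first by rewrite E in RV *; exact: h1.
have [ho' <-] : off_origin V (next a uv) /\ loc (next a uv) = loc uv.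
  by apply: h2; apply: subset_trans RV; have [] := charts_good (good_next a hg) hab.
by apply: IH => //; exact: good_next.
Qed.

(** The two charts of a blow up overlap where q / p is invertible. The center of V there differs
    from the next point blown up, so the later blow ups leave the local ring unchanged. *)
Lemma charts_separated s uv : good uv -> forall ab ab', ab \in charts s uv ->
  ab' \in charts s uv -> R ab `<=` V -> R ab' `<=` V -> loc ab = loc ab'.
Proof.
have both a uv' : good uv' -> R (next (true, 0) (recenter a uv')) `<=` V ->
    R (next a uv') `<=` V -> off_origin V (next a uv') /\
    loc (next a uv') = loc (next (true, 0) (recenter a uv')).
  move=> hg; have hg' := good_recenter a hg; have [p0 q0] := good_neq0 hg'.
  rewrite (next_recenter p0); case: (recenter a uv') p0 q0 => p q p0 q0; rewrite [_.1]/= in p0; rewrite [_.2]/= in q0.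
  rewrite next_true next_false => h1 h2; split; last first.
    by apply/seteqP; split; apply: loc_blow_both.
  right; apply/nonunitP; split; first by rewrite mulf_neq0 // invr_eq0.
  by rewrite /= invf_div; exact: h1 (R_snd (q, p / q)).
elim: s uv => [|a s IH] uv hg ab ab'.
  have := both (false, 0) uv hg.
  have -> : recenter (false, 0) uv = uv by case: uv {hg} => u v; rewrite /recenter /= rmorph0 mul0r subr0.
  move=> h; rewrite !inE => /orP[] /eqP -> /orP[] /eqP -> // h1 h2.
    by have [_ ->] := h h1 h2.
  by have [_ ->] := h h2 h1.
have one cd : cd \in charts s (next a uv) -> R cd `<=` V ->
    R (next (true, 0) (recenter a uv)) `<=` V ->
    loc cd = loc (next (true, 0) (recenter a uv)).
  move=> hcd RV h; have hg' := good_next a hg.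
  have RnV : R (next a uv) `<=` V.
    by apply: subset_trans RV; have [] := charts_good hg' hcd.
  have [ho <-] := both a uv hg h RnV.
  exact: (charts_off_origin hg' ho hcd RV).
rewrite !inE => /predU1P[->|h1] /predU1P[->|h2] V1 V2 //.
- by rewrite (one _ h2).
- exact: one.
- exact: (IH _ (good_next a hg)).
Qed.

End Separated.

End Charts.

(** * The canonical module at a coordinate axis *)

Section MonomialValuation.
Variables (F L : fieldType) (cst : {rmorphism F -> L}) (U W : L).
Local Notation PP := {poly {poly F}}.
Local Notation ev := (evK cst U W).
Local Notation B := (chart_ring cst U W).
Hypotheses (hi : indep cst U W) (hg : generating cst U W).

Lemma ev_neq0 f : (ev f != 0) = (f != 0).
Proof.
apply/idP/idP; first by apply: contraNneq => ->; rewrite rmorph0.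
by apply: contraNneq => /hi ->.
Qed.

Lemma ev_fact f : f != 0 -> exists2 g, ev f = U ^+ ordX f * ev g & g`_0 != 0.
Proof.
move=> /ordX_fact[g E g0]; exists g => //.
by rewrite {1}E rmorphM rmorphXn /= evKX.
Qed.

(** The equation U = 0 of the last exceptional curve in its chart. *)
Definition axis_ideal : set L := [set x | exists2 f : PP, f`_0 = 0 & x = ev f].

Lemma axis_idealE f : axis_ideal (ev f) <-> f`_0 = 0.
Proof. by split=> [[g g0 /(indep_inj hi) ->]|f0] //; exists f. Qed.

Lemma U_axis_ideal : axis_ideal U.
Proof. by exists 'X; [rewrite coefX | rewrite evKX]. Qed.

Lemma axis_ideal_prime : is_prime B axis_ideal.
Proof.
split.
- split=> [_ [f _ ->]||_ _ _ [a _ <-] [f f0 ->] [g g0 ->]]; first by exists f.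
    by exists 0; [exact: coef0 | rewrite rmorph0].
  exists (a * f + g); last by rewrite rmorphD rmorphM.
  by rewrite coefD coef0M f0 g0 mulr0 addr0.
- rewrite -(rmorph1 ev) => /axis_idealE/eqP.
  by rewrite coef1 oner_eq0.
- move=> _ _ [a _ <-] [b _ <-]; rewrite -rmorphM => /axis_idealE/eqP.
  rewrite coef0M mulf_eq0 => /orP[] /eqP h; [left|right]; exact/axis_idealE.
Qed.

Lemma axis_ideal_height_one : height_one B axis_ideal.
Proof.
split; first exact: axis_ideal_prime.
  move=> E; have := U_axis_ideal; rewrite E => U0.
  by have [] := indep_neq0 hi; rewrite U0 eqxx.
move=> Q [[QB Q0 QD] Q1 QM] QP; have [Qz|/existsNP[q /not_implyP[Qq q0]]] :=
    pselect (forall q, Q q -> q = 0).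
  by left; apply/seteqP; split=> [q /Qz|_ ->].
right; apply/seteqP; split=> //.
have BU n : B (U ^+ n) by exact: (subringX n (chart_ring_subring _ _ _) (chart_ring1 _ _ _)).
(* A nonzero element of Q is U^n times an element outside the axis ideal, so Q contains a power of
   U. *)
have QU : Q U.
  have [f _ fE] := QB _ Qq.
  have f0 : f != 0 by rewrite -ev_neq0 fE; exact/eqP.
  have [g gE g0] := ev_fact f0.
  have : Q (U ^+ ordX f).
    case: (QM (U ^+ ordX f) (ev g)) => //; first by exists g.
      by rewrite -gE fE.
    by move=> /QP/axis_idealE E; rewrite E eqxx in g0.
  elim: (ordX f) => [|n IH]; first by rewrite expr0.
  rewrite exprS; case/QM => //; exact: (BU 1%N).
move=> _ [f f0 ->].
have [g ->] : exists g, f = g * 'X.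
  exists (drop_poly 1 f); rewrite -{1}(poly_take_drop 1 f) commr_polyXn expr1.
  suff -> : take_poly 1 f = 0 by rewrite add0r mulrC.
  by apply/polyP => i; rewrite coef_take_poly coef0; case: i => [|i].
rewrite rmorphM /= evKX -[_ * _]addr0; apply: QD => //; by exists g.
Qed.

Definition axis_ring : set L := [set x | exists f g : PP, g`_0 != 0 /\ x = ev f / ev g].

Lemma coef0_neq0 (g : PP) : g`_0 != 0 -> g != 0.
Proof. by apply: contraNneq => ->; rewrite coef0. Qed.

Lemma localization_axis : localization B axis_ideal = axis_ring.
Proof.
apply/seteqP; split=> [_ [_ [_ [[f _ <-] [g _ <-] h ->]]]|_ [f [g [g0 ->]]]].
  by exists f, g; split=> //; apply/eqP => /axis_idealE.
exists (ev f), (ev g); split=> //; [by exists f | by exists g |].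
by move=> /axis_idealE/eqP E; rewrite E in g0.
Qed.

Section Integral.
Variable w : L -> int.
Hypothesis wM : forall x y, x != 0 -> y != 0 -> w (x * y) = w x + w y.
Hypothesis w_ev : forall f, f != 0 -> w (ev f) = (ordX f)%:Z.

Lemma w_div f g : f != 0 -> g != 0 -> w (ev f / ev g) = (ordX f)%:Z - (ordX g)%:Z.
Proof.
move=> f0 g0; rewrite -!w_ev //.
have : w (ev f / ev g) + w (ev g) = w (ev f).
  by rewrite -wM ?mulf_neq0 ?invr_eq0 ?ev_neq0 // divfK // ev_neq0.
by move=> <-; rewrite addrK.
Qed.

Lemma integralE x : x != 0 -> axis_ring x <-> 0 <= w x.
Proof.
move=> x0; split=> [[f [g [g0 E]]]|].
  have f0 : f != 0 by rewrite -ev_neq0; apply: contraNneq x0 => h; rewrite E h mul0r.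
  have o0 : ordX g = 0%N by rewrite -(ordX_eq 0 g0) expr0 mul1r.
  by rewrite E w_div //; [rewrite o0 subr0 | exact: coef0_neq0].
have [f [g [g0 E]]] := hg x; rewrite ev_neq0 in g0.
have f0 : f != 0 by rewrite -ev_neq0; apply: contraNneq x0 => h; rewrite E h mul0r.
rewrite E w_div // subr_ge0 lez_nat => le.
have [f1 fE f10] := ev_fact f0; have [g1 gE g10] := ev_fact g0.
exists ('X^(ordX f - ordX g) * f1), g1; split=> //.
have Ug : U ^+ ordX g != 0 by rewrite expf_neq0 //; have [] := indep_neq0 hi.
rewrite rmorphM rmorphXn /= evKX fE gE -{1}(subnK le) exprD.
by rewrite [_ * _ * ev f1]mulrAC [U ^+ ordX g * ev g1]mulrC -mulf_div divff // mulr1.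
Qed.

End Integral.

Lemma axis_valuation_exists : exists w : L -> int,
  (forall f, f != 0 -> w (ev f) = (ordX f)%:Z) /\
  normalized_valuation_of (localization B axis_ideal) w.
Proof.
pose w x := xget 0 [set n : int | exists f g, [/\ f != 0, g != 0, x = ev f / ev g &
  n = (ordX f)%:Z - (ordX g)%:Z]].
have wE f g : f != 0 -> g != 0 -> w (ev f / ev g) = (ordX f)%:Z - (ordX g)%:Z.
  move=> f0 g0; apply: xget_unique; first by exists f, g.
  move=> n [f' [g' [f'0 g'0 /eqP E ->]]].
  rewrite eqr_div ?ev_neq0 // -!rmorphM in E.
  have E' := indep_inj hi (eqP E); have : ordX (f * g') = ordX (f' * g) by rewrite E'.
  rewrite !ordXM //.
  by lia.
have w_ev f : f != 0 -> w (ev f) = (ordX f)%:Z.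
  move=> f0; have := wE f 1 f0 (oner_neq0 _); rewrite rmorph1 divr1 => ->.
  have o1 : ordX (1 : PP) = 0%N.
    have := @ordX_eq {poly F} 0%N (1 : PP); rewrite expr0 mulr1 coef1; apply.
    exact: oner_neq0.
  by rewrite o1 subr0.
have frac x : x != 0 -> exists f g, [/\ f != 0, g != 0 & x = ev f / ev g].
  move=> x0; have [f [g [g0 E]]] := hg x; rewrite ev_neq0 in g0; exists f, g; split=> //.
  by rewrite -ev_neq0; apply: contraNneq x0 => h; rewrite E h mul0r.
have wM x y : x != 0 -> y != 0 -> w (x * y) = w x + w y.
  move=> /frac[f [g [f0 g0 ->]]] /frac[f' [g' [f'0 g'0 ->]]].
  rewrite mulf_div -!rmorphM !wE ?mulf_neq0 // !ordXM //; lia.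
exists w; split=> //; split=> //.
  exists U; first by have [] := indep_neq0 hi.
  rewrite -[X in w X](evKX cst U W) w_ev ?polyX_eq0 //.
  by rewrite -[X in ordX X]mulr1 -['X]expr1 ordX_eq // coef1 oner_eq0.
by move=> x x0; rewrite localization_axis; exact: integralE.
Qed.

Section Jacobian.
Variables (J : L -> L -> L) (hJ : alternating_der cst J).
Let O := axis_ring.

Lemma axis_ring_subring : is_subring O.
Proof.
rewrite /O -localization_axis; apply: localization_subring.
  exact: chart_ring_subring.
exact: axis_ideal_prime.
Qed.

(** The coefficients are the partial derivatives of a in U and W. Being common to all derivations,
    they show that da is a combination of dU and dW over the local ring. *)
Lemma der_axis_ring a : O a -> exists al be, [/\ O al, O be &
  forall d, is_der cst d -> d a = al * d U + be * d W].
Proof.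
move=> Oa; have [f [g [g0 E]]] := Oa.
have hO := axis_ring_subring.
have O1 h : O (ev h / ev g) by exists h, g.
have Oe h : O (ev h).
  by exists h, 1; rewrite rmorph1 divr1 coef1 oner_eq0.
exists (ev (dX f) / ev g - a * (ev (dX g) / ev g)), (ev (dY f) / ev g - a * (ev (dY g) / ev g)).
have hB x y : O x -> O y -> O (x - y) by have [_ h _] := hO; exact: h.
split; try by apply: hB; [exact: O1 | apply: (subringM hO) => //; exact: O1].
move=> d hd; rewrite {1}E (der_div hd) //; last by rewrite ev_neq0 coef0_neq0.
rewrite -E !(der_evK hd); move: (ev (dX f)) (ev (dY f)) (ev (dX g)) (ev (dY g)) (ev g)^-1.
by move=> p q r s t; ring.
Qed.

Lemma jacobian_axis_ring a b : O a -> O b -> exists2 c, O c & J a b = c * J U W.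
Proof.
have hO := axis_ring_subring; have [hd hA h0] := hJ.
move=> /der_axis_ring[al [be [Oal Obe Ea]]] /der_axis_ring[al' [be' [Oal' Obe' Eb]]].
exists (al * be' - be * al').
  by have [_ h _] := hO; apply: h; apply: (subringM hO).
rewrite (Eb _ (hd a)) (hA a U) (hA a W) (Ea _ (hd U)) (Ea _ (hd W)) !h0 (hA W U).
by move: (J U W) => j; ring.
Qed.

Lemma canonical_axis_ring :
  [set h | exists s : seq (L * L * L),
     (forall t, t \in s -> [/\ O t.1.1, O t.1.2 & O t.2])
     /\ h = \sum_(t <- s) t.1.1 * J t.1.2 t.2] = [set c * J U W | c in O].
Proof.
have hO := axis_ring_subring.
have Oe h : O (ev h) by exists h, 1; rewrite rmorph1 divr1 coef1 oner_eq0.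
apply/seteqP; split=> [_ [s [hs ->]]|_ [c Oc <-]]; last first.
  exists [:: (c, U, W)]; rewrite big_seq1; split=> // t; rewrite inE => /eqP ->.
  by split=> //=; [rewrite -(evKX cst U W) | rewrite -(evKY cst U W)]; exact: Oe.
elim: s hs => [|t s IH] hs.
  by exists 0; [exact: subring0 | rewrite big_nil mul0r].
have [c Oc cE] : [set c * J U W | c in O] (\sum_(t <- s) t.1.1 * J t.1.2 t.2).
  by apply: IH => t' ht'; apply: hs; rewrite inE ht' orbT.
have [O1 O2 O3] := hs t (mem_head _ _).
have [c' Oc' E] := jacobian_axis_ring O2 O3.
exists (t.1.1 * c' + c); first by apply: (subringD hO) => //; exact: (subringM hO).
by rewrite big_cons -cE E mulrDl mulrA.
Qed.

End Jacobian.

End MonomialValuation.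

Section JacobianValue.
Variables (F L : fieldType) (cst : {rmorphism F -> L}) (w : L -> int).
Hypothesis hw : is_valuation cst w.
Variables (J : L -> L -> L) (hJ : alternating_der cst J).
Local Notation coords := (coords cst).
Local Notation next := (next cst).

Lemma val_coords1 s u v : indep cst u v ->
  (forall f, f != 0 -> w (evK cst (coords s (u, v)).1 (coords s (u, v)).2 f) = (ordX f)%:Z) ->
  w u = (eXY (shape s)).1%:Z.
Proof.
move=> hi h; rewrite -[X in w X](evKX cst u v) (ev_coords s) // h.
  by have [[g -> g0] _] := eXYP s; rewrite ordX_eq.
by rewrite sigma_eq0 polyX_eq0.
Qed.

Lemma val_sign (b : bool) : w (if b then -1 else 1) = 0.
Proof.
have -> : (if b then -1 else 1) = cst (if b then -1 else 1).
  by case: b; rewrite ?rmorphN rmorph1.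
by apply: (val_cst hw); case: b; rewrite ?oppr_eq0 oner_eq0.
Qed.

Lemma val_jacobian s u v : indep cst u v -> J u v != 0 ->
  (forall f, f != 0 -> w (evK cst (coords s (u, v)).1 (coords s (u, v)).2 f) = (ordX f)%:Z) ->
  J (coords s (u, v)).1 (coords s (u, v)).2 != 0 /\
  w (J (coords s (u, v)).1 (coords s (u, v)).2) = w (J u v) - (disc (shape s))%:Z.
Proof.
have one a u' v' : indep cst u' v' -> J u' v' != 0 ->
    J (next a (u', v')).1 (next a (u', v')).2 != 0 /\
    w (J (next a (u', v')).1 (next a (u', v')).2) = w (J u' v') - w (next a (u', v')).1.
  move=> hi j0; have [u0 v0] := indep_neq0 hi.
  have n0 : (next a (u', v')).1 != 0 by rewrite /next; case: a.1.
  have s0 : (if a.1 then -1 else 1 : L) != 0 by case: a.1; rewrite ?oppr_eq0 oner_eq0.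
  rewrite (jac_next hJ) //; split; first by rewrite !mulf_neq0 ?invr_eq0.
  by rewrite (val_div hw) ?mulf_neq0 // (valM hw) // val_sign add0r.
elim: s u v => [|a s IH] u v hi j0 h.
  have [n0 ->] := one (false, 0) u v hi j0; split=> //; congr (_ - _).
  by rewrite (val_coords1 hi h).
have [n0 nE] := one a u v hi j0.
have hi' := indep_next (a := a) hi.
have [E1 E2] : coords (a :: s) (u, v) = coords s ((next a (u, v)).1, (next a (u, v)).2) /\ True.
  by split=> //; rewrite coords_cons -surjective_pairing.
rewrite E1 in h *; have [c0 ->] := IH _ _ hi' n0 h; split=> //.
by rewrite nE (val_coords1 hi' h) /=; lia.
Qed.

End JacobianValue.

(** * The prime divisor of a sequence of blow ups *)

Section DivisorOfBlowUps.
Variable F : fieldType.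
Local Notation K := {fraction {mpoly F[2]}}.
Local Notation XY := (XK F, YK F).
Local Notation R uv := (chart_ring (@cstK F) uv.1 uv.2).

Lemma good_XY : good (@cstK F) XY.
Proof. by split; [exact: indep_XY | exact: generating_XY]. Qed.

Lemma affine_chart_R uv : good (@cstK F) uv -> R XY `<=` R uv -> affine_chart (R uv).
Proof.
move=> [hi hg] hXY; split; last exact: chart_ring_integrally_closed.
exists [:: uv.1; uv.2]; apply/seteqP; split.
  apply: chart_ring_sub; first exact: ring_generated_subring.
  - by move=> c; apply: sub_ring_generated; left; exists c%:MP.
  - by apply: sub_ring_generated; right; rewrite /= inE eqxx.
  - by apply: sub_ring_generated; right; rewrite /= !inE eqxx orbT.
apply: ring_generated_sub; first exact: chart_ring_subring.
move=> x [|]; first by rewrite coord_ringE; exact: hXY.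
by rewrite /= !inE => /orP[] /eqP ->; [exact: chart_ring1 | exact: chart_ring2].
Qed.

Section Model.
Variable s : seq (bool * F).
Local Notation l := (charts (@cstK F) s XY).

Definition blow_up_chart (i : 'I_(size l)) : set K := R (nth XY l i).

Lemma blow_up_chartP i : affine_chart (blow_up_chart i).
Proof.
have [hg hs] := charts_good good_XY (mem_nth XY (ltn_ord i)).
exact: affine_chart_R.
Qed.

Lemma blow_up_proper V : valuation_ring V -> @coord_ring F `<=` V ->
  exists i, blow_up_chart i `<=` V.
Proof.
rewrite coord_ringE => hV /(charts_proper hV s good_XY)[ab hab RV].
have lt : (index ab l < size l)%N by rewrite index_mem.
by exists (Ordinal lt); rewrite /blow_up_chart nth_index.
Qed.

Lemma blow_up_separated V i j : valuation_ring V ->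
  blow_up_chart i `<=` V -> blow_up_chart j `<=` V ->
  localization (blow_up_chart i) (center_on (blow_up_chart i) V) =
  localization (blow_up_chart j) (center_on (blow_up_chart j) V).
Proof.
move=> hV h1 h2.
exact: (charts_separated hV good_XY (mem_nth XY (ltn_ord i)) (mem_nth XY (ltn_ord j)) h1 h2).
Qed.

Definition blow_up_model : normal_model F :=
  NormalModel blow_up_chartP blow_up_proper blow_up_separated.

End Model.

Lemma constant_term (f : {poly {poly F}}) :
  exists g h, f = g * 'X + h * 'Y + CC f`_0`_0.
Proof.
have CC0 : CC (0 : F) = 0 by rewrite /CC !polyC0.
elim/poly_ind: f => [|g q _]; first by exists 0, 0; rewrite !coef0 !mul0r !add0r CC0.
elim/poly_ind: q => [|q c _]; exists g.
  by exists 0; rewrite polyC0 addr0 coefMX /= coef0 CC0 mul0r !addr0.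
exists q%:P; rewrite coefD coefMX coefC /= add0r coefD coefMX coefC /= add0r.
by rewrite polyCD polyCM addrA.
Qed.

(** Both coordinates of the plane pull back to multiples of x1, so the exceptional curve maps to the
    origin. *)
Lemma sigma_axis s (f : {poly {poly F}}) : (sigma s f)`_0 = 0 <-> f`_0`_0 = 0.
Proof.
suff -> : (sigma s f)`_0 = (f`_0`_0)%:P.
  by split=> [/eqP|->]; rewrite ?polyC_eq0 // => /eqP.
have [g [h {1}->]] := constant_term f.
have [[q1 E1 _] [q2 E2 _]] := eXYP s; have [h1 h2] := eXY_gt0 (shape s).
rewrite !rmorphD !rmorphM /= E1 E2 sigmaC !coefD !coef0M !coefXn.
by rewrite !(eq_sym 0%N) !eqn0Ngt h1 h2 /= !mul0r !mulr0 !add0r coefC.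
Qed.

Lemma meval0 (f : {mpoly F[2]}) : f.@[fun _ => 0] = f@_(mono2 0 0).
Proof.
rewrite -[f]toPPK coef_ofPP /= ; have [g [h E]] := constant_term (toPP f).
rewrite {1}E !rmorphD !rmorphM /= /ofPP ev2X ev2Y ev2CC !mevalXU mevalC !mulr0 !add0r.
by rewrite /mono2 !mnmE.
Qed.

(** The converse of [divisor_blow_ups], over any field; it provides the divisor over the complex
    plane. *)
Theorem blow_ups_divisor s : exists E : prime_divisor F, centered_at_origin E /\
  forall f, f != 0 -> pd_val E (evK (@cstK F) (XK F) (YK F) f) = (ordX (sigma s f))%:Z.
Proof.
have [hi hg] := good_XY.
set l := charts (@cstK F) s XY; set uv := coords (@cstK F) s XY.
have lt : (index uv l < size l)%N by rewrite index_mem coords_in_charts.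
have uvE : nth XY l (Ordinal lt) = uv by rewrite nth_index ?coords_in_charts.
have hi' : indep (@cstK F) uv.1 uv.2 := coords_indep hi.
have hg' : generating (@cstK F) uv.1 uv.2 := coords_generating s hi hg.
have [w [wE hw]] := axis_valuation_exists hi' hg'.
have h1 : height_one (chart (n := blow_up_model s) (Ordinal lt)) (axis_ideal (@cstK F) uv.1 uv.2).
  by rewrite /= /blow_up_chart uvE; exact: axis_ideal_height_one.
have h2 : normalized_valuation_of (localization (chart (n := blow_up_model s) (Ordinal lt))
    (axis_ideal (@cstK F) uv.1 uv.2)) w.
  by rewrite /= /blow_up_chart uvE.
exists (PrimeDivisor h1 h2); split=> [f|f f0].
  rewrite [pd_prime _]/= tofrac_evK (ev_coords s _ hi) (axis_idealE hi') sigma_axis.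
  by rewrite coef_toPP meval0.
by rewrite [pd_val _]/= (ev_coords s _ hi) wE // sigma_eq0.
Qed.

Section Discrepancy.
Variables (E : prime_divisor F) (s : seq (bool * F)).
Hypothesis hE : forall f, f != 0 ->
  pd_val E (evK (@cstK F) (XK F) (YK F) f) = (ordX (sigma s f))%:Z.
Local Notation uv := (coords (@cstK F) s XY).

(** A polynomial in the last coordinates need not be a pull-back, but its product with a suitable
    pull-back is one. *)
Lemma pd_val_coords f : f != 0 -> pd_val E (evK (@cstK F) uv.1 uv.2 f) = (ordX f)%:Z.
Proof.
have [hi hg] := good_XY; move=> f0.
have hi' : indep (@cstK F) uv.1 uv.2 := coords_indep hi.
have [a [b [b0 e]]] := hg (evK (@cstK F) uv.1 uv.2 f).
have b0' : b != 0 by move: b0; rewrite (ev_neq0 hi).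
have a0' : a != 0.
  rewrite -(ev_neq0 hi); apply: contraTneq f0 => a0.
  by rewrite negbK -(negbK (f == 0)) -(ev_neq0 hi') e a0 mul0r eqxx.
rewrite e (val_div (pd_is_valuation E)) ?(ev_neq0 hi) // !hE //.
have : sigma s a = f * sigma s b.
  apply: (indep_inj hi'); rewrite rmorphM /= -!(ev_coords s _ hi) e divfK //.
by move=> ->; rewrite ordXM ?sigma_eq0 // PoszD addrK.
Qed.

(** E may live on another model than the one built from s, but its local ring consists of the
    elements of nonnegative value and so equals the axis ring. *)
Lemma discrepancyE : discrepancy E = (disc (shape s))%:Z.
Proof.
have [hi hg] := good_XY; have hw := pd_is_valuation E.
have hi' : indep (@cstK F) uv.1 uv.2 := coords_indep hi.
have hg' : generating (@cstK F) uv.1 uv.2 := coords_generating s hi hg.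
have hJ := jacobian_alternating F.
have hi1 : indep (@cstK F) (XK F) (YK F) := hi.
have j1 : jacobian (XK F) (YK F) != 0 by rewrite jacobianXY oner_neq0.
have [j0 jE] := val_jacobian hw hJ hi1 j1 pd_val_coords.
have [hM _ hO] := pd_valP E.
have OE : pd_local_ring E = axis_ring (@cstK F) uv.1 uv.2.
  have O0 : pd_local_ring E 0.
    have hB := chart_subring (chartP (pd_chart E)); have [hP _ _] := pd_height_one E.
    exact: (subring0 (localization_subring hB hP)).
  have A0 : axis_ring (@cstK F) uv.1 uv.2 0.
    exact: (subring0 (axis_ring_subring hi')).
  apply/seteqP; split=> x; have [->//|x0] := eqVneq x 0.
    by move=> /(hO _ x0)/(integralE hi' hg' hM pd_val_coords x0).
  by move=> /(integralE hi' hg' hM pd_val_coords x0)/(hO _ x0).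
have CE := canonical_axis_ring hi' hJ.
set j := jacobian uv.1 uv.2 in j0 jE CE *.
have jv : pd_val E j^-1 = (disc (shape s))%:Z.
  by rewrite (valV hw) // jE jacobianXY (val1 hw) sub0r opprK.
apply: xget_unique.
  by exists j; split=> //; rewrite OE; exact: CE.
move=> n [h [h0 hE' ->]].
have EQ : [set c * h | c in axis_ring (@cstK F) uv.1 uv.2] =
          [set c * j | c in axis_ring (@cstK F) uv.1 uv.2].
  by rewrite -CE -OE -hE'.
have O1 : axis_ring (@cstK F) uv.1 uv.2 1 by exact: (subring1 (axis_ring_subring hi')).
(* Two generators of the same module divide each other, hence have equal values. *)
have le x y : x != 0 -> y != 0 -> [set c * x | c in axis_ring (@cstK F) uv.1 uv.2] y ->
    pd_val E x <= pd_val E y.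
  move=> x0 y0 [c Oc e]; have c0 : c != 0 by apply: contraNneq y0 => c0; rewrite -e c0 mul0r.
  rewrite -e (valM hw) // lerDr.
  exact/(integralE hi' hg' hM pd_val_coords c0).
rewrite -jv (valV hw h0) (valV hw j0); congr (- _); apply: le_anti; apply/andP; split.
  by apply: (le _ _ h0 j0); rewrite EQ; exists 1; [exact: O1 | rewrite mul1r].
by apply: (le _ _ j0 h0); rewrite -EQ; exists 1; [exact: O1 | rewrite mul1r].
Qed.

End Discrepancy.

End DivisorOfBlowUps.

(** * Generators of ideals and their values *)

Section GeneratedIdeals.
Variable T : comNzRingType.
Implicit Types G I : set T.

Lemma ideal_generated_ideal G : is_ideal setT (ideal_generated setT G).
Proof.
split=> [//|I [[_ I0 _] _] //|a x y _ hx hy I hI].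
by have [[_ _ h] _] := hI; apply: h; [by []|exact: hx|exact: hy].
Qed.

Lemma sub_ideal_generated G : G `<=` ideal_generated setT G.
Proof. exact: sub_smallest. Qed.

Lemma ideal_generated_sub G I : is_ideal setT I -> G `<=` I ->
  ideal_generated setT G `<=` I.
Proof. by move=> hI hG; exact: smallest_sub. Qed.

Lemma idealM I a x : is_ideal setT I -> I x -> I (a * x).
Proof. by move=> [_ I0 h] Ix; rewrite -[_ * _]addr0; exact: h. Qed.

Lemma idealD I x y : is_ideal setT I -> I x -> I y -> I (x + y).
Proof. by move=> [_ _ h] Ix Iy; rewrite -[x]mul1r; exact: h. Qed.

Definition noetherian := forall I, is_ideal setT I ->
  exists gs : seq T, I = ideal_generated setT [set` gs].

Lemma noetherianW : (forall I, is_ideal setT I ->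
  exists2 gs : seq T, [set` gs] `<=` I & I `<=` ideal_generated setT [set` gs]) ->
  noetherian.
Proof.
move=> h I hI; have [gs h1 h2] := h I hI; exists gs; apply/seteqP; split=> //.
exact: ideal_generated_sub.
Qed.

End GeneratedIdeals.

(** * The Hilbert basis theorem *)

Lemma field_noetherian (F : fieldType) : noetherian F.
Proof.
apply: noetherianW => I hI; have [h|/existsNP[x /not_implyP[Ix /eqP x0]]] :=
    pselect (forall x, I x -> x = 0).
  exists [::] => // x /h ->; have [_ h0 _] := ideal_generated_ideal [set` [::] : seq F]; exact: h0.
exists [:: x] => [y|y _]; first by rewrite /= inE => /eqP ->.
rewrite -(mulfVK x0 y); apply: (idealM _ (ideal_generated_ideal _)).
by apply: sub_ideal_generated; rewrite /= inE.
Qed.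

Lemma iso_noetherian (T T' : comNzRingType) (f : {rmorphism T -> T'}) (g : {rmorphism T' -> T}) :
  cancel g f -> cancel f g -> noetherian T -> noetherian T'.
Proof.
move=> gK fK hT; apply: noetherianW => I hI.
have hJ : is_ideal setT [set x | I (f x)].
  split=> [//||a x y _ /= Ix Iy]; first by rewrite /= rmorph0; have [_ h _] := hI.
  by rewrite rmorphD rmorphM; apply: idealD => //; exact: idealM.
have [gs E] := hT _ hJ; exists [seq f x | x <- gs] => [_ /mapP[x hx ->]|y Iy].
  by have : [set x | I (f x)] x by rewrite E; exact: sub_ideal_generated.
have : [set x | I (f x)] (g y) by rewrite /= gK.
rewrite E -{2}(gK y); set G := ideal_generated _ [set` map f gs].
have hG : is_ideal setT G := ideal_generated_ideal _.
apply: (@ideal_generated_sub _ _ [set x | G (f x)]).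
  split=> [//||a x z _ /= Ix Iy']; first by rewrite /= rmorph0; have [_ h _] := hG.
  rewrite /= rmorphD rmorphM; exact: (idealD hG (idealM _ hG Ix) Iy').
by move=> x hx; apply: sub_ideal_generated; exact: map_f.
Qed.

Section HilbertBasis.
Variable T : comNzRingType.
Hypothesis hT : noetherian T.
Variable I : set {poly T}.
Hypothesis hI : is_ideal setT I.

(** Elements of degree less than n contribute 0, which makes this an ideal. *)
Definition lead_ideal n : set T := [set c | exists f, [/\ I f, (size f <= n.+1)%N & f`_n = c]].

Lemma lead_ideal_ideal n : is_ideal setT (lead_ideal n).
Proof.
split=> [//||a _ _ _ [f [If sf <-]] [g [Ig sg <-]]].
  by exists 0; rewrite size_poly0 coef0; split=> //; have [_ h _] := hI.
exists (a%:P * f + g); split; first by have [_ _ h] := hI; exact: h.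
  apply: leq_trans (size_polyD _ _) _; rewrite geq_max sg andbT.
  by rewrite mul_polyC (leq_trans (size_scale_leq _ _)).
by rewrite coefD coefCM.
Qed.

Lemma lead_ideal_le m n : (m <= n)%N -> lead_ideal m `<=` lead_ideal n.
Proof.
move=> mn _ [f [If sf <-]]; exists (f * 'X^(n - m)); split.
- by rewrite mulrC; exact: idealM.
- apply: leq_trans (size_polyMleq _ _) _; rewrite size_polyXn addnS /=.
  by rewrite -[X in (_ <= X.+1)%N](subnK mn) addnC -addnS leq_add2l.
- by rewrite coefMXn ltnNge leq_subr /= subKn.
Qed.

Lemma lead_ideal_stable : exists N, forall n, lead_ideal n `<=` lead_ideal N.
Proof.
have hU : is_ideal setT [set c | exists n, lead_ideal n c].
  split=> [//||a x y _ [m hx] [n hy]]; first by exists 0%N; have [_ h _] := lead_ideal_ideal 0; exact: h.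
  exists (maxn m n); have [_ _ h] := lead_ideal_ideal (maxn m n); apply: h => //.
    exact: (lead_ideal_le (leq_maxl _ _)).
  exact: (lead_ideal_le (leq_maxr _ _)).
have [cs E] := hT hU.
have [N hN] : exists N, forall c, c \in cs -> lead_ideal N c.
  have : forall c, c \in cs -> exists n, lead_ideal n c.
    by move=> c hc; have : [set c | exists n, lead_ideal n c] c by rewrite E; exact: sub_ideal_generated.
  elim: cs {E} => [|c cs IH] h; first by exists 0%N.
  have [N hN] := IH (fun d hd => h d (mem_behead (s := c :: cs) hd)).
  have [n hn] := h c (mem_head _ _).
  exists (maxn n N) => d; rewrite inE => /predU1P[->|/hN hd].
    exact: (lead_ideal_le (leq_maxl _ _)).
  exact: (lead_ideal_le (leq_maxr _ _)).
exists N => n c hc; have : [set c | exists n, lead_ideal n c] c by exists n.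
by rewrite E; apply: ideal_generated_sub => //; exact: lead_ideal_ideal.
Qed.

(** The conclusion is stated for every ideal containing [hs], so that the lists found for different
    n can be concatenated. *)
Lemma lead_ideal_basis n : exists2 hs : seq {poly T}, [set` hs] `<=` I &
  forall G, is_ideal setT G -> [set` hs] `<=` G ->
  forall c, lead_ideal n c -> exists f, [/\ G f, (size f <= n.+1)%N & f`_n = c].
Proof.
have [cs E] := hT (lead_ideal_ideal n).
have : forall c, c \in cs -> lead_ideal n c.
  by move=> c hc; rewrite E; exact: sub_ideal_generated.
have [hs h1 h2] : exists2 hs : seq {poly T},
    forall f, f \in hs -> I f & forall c, lead_ideal n c -> c \in cs ->
    exists f, [/\ f \in hs, (size f <= n.+1)%N & f`_n = c].
  elim: cs {E} => [|c cs [hs h1 h2]]; first by exists [::].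
  have [[f [If sf fn]]|hc] := pselect (lead_ideal n c).
    exists (f :: hs) => [g|d hd]; first by rewrite inE => /predU1P[->|/h1].
    rewrite inE => /predU1P[->|/(h2 _ hd)[g [gh gs gn]]].
      by exists f; rewrite mem_head.
    by exists g; rewrite inE gh orbT.
  exists hs => // d hd; rewrite inE => /predU1P[dc|]; last exact: h2.
  by rewrite dc in hd.
move=> hcs; exists hs => // G hG hsG c; rewrite E.
pose J : set T := [set c | exists f, [/\ G f, (size f <= n.+1)%N & f`_n = c]].
apply: (@ideal_generated_sub _ _ J); last first.
  by move=> d hd; have [f [fh sf fn]] := h2 d (hcs d hd) hd; exists f; split=> //; exact: hsG.
split=> [//||a _ _ _ [f [If sf <-]] [g [Ig sg <-]]].
  by exists 0; rewrite size_poly0 coef0; split=> //; have [_ h _] := hG.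
exists (a%:P * f + g); split; first by have [_ _ h] := hG; exact: h.
  apply: leq_trans (size_polyD _ _) _; rewrite geq_max sg andbT.
  by rewrite mul_polyC (leq_trans (size_scale_leq _ _)).
by rewrite coefD coefCM.
Qed.

Lemma hilbert_basis_aux : exists2 gs : seq {poly T}, [set` gs] `<=` I &
  I `<=` ideal_generated setT [set` gs].
Proof.
have [N hN] := lead_ideal_stable.
have [gs g1 g2] : exists2 gs : seq {poly T}, [set` gs] `<=` I & forall n, (n <= N)%N ->
    forall G, is_ideal setT G -> [set` gs] `<=` G ->
    forall c, lead_ideal n c -> exists f, [/\ G f, (size f <= n.+1)%N & f`_n = c].
  elim: N {hN} => [|N [gs g1 g2]].
    have [hs h1 h2] := lead_ideal_basis 0; exists hs => // n; rewrite leqn0 => /eqP ->; exact: h2.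
  have [hs h1 h2] := lead_ideal_basis N.+1; exists (hs ++ gs) => [f|n].
    by rewrite /= mem_cat => /orP[]; [exact: h1 | exact: g1].
  rewrite leq_eqVlt => /predU1P[->|ltn] G hG hsG.
    by apply: h2 => // f hf; apply: hsG; rewrite /= mem_cat hf.
  by apply: (g2 n ltn) => // f hf; apply: hsG; rewrite /= mem_cat hf orbT.
exists gs => // f If; set G := ideal_generated _ _.
have hG : is_ideal setT G := ideal_generated_ideal _.
have gG : [set` gs] `<=` G := @sub_ideal_generated _ _.
have [m] := ubnP (size f); elim: m f If => // m IH f If; rewrite ltnS => sf.
have [->|f0] := eqVneq f 0; first by have [_ h _] := hG.
have sf0 : (0 < size f)%N by rewrite size_poly_gt0.
pose n := (size f).-1; have sfE : size f = n.+1 by rewrite prednK.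
have lf : lead_ideal n f`_n by exists f; rewrite sfE.
have [h [Gh sh hn]] : exists h, [/\ G h, (size h <= n.+1)%N & h`_n = f`_n].
  have [nN|Nn] := leqP n N; first exact: g2 nN _ hG gG _ lf.
  have [h [Gh sh hn]] := g2 N (leqnn N) _ hG gG _ (hN _ _ lf).
  exists (h * 'X^(n - N)); split.
  - by rewrite mulrC; exact: (idealM _ hG Gh).
  - apply: leq_trans (size_polyMleq _ _) _; rewrite size_polyXn addnS /=.
    by rewrite -[X in (_ <= X.+1)%N](subnK (ltnW Nn)) addnC -addnS leq_add2l.
  - by rewrite coefMXn ltnNge leq_subr /= subKn // ltnW.
have Ih : I h by exact: (ideal_generated_sub hI g1).
(* Here h - f lies in I and has smaller degree than f. *)
have -> : f = (-1) * ((-1) * f + h) + h by rewrite mulrDr mulrA mulN1r opprK mul1r mulN1r subrK.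
apply: (idealD hG (idealM _ hG _) Gh); apply: IH.
  exact: (idealD hI (idealM _ hI If) Ih).
apply: leq_trans _ sf; rewrite sfE ltnS; apply/leq_sizeP => j nj.
rewrite mulN1r coefD coefN; move: nj; rewrite leq_eqVlt => /predU1P[<-|nj].
  by rewrite hn addNr.
by rewrite (nth_default _ (leq_trans sh nj)) addr0 nth_default ?oppr0 // sfE.
Qed.

End HilbertBasis.

Lemma hilbert_basis (T : comNzRingType) : noetherian T -> noetherian {poly T}.
Proof. by move=> hT; apply: noetherianW => I hI; exact: hilbert_basis_aux. Qed.

HB.instance Definition _ (A : comNzRingType) := GRing.RMorphism.on (@toPP A).

Lemma mpoly2_noetherian (F : fieldType) : noetherian {mpoly F[2]}.
Proof.
apply: (@iso_noetherian {poly {poly F}} {mpoly F[2]} (@ofPP F) (@toPP F)).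
- exact: toPPK.
- exact: ofPPK.
- exact/hilbert_basis/hilbert_basis/field_noetherian.
Qed.

Section IdealValues.
Variables (F : fieldType) (E : prime_divisor F) (s : seq (bool * F)).
Hypothesis hE : forall f, f != 0 ->
  pd_val E (evK (@cstK F) (XK F) (YK F) f) = (ordX (sigma s f))%:Z.
Local Notation kx := {mpoly F[2]}.

Lemma toPP_eq0 (f : kx) : (toPP f == 0) = (f == 0).
Proof. by rewrite -(inj_eq (can_inj (@toPPK F))) rmorph0. Qed.

Lemma pd_val_tofrac (f : kx) : f != 0 -> pd_val E (tofrac f) = (ordX (sigma s (toPP f)))%:Z.
Proof. by move=> f0; rewrite tofrac_evK hE // toPP_eq0. Qed.

Lemma V_ideal n : is_ideal setT [set f : kx | V s n (toPP f)].
Proof.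
split=> [//||a x y _ /= hx hy]; first by rewrite /= /V !rmorph0 => i _; rewrite coef0.
by rewrite /V !rmorphD !rmorphM; apply: dvXD => //; exact: dvXMl.
Qed.

Lemma V_ordX n (f : kx) : f != 0 -> V s n (toPP f) <-> (n <= ordX (sigma s (toPP f)))%N.
Proof. by move=> f0; apply: dvX_ordX; rewrite sigma_eq0 toPP_eq0. Qed.

Lemma val_ideal_generated (G : set kx) n : (forall g, G g -> V s n (toPP g)) ->
  (exists2 g, G g & ~ V s n.+1 (toPP g)) -> val_ideal E (ideal_generated setT G) = n%:Z.
Proof.
move=> h1 [g Gg gn].
have g0 : g != 0 by apply/eqP => g0; have [_ h _] := V_ideal n.+1; apply: gn; rewrite g0; exact: h.
have gv : pd_val E (tofrac g) = n%:Z.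
  rewrite pd_val_tofrac //; congr Posz; apply/eqP; rewrite eqn_leq.
  have /V_ordX -> // := h1 g Gg; rewrite andbT leqNgt; apply/negP => lt.
  exact/gn/V_ordX.
have le f : ideal_generated setT G f -> f != 0 -> n%:Z <= pd_val E (tofrac f).
  move=> Gf f0; rewrite pd_val_tofrac // lez_nat; apply/V_ordX => //.
  exact: (ideal_generated_sub (V_ideal n) h1 Gf).
apply: xget_unique.
  by split=> //; exists g; split=> //; exact: sub_ideal_generated.
move=> m [[f [Gf f0 <-]] hm]; apply: le_anti; rewrite le // andbT -gv.
by apply: hm => //; exact: sub_ideal_generated.
Qed.

Lemma nonzero_ideal_order (G : set kx) : (exists2 f, ideal_generated setT G f & f != 0) ->
  exists n, (forall g, G g -> V s n (toPP g)) /\ exists2 g, G g & ~ V s n.+1 (toPP g).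
Proof.
move=> [f Gf f0].
have [g Gg g0] : exists2 g, G g & g != 0.
  apply: contrapT => h; move/eqP: f0; apply; move: Gf.
  apply: (@ideal_generated_sub _ _ [set 0]).
    by split=> [//|//|a x y _ -> ->]; rewrite /= mulr0 addr0.
  by move=> g Gg; apply: contrapT => /eqP g0; apply: h; exists g.
pose P n := `[< exists g, [/\ G g, g != 0 & ordX (sigma s (toPP g)) = n] >].
have exP : exists n, P n by exists (ordX (sigma s (toPP g))); apply/asboolP; exists g.
case: (ex_minnP exP) => n /asboolP[h [Gh h0 hn]] hmin; exists n; split.
  move=> g' Gg'; have [->|g'0] := eqVneq g' 0; first by have [_ h' _] := V_ideal n; exact: h'.
  by apply/V_ordX => //; apply: hmin; apply/asboolP; exists g'.
by exists h => // /(V_ordX _ h0); rewrite hn ltnn.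
Qed.

End IdealValues.

Section ColengthBound.
Variable F : fieldType.

Lemma indep_codim_leq r m (P : {poly {poly F}} -> Prop) :
  indep_mod 'I_m P -> codim_le 'I_r P -> (m <= r)%N.
Proof.
move=> [e eP] [l [lL lP]]; pose M := \matrix_(i < m, j < r) l j (e i).
have l0 j : l j 0 = 0.
  have := lL j 1 0 0; rewrite mulr0 addr0 mul1r => /eqP.
  by rewrite -subr_eq subrr eq_sym => /eqP.
have lsum j (u : 'I_m -> F) : l j (\sum_i CC (u i) * e i) = \sum_i u i * l j (e i).
  elim/big_rec2: _ => [|i y1 y2 _ <-]; [exact: l0 | exact: lL].
suff /eqP <- : row_free M by exact: rank_leq_col.
apply: inj_row_free => v vM; apply/rowP => i; rewrite mxE.
apply: (eP (v 0)) => //; apply: lP => j; rewrite lsum.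
have := congr1 (fun w : 'rV_r => w 0 j) vM; rewrite !mxE; apply: etrans.
by apply: eq_bigr => i' _; rewrite mxE.
Qed.

Lemma codim_le_leq m r (P : {poly {poly F}} -> Prop) : (m <= r)%N ->
  codim_le 'I_m P -> codim_le 'I_r P.
Proof.
move=> mr [l [lL lP]].
exists (fun i f => if insub (val i) is Some j then l j f else 0); split.
  by move=> i a f g; case: insubP => [j _ _|_]; rewrite ?lL // mulr0 addr0.
move=> f h; apply: lP => i; have := h (widen_ord mr i).
by case: insubP => [j _ E|]; [move=> <-; congr (l _ f); exact: val_inj | rewrite /= ltn_ord].
Qed.

End ColengthBound.

(* indep_colength gives an index set depending on s'; the bound on the colength of
   V s n transfers it to a fixed one. *)
Lemma uniform_colength (k K : fieldType) (s : seq (bool * k)) n : exists r,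
  indep_mod 'I_r (V s n) /\
  forall s' : seq (bool * K), shape s = shape s' -> codim_le 'I_r (V s' n).
Proof.
have [I [/indep_mod_ord hi /codim_le_ord hc]] := indep_colength n (erefl (shape s)).
exists #|I|; split=> // s' hs.
have [J [/indep_mod_ord hi' /codim_le_ord hc']] := indep_colength n hs.
exact: codim_le_leq (indep_codim_leq hi' hc) hc'.
Qed.

(** * Liftings *)

Section LiftedIdeals.
Variables (A : comNzRingType) (k K : fieldType).
Variables (phi : {rmorphism A -> k}) (iota : {rmorphism A -> K}).
Hypothesis iota_inj : injective iota.
Variable s : seq (bool * A).
Let sk := [seq (a.1, phi a.2) | a <- s].
Let sK := [seq (a.1, iota a.2) | a <- s].
Local Notation red g := (ofPP (map2 phi g)).
Local Notation lift g := (ofPP (map2 iota g)).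

(** The lifts reduce to nonzero constant multiples of the generators, so they generate the same
    ideal over [k]. A generator of value exactly n has a lift of value exactly n, since reduction
    would carry a larger value down to it. *)
Lemma lift_generators n r (e : 'I_r -> {poly {poly A}}) (gs : seq {poly {poly A}}) :
  (forall u : 'I_r -> k, V sk n (\sum_i CC (u i) * map2 phi (e i)) ->
     forall i, u i = 0) ->
  codim_le 'I_r (V sK n) ->
  (forall f, f \in gs -> V sk n (map2 phi f)) ->
  exists2 G : set {poly {poly A}},
    ideal_generated setT [set red f | f in [set` gs]] =
    ideal_generated setT [set red g | g in G] &
    (forall g, G g -> V sK n (map2 iota g)) /\
    forall f, f \in gs -> ~ V sk n.+1 (map2 phi f) ->
      exists2 g, G g & ~ V sK n.+1 (map2 iota g).
Proof.
move=> he hl hgs.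
pose G : set {poly {poly A}} := [set g | V sK n (map2 iota g) /\
  exists f m, [/\ f \in gs, phi m != 0 & map2 phi g = CC (phi m) * map2 phi f]].
have hG f : f \in gs -> exists g m, [/\ G g, phi m != 0 & map2 phi g = CC (phi m) * map2 phi f].
  move=> fgs; have [g [m [h1 h2 h3]]] := lift_in_V iota_inj he hl (hgs f fgs).
  by exists g, m; split=> //; split=> //; exists f, m.
have ofCC m (f : {poly {poly k}}) : ofPP (CC m * f) = m%:MP * ofPP f.
  by rewrite rmorphM /= /ofPP ev2CC.
exists G; last split=> [g []//|f fgs fn].
  apply/seteqP; split; apply: ideal_generated_sub; try exact: ideal_generated_ideal.
    move=> _ [f fgs <-]; have [g [m [Gg m0 E]]] := hG f fgs.
    have -> : ofPP (map2 phi f) = (phi m)^-1%:MP * ofPP (map2 phi g).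
      by rewrite E ofCC mulrA -mpolyCM mulVf // mpolyC1 mul1r.
    apply: (idealM _ (ideal_generated_ideal _)).
    by apply: sub_ideal_generated; exists g.
  move=> _ [g [_ [f [m [fgs m0 E]]]] <-]; rewrite E ofCC.
  apply: (idealM _ (ideal_generated_ideal _)).
  by apply: sub_ideal_generated; exists f.
have [g [m [Gg m0 E]]] := hG f fgs; exists g => // hV; apply: fn.
have -> : map2 phi f = CC (phi m)^-1 * map2 phi g.
  by rewrite E mulrA -rmorphM mulVf // rmorph1 mul1r.
rewrite /V rmorphM; apply: dvXMl.
exact: (@V_reduce A k K phi iota iota_inj s n.+1 g hV).
Qed.

Section Values.
Variables (E : prime_divisor k) (Et : prime_divisor K).
Hypothesis hE : forall f, f != 0 ->
  pd_val E (evK (@cstK k) (XK k) (YK k) f) = (ordX (sigma sk f))%:Z.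
Hypothesis hEt : forall f, f != 0 ->
  pd_val Et (evK (@cstK K) (XK K) (YK K) f) = (ordX (sigma sK f))%:Z.

Lemma lift_ideal n r (e : 'I_r -> {poly {poly A}}) (gs : seq {poly {poly A}}) :
  (forall u : 'I_r -> k, V sk n (\sum_i CC (u i) * map2 phi (e i)) ->
     forall i, u i = 0) ->
  codim_le 'I_r (V sK n) ->
  (forall f, f \in gs -> V sk n (map2 phi f)) ->
  (exists2 f, f \in gs & ~ V sk n.+1 (map2 phi f)) ->
  exists G : set {poly {poly A}},
    [/\ ideal_generated setT [set red f | f in [set` gs]] =
        ideal_generated setT [set red g | g in G] &
        val_ideal E (ideal_generated setT [set red f | f in [set` gs]]) =
        val_ideal Et (ideal_generated setT [set lift g | g in G])].
Proof.
move=> he hl hgs [f fgs fn].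
have [G GE [G1 G2]] := lift_generators he hl hgs; exists G; split=> //.
rewrite (@val_ideal_generated k E sk hE _ n); last first.
- by exists (ofPP (map2 phi f)); [exists f | rewrite ofPPK].
- by move=> _ [g hg <-]; rewrite ofPPK; exact: hgs.
rewrite (@val_ideal_generated K Et sK hEt _ n) //.
- by move=> _ [g hg <-]; rewrite ofPPK; exact: G1.
- have [g Gg gn] := G2 f fgs fn.
  by exists (ofPP (map2 iota g)); [exists g | rewrite ofPPK].
Qed.

End Values.

End LiftedIdeals.

Section LiftingData.
Variables (k K : fieldType) (s : seq (bool * k)).
Local Notation kx := {mpoly k[2]}.

Definition poly_coefs (f : {poly {poly k}}) : seq k := [seq c | q <- f, c <- (q : {poly k})].

Definition lifting_data : Type := (seq kx * nat * {r : nat & 'I_r -> {poly {poly k}}})%type.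

(** The last clause ranges over all sequences of the same shape because the lifted one is known only
    after the skeleton, which must itself contain the coefficients of these data. *)
Definition data_of (I : set kx) (D : lifting_data) : Prop :=
  let: (gs, n, existT r e) := D in
  [/\ I = ideal_generated setT [set` gs],
      forall f, f \in gs -> V s n (toPP f),
      exists2 f, f \in gs & ~ V s n.+1 (toPP f),
      forall u : 'I_r -> k, V s n (\sum_i CC (u i) * e i) -> forall i, u i = 0 &
      forall s' : seq (bool * K), shape s = shape s' -> codim_le 'I_r (V s' n)].

Definition data_coefs (D : lifting_data) : seq k :=
  let: (gs, n, existT r e) := D in
  flatten [seq poly_coefs (toPP f) | f <- gs] ++
  flatten [seq poly_coefs (e i) | i <- enum 'I_r].

Lemma data_exists I : is_nonzero_ideal I -> exists D, data_of I D.
Proof.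
move=> [hI hn]; have [gs E] := mpoly2_noetherian hI.
have [|n [h1 h2]] := @nonzero_ideal_order k s [set` gs]; first by rewrite -E.
have [r [[e he] hc]] := uniform_colength K s n.
by exists (gs, n, existT _ r e).
Qed.

Lemma lift_poly (A : comNzRingType) (phi : {rmorphism A -> k}) f :
  (forall x, x \in poly_coefs f -> exists a, phi a = x) ->
  exists g : {poly {poly A}}, map2 phi g = f.
Proof.
move=> h; have {}h i j : exists a, phi a = f`_i`_j.
  have [ifs|] := ltnP i (size f); last first.
    by move=> fi; exists 0; rewrite (nth_default 0 fi) coef0 rmorph0.
  have [jfs|fj] := ltnP j (size (f`_i)%R); last first.
    by exists 0; rewrite (nth_default 0 fj) rmorph0.
  apply: h; apply/allpairsPdep; exists (f`_i)%R, (f`_i)`_j.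
  by split=> //; exact: mem_nth.
have [c hc] := choice (fun ij : nat * nat => h ij.1 ij.2).
exists (\poly_(i < size f) \poly_(j < size (f`_i)%R) c (i, j)).
apply/polyP => i; apply/polyP => j; rewrite coef_map2 !coef_poly.
case: ltnP => [_|fi]; last by rewrite coef0 rmorph0 (nth_default 0 fi) coef0.
rewrite coef_poly; case: ltnP => [_|fj]; first exact: hc (i, j).
by rewrite rmorph0 (nth_default 0 fj).
Qed.

End LiftingData.

Section CompatibleSkeletons.
Variables (p : nat) (k : fieldType) (C : closedFieldType).
Hypothesis charC : forall n : int, (n%:~R == 0 :> C) = (n == 0).

Lemma skel_compatible (St : set C) (Phi : C -> k) : skel p St Phi ->
  (0 < p)%N ->
  compatible_skeletons p ([set Phi x | x in St] : set k^o) (St : set C^o) Phi.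
Proof.
move=> hs p0; have [A [iota [phi [inj SE PE]]]] := skel_type hs.
(* The algebra is the field itself, so the constants already generate it. *)
have whole (F : fieldType) (S : set F^o) :
    ring_generated (range (fun c : F => c%:A : F^o) `|` S) = setT.
  apply/seteqP; split=> // x _; apply: sub_ring_generated; left.
  by exists x => //; exact: mulr1.
have hB := skel_ring hs; have [gs gsE] := skel_fg hs.
split.
- split; last exact: whole.
  exists (map Phi gs); apply/seteqP; split.
    pose T : set C := [set x | St x /\ ring_generated [set` map Phi gs] (Phi x)].
    suff h : St `<=` T by move=> _ [x Sx <-]; have [] := h x Sx.
    have hS : is_subring (ring_generated [set` map Phi gs]) := ring_generated_subring _.
    rewrite {1}gsE; apply: ring_generated_sub.
      split.
      - by split; [exact: subring1 | rewrite (skel1 hs); exact: subring1].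
      - move=> x y [Sx hx] [Sy hy].
        have [a aE] := (SE x).1 Sx; have [b bE] := (SE y).1 Sy.
        have E : x - y = iota (a - b) by rewrite rmorphB aE bE.
        split; first by apply/SE; exists (a - b).
        rewrite E PE rmorphB -!PE aE bE; have [_ h _] := hS; exact: h.
      - move=> x y [Sx hx] [Sy hy]; split; first exact: (subringM hB).
        by rewrite (skelM hs) //; exact: (subringM hS).
    move=> x hx; split; first by rewrite gsE; exact: sub_ring_generated.
    by apply: sub_ring_generated; exact: map_f.
  apply: ring_generated_sub.
    split.
    - by exists 1; [exact: subring1 | exact: skel1 hs].
    - move=> _ _ [x Sx <-] [y Sy <-].
      have [a aE] := (SE x).1 Sx; have [b bE] := (SE y).1 Sy.
      exists (iota (a - b)); first by apply/SE; exists (a - b).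
      by rewrite PE rmorphB -!PE aE bE.
    - move=> _ _ [x Sx <-] [y Sy <-].
      by exists (x * y); [exact: (subringM hB) | exact: (skelM hs)].
  move=> _ /mapP[x hx ->]; exists x => //.
  by rewrite gsE; exact: sub_ring_generated.
- by split; [exists gs | exact: whole].
- move=> x _ /eqP; rewrite -mulr_natr mulf_eq0 => /orP[/eqP//|].
  by have := charC p; rewrite -pmulrn => ->; case: (p) p0.
- by split; [exact: skel1 hs | exact: skelD hs | exact: skelM hs].
- by split=> // x; exact: (skel_ker hs).
Qed.

End CompatibleSkeletons.

Lemma coef_mpoly_reduction (n : nat) (A At : comNzRingType) (Phi : At -> A) f m :
  Phi 0 = 0 -> (@mpoly_reduction n A At Phi f)@_m = Phi f@_m.
Proof.
move=> Phi0; rewrite /mpoly_reduction linear_sum /=.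
under eq_bigr do rewrite mcoeffZ mcoeffX.
have [mf|mf] := boolP (m \in msupp f).
  rewrite (bigD1_seq m) ?msupp_uniq //= eqxx mulr1 big1 ?addr0 // => m' ne.
  by rewrite (negPf ne) mulr0.
rewrite (memN_msupp_eq0 mf) Phi0 big_seq big1 // => m' hm'.
by rewrite (negPf (memPn mf _ hm')) mulr0.
Qed.

Theorem corollary1p2 (R : realType) (k : closedFieldType) (p : nat)
    (hp : p \in [pchar k])
    (E : prime_divisor k) (hE : centered_at_origin E)
    (a : set {mpoly k[2]}) (ha : is_nonzero_ideal a)
    (r : nat) (b : 'I_r -> set {mpoly k[2]})
    (hb : forall i, is_nonzero_ideal (b i)) :
  exists (S : set k) (St : set R[i]) (Phi : R[i] -> k),
    compatible_skeletons p (S : set k^o) (St : set R[i]^o) Phi /\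
    let lifts (It : set {mpoly R[i][2]}) (I : set {mpoly k[2]}) :=
      is_lifting (mpoly_skeleton St) (mpoly_reduction Phi) It I in
    exists Et : prime_divisor R[i],
      [/\ centered_at_origin Et,
          discrepancy E = discrepancy Et,
          exists at_ : set {mpoly R[i][2]},
            lifts at_ a /\ val_ideal E a = val_ideal Et at_
        & exists bt : 'I_r -> set {mpoly R[i][2]},
            (forall i, lifts (bt i) (b i)
                       /\ val_ideal E (b i) = val_ideal Et (bt i))
            /\ forall e : 'I_r -> R, (forall i, 0 < e i) ->
                 log_discrepancy E b e = log_discrepancy Et bt e].
Proof.
have [s hs] := divisor_blow_ups hp hE.
(* The ideal a and the b i are treated as one family, so that one skeleton and one lifted divisor
   serve them all. *)
pose I_ (j : option 'I_r) := if j is Some i then b i else a.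
have hI j : is_nonzero_ideal (I_ j) by case: j.
have [D hD] := choice (fun j => data_exists R[i] s (hI j)).
pose xs := map snd s ++ flatten [seq data_coefs (D j) | j <- enum {: option 'I_r}].
have charC (n : int) : (n%:~R == 0 :> R[i]) = (n == 0) by exact: intr_eq0.
have [St [Phi [hSt hxs]]] := skel_exists charC hp (@complex_uncountable R) xs.
have [A [iota [phi [iota_inj SE PE]]]] := skel_type hSt.
have lift x : x \in xs -> exists a, phi a = x.
  by move=> /hxs[y /SE[c <-] <-]; exists c; rewrite PE.
have [sA sAE sAsh] : exists2 sA : seq (bool * A), [seq (c.1, phi c.2) | c <- sA] = s &
    shape s = shape [seq (c.1, iota c.2) | c <- sA].
  have : forall x, x \in map snd s -> exists a, phi a = x.
    by move=> x hx; apply: lift; rewrite mem_cat hx.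
  elim: (s) => [|[c x] s' IH] h; first by exists [::].
  have [sA E1 E2] := IH (fun y hy => h y (mem_behead (s := x :: _) hy)).
  (* To keep the shape, 0 is lifted to 0; a nonzero element has only nonzero lifts. *)
  have [d dx d0] : exists2 d, phi d = x & (x == 0) = (iota d == 0).
    have [->|x0] := eqVneq x 0; first by exists 0; rewrite rmorph0 ?eqxx.
    have [d dx] := h x (mem_head _ _); exists d => //.
    apply/esym/negbTE; apply: contraNneq x0; rewrite -(rmorph0 iota) => /iota_inj d0.
    by rewrite -dx d0 rmorph0.
  exists ((c, d) :: sA); first by rewrite /= E1 dx.
  by rewrite /= E2 d0.
have [Et [hEt hEtv]] := blow_ups_divisor [seq (c.1, iota c.2) | c <- sA].
have skE : forall f, f != 0 -> pd_val E (evK (@cstK k) (XK k) (YK k) f) =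
    (ordX (sigma [seq (c.1, phi c.2) | c <- sA] f))%:Z by rewrite sAE.
have Phi0 : Phi 0 = 0 by rewrite -(rmorph0 iota) PE rmorph0.
have redE (g : {poly {poly A}}) : mpoly_reduction Phi (ofPP (map2 iota g)) = ofPP (map2 phi g).
  by apply/mpolyP => m; rewrite coef_mpoly_reduction // !coef_ofPP !coef_map2 PE.
exists [set Phi x | x in St], St, Phi; split.
  by apply: (skel_compatible charC hSt); exact: (prime_gt0 (pcharf_prime hp)).
move=> lifts; exists Et.
have main j : exists It, lifts It (I_ j) /\ val_ideal E (I_ j) = val_ideal Et It.
  have := hD j; have : {subset data_coefs (D j) <= xs}.
    move=> x hx; rewrite mem_cat; apply/orP; right; apply/flattenP.
    by exists (data_coefs (D j)) => //; apply: map_f; rewrite mem_enum.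
  case: (D j) => [[gs n] [m e]] /= sub [IE h1 h2 h3 h4].
  have [gA gAE] : exists gA : seq {poly {poly A}}, [seq ofPP (map2 phi g) | g <- gA] = gs.
    have : forall f, f \in gs -> exists g, map2 phi g = toPP f.
      move=> f hf; apply: lift_poly => x hx; apply: lift; apply: sub.
      rewrite mem_cat; apply/orP; left; apply/flattenP.
      by exists (poly_coefs (toPP f)) => //; exact: map_f.
    elim: (gs) => [|f gs' IH] h; first by exists [::].
    have [gA E1] := IH (fun g hg => h g (mem_behead (s := f :: _) hg)).
    have [g gE] := h f (mem_head _ _).
    by exists (g :: gA); rewrite /= E1 gE toPPK.
  have eL i : exists g, map2 phi g = e i.
    apply: lift_poly => x hx; apply: lift; apply: sub.
    rewrite mem_cat; apply/orP; right; apply/flattenP.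
    by exists (poly_coefs (e i)) => //; apply: map_f; rewrite mem_enum.
  have [eA eAE] := choice eL.
  have h3' (u : 'I_m -> k) : V [seq (c.1, phi c.2) | c <- sA] n
      (\sum_i CC (u i) * map2 phi (eA i)) -> forall i, u i = 0.
    by under eq_bigr do rewrite eAE; rewrite sAE; exact: h3.
  have h1' g : g \in gA -> V [seq (c.1, phi c.2) | c <- sA] n (map2 phi g).
    move=> hg; rewrite sAE -[map2 phi g]ofPPK; apply: h1; rewrite -gAE.
    exact: map_f.
  have h2' : exists2 g, g \in gA & ~ V [seq (c.1, phi c.2) | c <- sA] n.+1 (map2 phi g).
    have [f] := h2; rewrite -gAE => /mapP[g hg ->]; rewrite ofPPK => hV.
    by exists g => //; rewrite sAE.
  have [G [G1 G2]] := lift_ideal iota_inj skE hEtv h3' (h4 _ sAsh) h1' h2'.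
  have gsE : [set` gs] = [set ofPP (map2 phi f) | f in [set` gA]].
    rewrite -gAE; apply/seteqP; split=> [_ /mapP[g hg ->]|_ [g hg <-]]; first by exists g.
    exact: map_f.
  exists (ideal_generated setT [set ofPP (map2 iota g) | g in G]); split; last first.
    by rewrite IE gsE.
  exists [set ofPP (map2 iota g) | g in G]; split=> //.
    move=> _ [g _ <-] d /=; rewrite coef_ofPP coef_map2; apply/SE; by exists (g`_(d 0)`_(d 1)).
  rewrite IE gsE G1; congr ideal_generated; apply/seteqP; split=> [_ [g Gg <-]|_ [_ [g Gg <-] <-]].
    by exists (ofPP (map2 iota g)); [exists g | exact: redE].
  by exists g => //; rewrite redE.
have discE : discrepancy E = discrepancy Et.
  by rewrite (discrepancyE hs) (discrepancyE hEtv) sAsh.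
split=> //; first exact: (main None).
have [bt hbt] := choice (fun i => main (Some i)).
exists bt; split=> // e _; rewrite /log_discrepancy discE; congr (_ - _).
by apply: eq_bigr => i _; have [_ ->] := hbt i.
Qed.
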